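(* For any $r>\sqrt2\pi/2$ and $q>1$, we have $$\beta^{\ast}_r(q)=\max\left\{\beta>0:\ (q\beta,\beta)\in\Sigma^{D}_r\right\}.$$ Consequently, $$\beta^{\ast}(q)=\sup_{r>\sqrt2\pi/2}\ \max\left\{\beta>0:\ (q\beta,\beta)\in\Sigma^{D}_r\right\}.$$
   Context: Write $v^{\pm}=\max\{\pm v,0\}$. For $r>0$ let $H_0^2(-r,r)=\{v\in H^2(-r,r): v(\pm r)=v'(\pm r)=0\}$, and for $q>1$ let $$S_{r,q}:=\left\{v\in H_0^2(-r,r):\ \int_{-r}^r\left(q(v^+)^2+(v^-)^2\right)dx=1\right\},\qquad \beta_r^{\ast}(q):=\sup_{v\in S_{r,q}}\int_{-r}^r\left(2(v')^2-(v'')^2\right)dx.$$ For $(\alpha,\beta)\in\mathbb{R}^2$, $v\in H^2(\mathbb{R})$ put $J(\alpha,\beta,v):=\int_{\mathbb{R}}\left((v'')^2-2(v')^2+\alpha(v^+)^2+\beta(v^-)^2\right)dx$, and for $q>1$ $$\beta^{\ast}(q):=\sup\{\beta>0:\ \exists v\in H^2(\mathbb{R})\setminus\{0\}:\ J(q\beta,\beta,v)=0\}.$$ The Fučík spectrum $\Sigma^{D}_r$ is the set of all $(\alpha,\beta)\in\mathbb{R}^2$ for which $$v^{(4)}+2v''+\alpha v^+-\beta v^-=0\ \text{ in } (-r,r),\qquad v(\pm r)=v'(\pm r)=0,$$ has a nontrivial (classical) solution. *)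

(* Defs.v *)
From HB Require Import structures.
From mathcomp Require Import all_boot all_order all_algebra.
From mathcomp Require Import all_classical all_reals all_analysis.

Set Implicit Arguments.
Unset Strict Implicit.
Unset Printing Implicit Defensive.

Import Order.TTheory GRing.Theory Num.Theory.
Import numFieldTopology.Exports numFieldNormedType.Exports.

Local Open Scope ring_scope.
Local Open Scope classical_set_scope.

Section SobolevSpaces.
Context {R : realType}.
Local Notation mu := (@lebesgue_measure R).
Implicit Types (D : set R) (u g phi : R -> R).

(** Elements of Sobolev spaces over [D] are represented by everywhere defined
    functions; values outside [D], or on a null subset of [D], are irrelevant. *)

Definition square_integrable D u : Prop :=
  measurable_fun D u /\ mu.-integrable D (fun x => (u x ^+ 2)%:E).

Definition test_function D phi : Prop :=
  (forall n x, derivable (phi^`(n)) x 1) /\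
  (exists2 K : set R, compact K /\ K `<=` D & forall x, ~ K x -> phi x = 0).

Definition is_weak_derivative D u g : Prop :=
  forall phi, test_function D phi ->
    \int[mu]_(x in D) (u x * (phi^`()%classic) x) = - \int[mu]_(x in D) (g x * phi x).

(** A chosen square-integrable weak derivative, unique up to a null set when one
    exists; the default value [0] occurs only outside [sobolevH1]. *)
Definition wderiv D u : R -> R :=
  xget (fun=> 0) [set g | square_integrable D g /\ is_weak_derivative D u g].

Definition sobolevH1 D u : Prop :=
  square_integrable D u /\
  exists2 g, square_integrable D g & is_weak_derivative D u g.

Definition sobolevH2 D u : Prop := sobolevH1 D u /\ sobolevH1 D (wderiv D u).

(** [u(-r) = u(r) = 0], read on the representative of [u] that is continuous on
    [[-r, r]]. *)
Definition vanishes_at_ends (r : R) u : Prop :=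
  exists w : R -> R,
    [/\ {within `[- r, r], continuous w},
        {ae mu, forall x : R, - r < x < r -> u x = w x},
        w (- r) = 0 & w r = 0].

Definition sobolevH20 (r : R) u : Prop :=
  [/\ sobolevH2 `]- r, r[ u,
      vanishes_at_ends r u &
      vanishes_at_ends r (wderiv `]- r, r[ u)].

End SobolevSpaces.

Section VariationalProblems.
Context {R : realType}.
Local Notation mu := (@lebesgue_measure R).

Definition constraint_set (r q : R) : set (R -> R) :=
  [set v | sobolevH20 r v /\
    \int[mu]_(x in `]- r, r[) (q * v^\+ x ^+ 2 + v^\- x ^+ 2) = 1].

Definition clamped_energy (r : R) (v : R -> R) : R :=
  let v1 := wderiv `]- r, r[ v in
  let v2 := wderiv `]- r, r[ v1 in
  \int[mu]_(x in `]- r, r[) (2 * v1 x ^+ 2 - v2 x ^+ 2).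

Definition beta_star_r (r q : R) : \bar R :=
  ereal_sup [set (clamped_energy r v)%:E | v in constraint_set r q].

Definition J (alpha beta : R) (v : R -> R) : R :=
  let v1 := wderiv setT v in
  let v2 := wderiv setT v1 in
  \int[mu]_x (v2 x ^+ 2 - 2 * v1 x ^+ 2
              + alpha * v^\+ x ^+ 2 + beta * v^\- x ^+ 2).

Definition beta_star (q : R) : \bar R :=
  ereal_sup [set beta%:E | beta in [set beta : R | 0 < beta /\
    exists v : R -> R, [/\ sobolevH2 setT v,
      ~ {ae mu, forall x, v x = 0} &
      J (q * beta) beta v = 0]]].

End VariationalProblems.

Section FucikSpectrum.
Context {R : realType}.

(** Classical solution: [v] is C^4 in [(-r, r)], and [v], [v'] extend
    continuously to [[-r, r]] with value [0] at both ends (so that the extension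
    is C^1 there, with one-sided derivative [0] at the ends). *)
Definition classical_solution (r alpha beta : R) (v : R -> R) : Prop :=
  [/\ forall x : R, - r < x < r ->
        forall n, (n < 4)%N -> derivable (v^`(n)) x 1,
      forall x : R, - r < x < r -> {for x, continuous (v^`(4))},
      forall x : R, - r < x < r ->
        v^`(4)%classic x + 2 * v^`(2)%classic x + alpha * v^\+ x - beta * v^\- x = 0 &
      forall n, (n < 2)%N ->
        v^`(n) x @[x --> (- r)^'+] --> (0 : R) /\
        v^`(n) x @[x --> r^'-] --> (0 : R)].

Definition fucik_spectrum (r : R) : set (R * R) :=
  [set ab | exists2 v : R -> R, classical_solution r ab.1 ab.2 v &
    exists2 x : R, - r < x < r & v x != 0].

Definition fucik_ray (r q : R) : set R :=
  [set beta | 0 < beta /\ fucik_spectrum r (q * beta, beta)].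

Definition is_max (A : set R) (m : R) : Prop := A m /\ ubound A m.

End FucikSpectrum.

(* Main.v *)
Require Import Defs.
From mathcomp Require Import all_boot all_order all_algebra.
From mathcomp Require Import all_classical all_reals all_analysis.
From mathcomp Require Import measurable_realfun ring lra.
Set Implicit Arguments.
Unset Strict Implicit.
Unset Printing Implicit Defensive.
Import Order.TTheory GRing.Theory Num.Theory.
Import numFieldTopology.Exports numFieldNormedType.Exports.
Local Open Scope ring_scope.
Local Open Scope classical_set_scope.

(** Write I for the primitive from -r. A function v of H^2 on ]-r, r[ with v
    and v' vanishing at both ends is I (I h) with h = v'' in L^2, subject to
    two linear conditions on h (definition [clamped]; the identification rests
    on the lemma of du Bois-Reymond, which also gives uniqueness of weak
    derivatives). Let E be the integral of 2 (v')^2 - (v'')^2 and M the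
    integral of q (v^+)^2 + (v^-)^2, so that the supremum beta_r^* of E under
    the constraint M = 1 is the best constant in E <= b M.

    The interval. Completing the square in the integral of (v + v'')^2 gives
    E <= M, so the supremum b is finite; for r > sqrt 2 pi / 2 the function
    1 + cos (pi x / r) has E > 0, so b > 0. The functional b M - E is
    nonnegative on the whole space, and a maximising sequence makes it tend to
    0. One step of steepest descent then shows that its gradient tends to 0
    ([euler_lagrange_estimate]): the v_n almost satisfy the equation, integrated
    twice, v'' = l - 2 v - b I (I (q v^+ - v^-)), in which l is the affine
    function that makes the right-hand side clamped. The right-hand side is
    Lipschitz in v for the uniform norm and the v_n are equi-Lipschitz, so a
    uniform cluster point v solves the equation exactly, and v is not zero
    because the v_n, of mass 1, are not uniformly small ([exists_extremal]). By the shape of the equation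
    v is a classical solution, so (q b, b) lies in the Fucik spectrum.
    Conversely, a classical solution for (q b', b') has bounded derivatives up
    to order 4, so it is clamped, and testing the equation against it gives
    E = b' M ([classical_clamped]); hence b' <= b. Therefore b is the maximum
    over the ray ([fucik_max]).

    The line. A solution on ]-r, r[, extended by zero, belongs to H^2 of the
    line and E = b M becomes J (q b) b v = 0 ([zero_extension_J]). Conversely,
    if J (q b) b v = 0 and v is not zero, then E = b M over the line with M > 0.
    The truncations psi (x / n) v are clamped on large intervals, where E is at
    most beta_r^* M, and their E and M converge to those of v by dominated
    convergence. So b is at most the supremum of the beta_r^* ([J_zero_le]). *)

(** * Integrable functions, primitives and integration by parts *)

Section Basics.
Context {R : realType}.
Local Notation mu := (@lebesgue_measure R).
Implicit Types (D : set R) (f g : R -> R).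

Lemma L1D D f g : measurable D -> mu.-integrable D (EFin \o f) ->
  mu.-integrable D (EFin \o g) -> mu.-integrable D (EFin \o (fun x => f x + g x)).
Proof. by move=> mD Hf Hg; exact: (@integrableD _ _ _ mu D _ (EFin \o f) (EFin \o g)). Qed.

Lemma L1B D f g : measurable D -> mu.-integrable D (EFin \o f) ->
  mu.-integrable D (EFin \o g) -> mu.-integrable D (EFin \o (fun x => f x - g x)).
Proof. by move=> mD Hf Hg; exact: (@integrableB _ _ _ mu D _ (EFin \o f) (EFin \o g)). Qed.

Lemma L1Z D f k : measurable D -> mu.-integrable D (EFin \o f) ->
  mu.-integrable D (EFin \o (fun x => k * f x)).
Proof. by move=> mD Hf; exact: (@integrableZl _ _ _ mu D _ k (EFin \o f)). Qed.

Lemma eq_L1 D f g : measurable D -> (forall x, D x -> f x = g x) ->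
  mu.-integrable D (EFin \o f) -> mu.-integrable D (EFin \o g).
Proof.
move=> mD fg; apply: eq_integrable => // x; rewrite inE => Dx /=.
by rewrite fg.
Qed.

Lemma L2_mul D f g : measurable D -> square_integrable D f ->
  square_integrable D g -> mu.-integrable D (EFin \o (fun x => f x * g x)).
Proof.
move=> mD [mf f2] [mg g2].
apply: (@le_integrable _ _ _ mu D _ _ (EFin \o (fun x => f x ^+ 2 + g x ^+ 2))) => //.
- apply/measurable_EFinP; exact: measurable_funM.
- move=> x Dx /=; rewrite lee_fin.
  have : 0 <= f x ^+ 2 + g x ^+ 2 by rewrite addr_ge0// sqr_ge0.
  move=> h; rewrite (ger0_norm h) normrM.
  have := sqr_ge0 (`|f x| - `|g x|); rewrite sqrrB !real_normK ?num_real// => H.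
  have := normr_ge0 (f x * g x); rewrite normrM => H2.
  move: H; rewrite -mulr_natl; lra.
- exact: L1D.
Qed.

Lemma L2Z D f k : measurable D -> square_integrable D f ->
  square_integrable D (fun x => k * f x).
Proof.
move=> mD [mf f2]; split; first exact: measurable_funM.
have := L1Z (k ^+ 2) mD f2.
by apply: eq_L1 => // x _ /=; rewrite exprMn.
Qed.

Lemma L2D D f g : measurable D -> square_integrable D f -> square_integrable D g ->
  square_integrable D (fun x => f x + g x).
Proof.
move=> mD Hf Hg; split; first by apply: measurable_funD; [case: Hf|case: Hg].
have fg := L2_mul mD Hf Hg; case: Hf => mf f2; case: Hg => mg g2.
have := L1D mD (L1D mD f2 g2) (L1Z 2 mD fg).
by apply: eq_L1 => // x _ /=; ring.
Qed.

Lemma L2N D f : measurable D -> square_integrable D f ->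
  square_integrable D (fun x => - f x).
Proof.
move=> mD Hf; have := L2Z (-1) mD Hf.
by under eq_fun do rewrite mulN1r.
Qed.

Lemma L2B D f g : measurable D -> square_integrable D f -> square_integrable D g ->
  square_integrable D (fun x => f x - g x).
Proof. by move=> mD Hf Hg; apply: L2D => //; exact: L2N. Qed.

Lemma L1_measurable D f : mu.-integrable D (EFin \o f) -> measurable_fun D f.
Proof. by move=> /measurable_int/measurable_EFinP. Qed.

Lemma L1_bounded D f M : measurable D -> (mu D < +oo)%E -> measurable_fun D f ->
  (forall x, D x -> `|f x| <= M) -> mu.-integrable D (EFin \o f).
Proof.
move=> mD muD mf fM; apply: measurable_bounded_integrable => //.
exists M; split; first exact: num_real.
by move=> N MN x Dx /=; rewrite (le_trans (fM _ Dx))// ltW.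
Qed.

Lemma L2_bounded D f M : measurable D -> (mu D < +oo)%E -> measurable_fun D f ->
  (forall x, D x -> `|f x| <= M) -> square_integrable D f.
Proof.
move=> mD muD mf fM; split => //.
apply: (@L1_bounded _ (fun x => f x ^+ 2) (M ^+ 2)) => //.
  exact: measurable_funX.
by move=> x Dx; rewrite normrX lerXn2r ?nnegrE// ?fM// (le_trans _ (fM _ Dx)).
Qed.

Lemma L2_L1 D f : measurable D -> (mu D < +oo)%E -> square_integrable D f ->
  mu.-integrable D (EFin \o f).
Proof.
move=> mD muD f2.
have : square_integrable D (cst 1) by apply: (@L2_bounded _ _ 1) => // x _; rewrite normr1.
move=> /(L2_mul mD f2).
by apply: eq_L1 => // x _; rewrite mulr1.
Qed.

Lemma L1_mul_bounded D f g M : measurable D -> mu.-integrable D (EFin \o f) ->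
  measurable_fun D g -> (forall x, D x -> `|g x| <= M) ->
  mu.-integrable D (EFin \o (fun x => f x * g x)).
Proof.
move=> mD f1 mg gM; apply: (@integrableMl _ _ _ mu D _ (EFin \o f) g) => //.
exists M; split; first exact: num_real.
by move=> N MN x Dx /=; rewrite (le_trans (gM _ Dx))// ltW.
Qed.

Lemma L1_EFin D f : measurable D -> mu.-integrable D (EFin \o f) ->
  (\int[mu]_(x in D) (f x)%:E = (\int[mu]_(x in D) f x)%:E)%E.
Proof. by move=> mD f1; rewrite /Rintegral fineK//; apply: integrable_fin_num. Qed.

Lemma L1_subset D D' f : measurable D -> measurable D' -> D' `<=` D ->
  mu.-integrable D (EFin \o f) -> mu.-integrable D' (EFin \o f).
Proof. by move=> mD mD' D'D; apply: integrableS. Qed.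

Lemma L1_restrict D f : measurable D -> mu.-integrable D (EFin \o f) ->
  mu.-integrable setT (EFin \o (f \_ D)).
Proof.
by move=> mD /integrable_mkcond - /(_ mD); rewrite restrict_EFin.
Qed.

Definition prim (a : R) f (x : R) : R := \int[mu]_(t in `[a, x]) f t.

Lemma measurable_fun_le2 :
  measurable_fun setT (fun z : measurableTypeR R * measurableTypeR R => \1_[set w : R | w <= z.1] z.2 : R).
Proof.
have m : measurable_fun setT (fun z : measurableTypeR R * measurableTypeR R => (z.2 <= z.1)%R).
  exact: measurable_fun_ler.
have := @measurable_fun_ifT _ _ _ (measurableTypeR R) (fun=> 1) (fun=> 0) _ m (measurable_cst _) (measurable_cst _).
apply: eq_measurable_fun => -[x y] _ /=.
rewrite indicE /=; case: (boolP (y <= x)) => h; first by rewrite mem_set.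
by rewrite memNset//; exact/negP.
Qed.

(** Fubini on the triangle y <= x. For integrable f and g this is
    integration by parts for absolutely continuous functions. *)
Lemma ibp_prim a b f g : a <= b ->
  mu.-integrable `[a, b] (EFin \o f) -> mu.-integrable `[a, b] (EFin \o g) ->
  \int[mu]_(x in `[a, b]) (f x * prim a g x) =
  \int[mu]_(x in `[a, b]) (g x * (prim a f b - prim a f x)).
Proof.
move=> ab f1 g1.
pose C : set R := `[a, b]%classic; pose h (z : measurableTypeR R * measurableTypeR R) : R :=
  (f \_ C) z.1 * (g \_ C) z.2 * \1_[set w : R | w <= z.1] z.2.
have leE (x y : R) : (\1_[set w : R | w <= x] y : R) = (y <= x)%R%:R.
  by rewrite indicE; congr ((nat_of_bool _)%:R); apply/idP/idP; rewrite inE.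
have geE (x y : R) : (\1_[set w : R | y <= w] x : R) = (y <= x)%R%:R.
  by rewrite indicE; congr ((nat_of_bool _)%:R); apply/idP/idP; rewrite inE.
have pE (u : R -> R) (c d x : R) : (u \_ `[c, d]) x = u x * (c <= x <= d)%R%:R.
  rewrite patchE mem_setE in_itv/=; case: ifPn => _; first by rewrite mulr1.
  by rewrite mulr0.
have gE x : C x -> \int[mu]_y ((g \_ C) y * \1_[set w : R | w <= x] y) = prim a g x.
  rewrite /C/= in_itv/= => /andP[ax xb].
  rewrite /prim [RHS]Rintegral_mkcond; apply: eq_Rintegral => y _.
  rewrite leE !pE -mulrA -natrM mulnb; congr (_ * (nat_of_bool _)%:R).
  by case: (a <= y) => //=; apply/andP/idP => [[]//|yx]; rewrite yx (le_trans yx xb).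
have fE y : C y -> \int[mu]_x ((f \_ C) x * \1_[set w : R | y <= w] x) = prim a f b - prim a f y.
  rewrite /C/= in_itv/= => /andP[ay yb].
  rewrite /prim Rintegral_itvB ?bnd_simp// Rintegral_itv_obnd_cbnd; last first.
    by apply: L1_subset f1 => //; apply: subset_itvr; rewrite bnd_simp.
  rewrite [RHS]Rintegral_mkcond; apply: eq_Rintegral => x _.
  rewrite geE !pE -mulrA -natrM mulnb; congr (_ * (nat_of_bool _)%:R).
  apply/andP/andP => [[/andP[_ ->] ->]//|[yx ->]]; by rewrite yx (le_trans ay yx).
have F1 := L1_restrict (measurable_itv _) f1.
have G1 := L1_restrict (measurable_itv _) g1.
have mf : measurable_fun (setT : set R) (f \_ C) := L1_measurable F1.
have mg : measurable_fun (setT : set R) (g \_ C) := L1_measurable G1.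
have mind (P : set R) : measurable P -> measurable_fun setT (\1_P : R -> R) by move=> ?; exact: measurable_indic.
have mle (x : R) : measurable [set w : R | w <= x].
  rewrite -set_itvNyc. exact: measurable_itv.
have mge (x : R) : measurable [set w : R | x <= w].
  by rewrite -set_itvcy; exact: measurable_itv.
have bind (P : set R) (x : R) : setT x -> `|\1_P x : R| <= 1.
  by move=> _; rewrite indicE; case: (x \in P); rewrite ?normr1 ?normr0.
have mh : measurable_fun setT h.
  apply: measurable_funM; last exact: measurable_fun_le2.
  apply: measurable_funM.
    exact: (@measurableT_comp _ _ _ _ (measurableTypeR R) R (f \_ C) _ fst).
  exact: (@measurableT_comp _ _ _ _ (measurableTypeR R) R (g \_ C) _ snd).
have gle1 x : mu.-integrable setT (EFin \o (fun y => (g \_ C) y * \1_[set w : R | w <= x] y)).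
  apply: (@L1_mul_bounded _ _ _ 1) => //.
  by move=> ? _; exact: bind.
have fge1 y : mu.-integrable setT (EFin \o (fun x => (f \_ C) x * \1_[set w : R | y <= w] x)).
  by apply: (@L1_mul_bounded _ _ _ 1) => // ? _; exact: bind.
have hx x : (\int[mu]_y (h (x, y))%:E = ((f \_ C) x * \int[mu]_y ((g \_ C) y * \1_[set w : R | w <= x] y))%:E)%E.
  rewrite -RintegralZl// -L1_EFin//; last exact: L1Z.
  by apply: eq_integral => y _; rewrite /h mulrA.
have hy y : (\int[mu]_x (h (x, y))%:E = ((g \_ C) y * \int[mu]_x ((f \_ C) x * \1_[set w : R | y <= w] x))%:E)%E.
  rewrite -RintegralZl// -L1_EFin//; last exact: L1Z.
  apply: eq_integral => x _; rewrite /h /= mulrA [_ * (g \_ C) y]mulrC.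
  by congr (_ * _)%:E; rewrite !indicE.
have N1 : mu.-integrable setT (EFin \o (fun x => `|(f \_ C) x|)) by exact: integrable_norm.
have N2 : mu.-integrable setT (EFin \o (fun x => `|(g \_ C) x|)) by exact: integrable_norm.
have ih : (mu \x mu)%E.-integrable setT (EFin \o h).
  apply/integrable12ltyP; first exact/measurable_EFinP.
  apply: (@le_lt_trans _ _ (\int[mu]_x (`|(f \_ C) x| * \int[mu]_y `|(g \_ C) y|)%:E)%E); last first.
    rewrite L1_EFin// ?ltry//.
    have := L1Z (\int[mu]_y `|(g \_ C) y|) measurableT N1.
    by apply: eq_L1 => // x _; rewrite mulrC.
  have mh' : measurable_fun setT (abse \o (EFin \o h)).
    by apply: measurableT_comp => //; exact/measurable_EFinP.
  apply: ge0_le_integral => //.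
  + by move=> x _; exact: integral_ge0.
  + exact: (measurable_fun_fubini_tonelli_F (m2 := mu) _ mh' (fun z => abse_ge0 _)).
  + by apply/measurable_EFinP; apply: measurable_funM => //; exact: measurableT_comp.
  + move=> x _.
    rewrite -RintegralZl// -L1_EFin//; last exact: L1Z.
    apply: ge0_le_integral => //=.
    * by apply/measurable_EFinP; apply: measurableT_comp => //; apply: measurableT_comp mh _; exact: pair1_measurable.
    * by apply/measurable_EFinP; apply: measurable_funM => //; exact: measurableT_comp.
    * move=> y _; rewrite lee_fin /h !normrM/= ler_piMr ?mulr_ge0//; exact: bind.
have F2 := Fubini ih.
have {F2} : (\int[mu]_x (((f \_ C) x * \int[mu]_y ((g \_ C) y * \1_[set w : R | w <= x] y))%:E) =
  \int[mu]_y ((g \_ C) y * \int[mu]_x ((f \_ C) x * \1_[set w : R | y <= w] x))%:E)%E.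
  rewrite -(eq_integral _ _ (fun x _ => hx x)) -(eq_integral _ _ (fun x _ => hy x)).
  exact: F2.
move=> /(congr1 fine) FF.
rewrite [LHS]Rintegral_mkcond [RHS]Rintegral_mkcond.
transitivity (\int[mu]_x ((f \_ C) x * \int[mu]_y ((g \_ C) y * \1_[set w : R | w <= x] y))).
  apply: eq_Rintegral => x _; rewrite !patchE; case: ifPn => xC; last by rewrite mul0r.
  by move: xC; rewrite inE => Cx; rewrite (gE x Cx).
transitivity (\int[mu]_y ((g \_ C) y * \int[mu]_x ((f \_ C) x * \1_[set w : R | y <= w] x))); first exact: FF.
apply: eq_Rintegral => x _; rewrite !patchE; case: ifPn => xC; last by rewrite mul0r.
by move: xC; rewrite inE => Cx; rewrite (fE x Cx).
Qed.

Lemma prim_left (a : R) f : prim a f a = 0.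
Proof. by rewrite /prim set_itv1 Rintegral_set1. Qed.

Lemma prim_sub (a b x y : R) f : mu.-integrable `[a, b] (EFin \o f) ->
  a <= x -> x <= y -> y <= b -> prim a f y - prim a f x = \int[mu]_(t in `[x, y]) f t.
Proof.
move=> f1 ax xy yb.
have fy : mu.-integrable `[a, y] (EFin \o f).
  by apply: L1_subset f1 => //; apply: subset_itvl; rewrite bnd_simp.
rewrite /prim Rintegral_itvB ?bnd_simp// Rintegral_itv_obnd_cbnd//.
by apply: L1_subset fy => //; apply: subset_itvr; rewrite bnd_simp.
Qed.

Lemma prim_cont (a b : R) f : a <= b -> mu.-integrable `[a, b] (EFin \o f) ->
  {within `[a, b], continuous (prim a f)}.
Proof. by move=> ab f1; exact: parameterized_integral_continuous. Qed.

Lemma prim_meas (a b : R) f : a <= b -> mu.-integrable `[a, b] (EFin \o f) ->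
  measurable_fun `[a, b] (prim a f).
Proof.
by move=> ab f1; apply: subspace_continuous_measurable_fun => //; exact: prim_cont.
Qed.

Lemma le_norm_prim (a b x : R) f : mu.-integrable `[a, b] (EFin \o f) ->
  x <= b -> `|prim a f x| <= \int[mu]_(t in `[a, b]) `|f t|.
Proof.
move=> f1 xb.
have sub : `[a, x] `<=` `[a, b] by apply: subset_itvl; rewrite bnd_simp.
have f1x : mu.-integrable `[a, x] (EFin \o f) by apply: L1_subset f1.
apply: (le_trans (le_normr_Rintegral _ _)) => //.
rewrite -lee_fin -!L1_EFin//; try exact: integrable_norm.
apply: ge0_subset_integral => //=.
by apply/measurable_EFinP; apply: measurableT_comp => //; exact: L1_measurable f1.
Qed.

Lemma L1_prim (a b : R) f : a <= b -> mu.-integrable `[a, b] (EFin \o f) ->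
  mu.-integrable `[a, b] (EFin \o prim a f).
Proof.
move=> ab f1; apply: (@L1_bounded _ _ (\int[mu]_(t in `[a, b]) `|f t|)) => //.
- by rewrite lebesgue_measure_itv; case: ifP; rewrite ?ltry// -EFinB ltry.
- exact: prim_meas.
- move=> x; rewrite /= in_itv/= => /andP[_ xb]; exact: le_norm_prim.
Qed.

Lemma L2_prim (a b : R) f : a <= b -> mu.-integrable `[a, b] (EFin \o f) ->
  square_integrable `[a, b] (prim a f).
Proof.
move=> ab f1; apply: (@L2_bounded _ _ (\int[mu]_(t in `[a, b]) `|f t|)) => //.
- by rewrite lebesgue_measure_itv; case: ifP; rewrite ?ltry// -EFinB ltry.
- exact: prim_meas.
- move=> x; rewrite /= in_itv/= => /andP[_ xb]; exact: le_norm_prim.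
Qed.

Lemma itv_fin (a b : R) : (mu `[a, b] < +oo)%E.
Proof. by rewrite lebesgue_measure_itv; case: ifP; rewrite ?ltry// -EFinB ltry. Qed.

Lemma ibp_prim0 a b f g : a <= b ->
  mu.-integrable `[a, b] (EFin \o f) -> mu.-integrable `[a, b] (EFin \o g) ->
  \int[mu]_(x in `[a, b]) (f x * prim a g x) =
  prim a f b * prim a g b - \int[mu]_(x in `[a, b]) (prim a f x * g x).
Proof.
move=> ab f1 g1; rewrite ibp_prim//.
have gf1 : mu.-integrable `[a, b] (EFin \o (fun x => g x * prim a f x)).
  apply: (@L1_mul_bounded _ _ _ (\int[mu]_(t in `[a, b]) `|f t|)) => //.
    exact: prim_meas.
  by move=> x; rewrite /= in_itv/= => /andP[_ xb]; exact: le_norm_prim.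
under eq_Rintegral do rewrite mulrBr.
rewrite RintegralB//; last by apply: (eq_L1 _ _ (L1Z (prim a f b) _ g1)) => // x _; rewrite mulrC.
rewrite RintegralZr// mulrC; congr (_ - _).
by apply: eq_Rintegral => x _; rewrite mulrC.
Qed.

(** The constants of integration c and d are free because a function is
    recovered from its weak derivative only up to a constant. *)
Lemma ibp a b c d f g : a <= b ->
  mu.-integrable `[a, b] (EFin \o f) -> mu.-integrable `[a, b] (EFin \o g) ->
  \int[mu]_(x in `[a, b]) (f x * (d + prim a g x)) =
  (c + prim a f b) * (d + prim a g b) - c * d
  - \int[mu]_(x in `[a, b]) ((c + prim a f x) * g x).
Proof.
move=> ab f1 g1.
have bP u x : mu.-integrable `[a, b] (EFin \o u) -> `[a, b]%classic x -> `|prim a u x| <= \int[mu]_(t in `[a, b]) `|u t|.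
  by move=> u1; rewrite /= in_itv/= => /andP[_ xb]; exact: le_norm_prim.
have fg : mu.-integrable `[a, b] (EFin \o (fun x => f x * prim a g x)).
  by apply: L1_mul_bounded => //; [exact: prim_meas|move=> x; exact: bP].
have gf : mu.-integrable `[a, b] (EFin \o (fun x => prim a f x * g x)).
  apply: (eq_L1 _ (fun x _ => mulrC (g x) (prim a f x))) => //.
  by apply: L1_mul_bounded => //; [exact: prim_meas|move=> x; exact: bP].
under eq_Rintegral do rewrite mulrDr.
under [in RHS]eq_Rintegral do rewrite mulrDl.
rewrite RintegralD//; last by apply: (eq_L1 _ _ (L1Z d _ f1)) => // x _; rewrite mulrC.
rewrite [in RHS]RintegralD//; last exact: L1Z.
rewrite RintegralZr// RintegralZl// ibp_prim0// -!/(prim a _ b).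
ring.
Qed.

Lemma primD (a b x : R) f g : mu.-integrable `[a, b] (EFin \o f) ->
  mu.-integrable `[a, b] (EFin \o g) -> x <= b ->
  prim a (fun t => f t + g t) x = prim a f x + prim a g x.
Proof.
move=> f1 g1 xb; rewrite /prim RintegralD//.
  by apply: L1_subset f1 => //; apply: subset_itvl; rewrite bnd_simp.
by apply: L1_subset g1 => //; apply: subset_itvl; rewrite bnd_simp.
Qed.

Lemma primZ (a b x k : R) f : mu.-integrable `[a, b] (EFin \o f) -> x <= b ->
  prim a (fun t => k * f t) x = k * prim a f x.
Proof.
move=> f1 xb; rewrite /prim RintegralZl//.
by apply: L1_subset f1 => //; apply: subset_itvl; rewrite bnd_simp.
Qed.

Lemma eq_prim (a x : R) f g : (forall t, a <= t <= x -> f t = g t) ->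
  prim a f x = prim a g x.
Proof.
by move=> fg; apply: eq_Rintegral => t; rewrite inE/= in_itv/=; exact: fg.
Qed.

End Basics.

(** * Smooth functions and smooth steps *)

Section Smooth.
Context {R : realType}.
Local Notation mu := (@lebesgue_measure R).
Implicit Types (D : set R) (f g : R -> R).

Definition smooth f := forall n (x : R), derivable (f^`(n)) x 1.

(** Smoothness by coinduction: a class of functions that is stable under
    differentiation consists of smooth functions. *)
Lemma smooth_coind (C : set (R -> R)) :
  (forall f, C f -> exists2 g, C g & forall x : R, is_derive x 1 f (g x)) ->
  forall f, C f -> smooth f.
Proof.
move=> H f Cf n; have : C f^`(n).
  elim: n => [//|n IH]; have [g Cg fg] := H _ IH.
  rewrite derive1nS (_ : (f^`(n))^`() = g)//.
  by apply/funext => x; rewrite derive1E; apply: derive_val.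
by move=> /H[g _ fg] x; have := fg x; case.
Qed.

Lemma smooth_is_derive f : smooth f -> forall x : R, is_derive x 1 f ((derive1 f) x).
Proof. by move=> sf x; apply: DeriveDef; [exact: (sf 0%N)|rewrite derive1E]. Qed.

Lemma smooth_derive1 f : smooth f -> smooth (derive1 f).
Proof. by move=> sf n; have := sf n.+1; rewrite derive1Sn. Qed.

Lemma smooth_continuous f : smooth f -> continuous f.
Proof.
by move=> sf x; apply: differentiable_continuous; apply/derivable1_diffP; exact: (sf 0%N).
Qed.

(** By the Leibniz rule this class is stable under differentiation, which
    single products are not. *)
Inductive prodsum : (R -> R) -> Prop :=
| prodsum_mul f g : smooth f -> smooth g -> prodsum (fun x => f x * g x)
| prodsum_add f g : prodsum f -> prodsum g -> prodsum (fun x => f x + g x).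

Lemma smooth_prodsum f : prodsum f -> smooth f.
Proof.
apply: smooth_coind => {}f; elim => {f} [f g sf sg|f g _ [f' Cf' ff'] _ [g' Cg' gg']].
  exists (fun x => f x * (derive1 g) x + g x * (derive1 f) x).
    apply: (@prodsum_add (fun x => f x * (derive1 g) x) (fun x => g x * (derive1 f) x)).
      exact: prodsum_mul sf (smooth_derive1 sg).
    exact: prodsum_mul sg (smooth_derive1 sf).
  move=> x; have df := smooth_is_derive sf x; have dg := smooth_is_derive sg x.
  exact: is_deriveM.
by exists (fun x => f' x + g' x); [exact: prodsum_add|move=> x; apply: is_deriveD].
Qed.

Lemma smoothM f g : smooth f -> smooth g -> smooth (fun x => f x * g x).
Proof. by move=> sf sg; apply: smooth_prodsum; exact: prodsum_mul. Qed.

Lemma smoothD f g : smooth f -> smooth g -> smooth (fun x => f x + g x).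
Proof.
move=> sf sg.
apply: (@smooth_coind [set h | exists f g, [/\ smooth f, smooth g & h = (fun x => f x + g x)]]); last by exists f, g.
move=> _ [{sf}{}f [{sg}{}g [sf sg ->]]]; exists (fun x => (derive1 f) x + (derive1 g) x).
  by exists (derive1 f), (derive1 g); split; [exact: smooth_derive1 sf|exact: smooth_derive1 sg|].
by move=> x; have df := smooth_is_derive sf x; have dg := smooth_is_derive sg x; apply: is_deriveD.
Qed.

Lemma smooth_affine f (k c d : R) : smooth f -> smooth (fun x => k * f (c * x + d)).
Proof.
move=> sf; apply: (@smooth_coind [set h | exists k f, smooth f /\ h = (fun x => k * f (c * x + d))]); last by exists k, f.
move=> _ [{}k [{sf}{}f [sf ->]]]; exists (fun x => (k * c) * (derive1 f) (c * x + d)).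
  by exists (k * c), (derive1 f); split; [exact: smooth_derive1 sf|].
move=> x; have df := smooth_is_derive sf (c * x + d).
have da : is_derive x 1 (fun x : R => c * x + d) c.
  have := is_deriveD (is_deriveZ c (is_derive_id x (1 : R))) (is_derive_cst d x (1 : R)).
  by move=> /is_derive_eq; apply; rewrite addr0 /GRing.scale/= mulr1.
have := @is_derive1_comp _ f (fun x : R => c * x + d) x _ _ df da.
move=> fc; apply: (is_derive_eq (is_deriveZ k fc)).
by rewrite /GRing.scale/=; ring.
Qed.

Lemma smoothB f g : smooth f -> smooth g -> smooth (fun x => f x - g x).
Proof.
move=> sf sg0; have sg := @smooth_affine g (-1) 1 0 sg0.
have := smoothD sf sg; congr smooth; apply/funext => x.
by rewrite mulN1r mul1r addr0.
Qed.

(** The functions x^-n exp(-1/x), extended by 0 to x <= 0, form together a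
    family whose linear span is stable under differentiation; flat 0 is the
    classical smooth function that is not analytic at 0. *)
Definition flat n (x : R) : R := if 0 < x then x ^- n * expR (- x^-1) else 0.

Lemma is_derive0_sq f (M : R) : f 0 = 0 -> (forall x, `|f x| <= M * x ^+ 2) ->
  is_derive (0 : R) 1 f 0.
Proof.
move=> f0 fM.
suff h : (fun h : R => h^-1 *: ((f \o shift 0) (h *: (1 : R)) - f 0)) @ 0^' --> (0 : R).
  by apply: DeriveDef; [apply/cvg_ex; exists 0|exact: cvg_lim h].
apply/cvgr0Pnorm_lt => e e0.
have M0 : 0 <= M by have := fM 1; rewrite expr1n mulr1; exact: le_trans.
have d0 : 0 < e / (M + 1) by rewrite divr_gt0// ltr_wpDl.
near=> h.
have h0 : h != 0 by near: h; exact: nbhs_dnbhs_neq.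
rewrite /= f0 subr0 addr0 /GRing.scale/= mulr1 normrM normfV.
apply: (@le_lt_trans _ _ (M * `|h|)).
  rewrite mulrC ler_pdivrMr ?normr_gt0// -mulrA -expr2 real_normK ?num_real//.
apply: (@le_lt_trans _ _ ((M + 1) * `|h|)).
  by rewrite ler_wpM2r// lerDl.
rewrite mulrC -ltr_pdivlMr ?ltr_wpDl//.
near: h; apply: dnbhs0_lt; exact: d0.
Unshelve. all: by end_near. Qed.

(** Follows from y^(n+2) / (n+2)! <= exp y at y = 1/x. A quadratic bound at
    0 is all that the derivative at 0 requires. *)
Lemma flat_le n (x : R) : `|flat n x| <= n.+2`!%:R * x ^+ 2.
Proof.
rewrite /flat; case: ifPn => [x0|_]; last by rewrite normr0 mulr_ge0// sqr_ge0.
rewrite ger0_norm; last by rewrite mulr_ge0 ?expR_ge0 ?invr_ge0 ?exprn_ge0// ltW.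
have h : 1 + x^-1 ^+ n.+2 / (n.+2)`!%:R <= expR x^-1.
  by apply: expR_ge1Dxn; rewrite invr_ge0 ltW.
have F0 : 0 < n.+2`!%:R :> R by rewrite ltr0n fact_gt0.
move: (n.+2`!%:R) F0 h => F F0 h.
rewrite expRN ler_pdivrMr ?expR_gt0//.
apply: (@le_trans _ _ (F * x ^+ 2 * (x^-1 ^+ n.+2 / F))); last first.
  rewrite ler_wpM2l//; first by rewrite mulr_ge0 ?sqr_ge0// ltW.
  by rewrite (le_trans _ h)// lerDr.
rewrite le_eqVlt; apply/orP; left; apply/eqP; rewrite exprVn -[n.+2]addn2 exprD.
have xn : x ^+ n != 0 by rewrite expf_neq0// gt_eqF.
move: (x ^+ n) xn => X X0; field; rewrite X0 !gt_eqF//.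
Qed.

Lemma is_derive_flat n (x : R) :
  is_derive x 1 (flat n) (- n%:R * flat n.+1 x + flat n.+2 x).
Proof.
have [x0|x0|->] := ltgtP x 0.
- rewrite /flat ltNge (ltW x0)/= mulr0 addr0.
  apply: near_eq_is_derive (is_derive_cst (0 : R) x (1 : R)).
  near=> y; rewrite ltNge ifN// negbK ltW//.
  by near: y; exact: lt_nbhsl.
- have dV : is_derive x 1 (fun y : R => y^-1) (- x ^- 2).
    have xn0 : id x != 0 by rewrite gt_eqF.
    apply: (is_derive_eq (is_deriveV xn0 (is_derive_id x (1 : R)))).
    by rewrite /GRing.scale/= mulr1.
  have dE : is_derive x 1 (fun y => expR (- y^-1)) (expR (- x^-1) * x ^- 2).
    have dNV := is_deriveN dV.
    apply: (is_derive_eq (@is_derive1_comp _ expR (fun y => - y^-1) x _ _ _ dNV)).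
    by rewrite opprK.
  have dX : is_derive x 1 (fun y => y ^- n) (- n%:R * x ^- n.+1).
    apply: (@near_eq_is_derive _ _ _ ((fun y : R => y^-1) ^+ n)).
      by near=> y; rewrite /= exprfctE exprVn.
    apply: (is_derive_eq (is_deriveX n dV)).
    rewrite /GRing.scale/=; case: (n) => [|m]; first by rewrite !mul0r oppr0 mul0r.
    by rewrite -pred_Sn mulrN mulNr -mulrA; congr (- (_ * _)); rewrite exprVn -invfM -exprD addn2.
  have dP : is_derive x 1 (fun y => y ^- n * expR (- y^-1)) (- n%:R * flat n.+1 x + flat n.+2 x).
    apply: (is_derive_eq (is_deriveM dX dE)).
    rewrite /flat x0 /GRing.scale/= addrC.
    have -> : x ^- n.+2 = x ^- n * x ^- 2 by rewrite -invfM -exprD addn2.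
    by move: (expR _) (x ^- n.+1) (x ^- n) (x ^- 2) (n%:R) => *; ring.
  apply: near_eq_is_derive dP.
  near=> y; rewrite /flat ifT//.
  by near: y; exact: lt_nbhsr.
- rewrite {2 3}/flat ltxx mulr0 addr0.
  by apply: (is_derive0_sq _ (flat_le n)); rewrite /flat ltxx.
Unshelve. all: by end_near. Qed.

(** The linear span of the family flat n, the class to which coinduction
    applies. *)
Inductive flatsum : (R -> R) -> Prop :=
| flatsum1 k n : flatsum (fun x => k * flat n x)
| flatsumD f g : flatsum f -> flatsum g -> flatsum (fun x => f x + g x).

Lemma smooth_flat : smooth (flat 0).
Proof.
apply: (@smooth_coind flatsum); last first.
  by rewrite (_ : flat 0 = (fun x => 1 * flat 0 x)); [exact: flatsum1|apply/funext => x; rewrite mul1r].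
move=> f; elim => {f} [k n|f g _ [f' Cf' ff'] _ [g' Cg' gg']].
  exists (fun x => (k * - n%:R) * flat n.+1 x + k * flat n.+2 x).
    by apply: flatsumD; exact: flatsum1.
  move=> x; apply: (is_derive_eq (is_deriveZ k (is_derive_flat n x))).
  by rewrite /GRing.scale/= mulrDr mulrA.
by exists (fun x => f' x + g' x); [exact: flatsumD|move=> x; apply: is_deriveD].
Qed.

Lemma Rintegral_dominated D (f_ : nat -> R -> R) f g : measurable D ->
  (forall n, measurable_fun D (f_ n)) -> measurable_fun D f ->
  (forall x, D x -> f_ n x @[n --> \oo] --> f x) ->
  mu.-integrable D (EFin \o g) -> (forall n x, D x -> `|f_ n x| <= g x) ->
  mu.-integrable D (EFin \o f) /\
  (\int[mu]_(x in D) f_ n x) @[n --> \oo] --> \int[mu]_(x in D) f x.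
Proof.
move=> mD mf_ mf f_f ig f_g.
have [] := @dominated_convergence _ _ _ mu D mD (fun n => EFin \o f_ n) (EFin \o f) (EFin \o g).
- by move=> n; apply/measurable_EFinP; exact: mf_.
- by apply/measurable_EFinP; exact: mf.
- by apply: aeW => x Dx; apply: cvg_EFin; [exact: nearW|exact: f_f].
- exact: ig.
- by apply: aeW => x n Dx; rewrite /= lee_fin; exact: f_g.
move=> if_ _ H; split => //.
have if_n n : mu.-integrable D (EFin \o f_ n).
  apply: le_integrable ig => //; first by apply/measurable_EFinP; exact: mf_.
  by move=> x Dx /=; rewrite lee_fin (le_trans (f_g _ _ Dx))// ler_norm.
apply: fine_cvg; move: H; rewrite -L1_EFin//; exact.
Qed.

Definition bell (x : R) := flat 0 x * flat 0 (1 - x).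

Lemma smooth_bell : smooth bell.
Proof.
apply: smoothM; first exact: smooth_flat.
have := @smooth_affine (flat 0) 1 (-1) 1 smooth_flat.
by congr smooth; apply/funext => x; rewrite mul1r mulN1r addrC.
Qed.

Lemma flat_ge0 n x : 0 <= flat n x.
Proof.
by rewrite /flat; case: ifPn => // x0; rewrite mulr_ge0 ?expR_ge0 ?invr_ge0 ?exprn_ge0// ltW.
Qed.

Lemma flat_gt0 n x : 0 < x -> 0 < flat n x.
Proof. by rewrite /flat => x0; rewrite x0 mulr_gt0 ?expR_gt0 ?invr_gt0 ?exprn_gt0. Qed.

Lemma flat_eq0 n x : x <= 0 -> flat n x = 0.
Proof. by rewrite /flat ltNge => ->. Qed.

Lemma bell_ge0 x : 0 <= bell x.
Proof. by rewrite mulr_ge0 ?flat_ge0. Qed.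

Lemma bell_gt0 x : 0 < x < 1 -> 0 < bell x.
Proof. by move=> /andP[x0 x1]; rewrite mulr_gt0 ?flat_gt0 ?subr_gt0. Qed.

Lemma bell_left x : x <= 0 -> bell x = 0.
Proof. by move=> x0; rewrite /bell flat_eq0// mul0r. Qed.

Lemma bell_right x : 1 <= x -> bell x = 0.
Proof. by move=> x0; rewrite /bell mulrC flat_eq0 ?mul0r// subr_le0. Qed.

Lemma cont_L1 (a b : R) f : continuous f -> mu.-integrable `[a, b] (EFin \o f).
Proof.
move=> cf; apply: continuous_compact_integrable => //; first exact: segment_compact.
exact: continuous_subspaceT.
Qed.

Lemma smooth_primitive f F : smooth f -> (forall x : R, is_derive x 1 F (f x)) -> smooth F.
Proof.
move=> sf H n x; case: n => [|n]; first by have := H x; case.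
rewrite derive1Sn (_ : derive1 F = f); first exact: sf.
by apply/funext => y; rewrite derive1E; apply: derive_val.
Qed.

Lemma prim_eq0 (a x : R) f : (forall t, t <= x -> f t = 0) -> prim a f x = 0.
Proof.
move=> f0; rewrite (@eq_prim _ _ _ _ (cst 0)) => [|t /andP[_]]; last exact: f0.
by rewrite /prim Rintegral_cst// mul0r.
Qed.

Lemma prim_is_derive (a x : R) f : continuous f -> a < x -> is_derive x 1 (prim a f) (f x).
Proof.
move=> cf ax.
have [||] := @continuous_FTC1_closed R f a x (x + 1) _ _ ax (cf x).
- by rewrite ltrDl.
- exact: cont_L1.
- by move=> d1 d2; apply: (DeriveDef d1); rewrite -derive1E; exact: d2.
Qed.

Lemma prim_smooth_is_derive f (x : R) : continuous f -> (forall x, x <= 0 -> f x = 0) ->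
  is_derive x 1 (prim (-1) f) (f x).
Proof.
move=> cf f0; have [x0|x0] := ltP x 0.
  rewrite f0 ?ltW//; apply: near_eq_is_derive (is_derive_cst (0 : R) x (1 : R)).
  near=> y; rewrite /= prim_eq0// => t ty; rewrite f0// (le_trans ty)// ltW//.
  by near: y; exact: lt_nbhsl.
by apply: prim_is_derive => //; rewrite (lt_le_trans _ x0)// ltrN10.
Unshelve. all: by end_near. Qed.

(** The base point -1 lies strictly to the left of the support of the
    integrand, so the primitive is differentiable at every real number, with
    value 0 on the left half-line. *)
Definition raw_step : R -> R := prim (-1) bell.
Definition step (x : R) : R := raw_step x / raw_step 1.
Definition ramp : R -> R := prim (-1) step.

Lemma is_derive_raw_step (x : R) : is_derive x 1 raw_step (bell x).
Proof. apply: prim_smooth_is_derive => //; [exact: smooth_continuous smooth_bell|exact: bell_left]. Qed.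

Lemma raw_step_left (x : R) : x <= 0 -> raw_step x = 0.
Proof. by move=> x0; apply: prim_eq0 => t tx; apply: bell_left; exact: le_trans x0. Qed.

Lemma raw_step_mvt x y : x < y -> exists2 z, x < z < y & raw_step y - raw_step x = bell z * (y - x).
Proof.
move=> xy; have [|z] := MVT xy (fun z _ => is_derive_raw_step z).
  apply: continuous_subspaceT => z; apply: differentiable_continuous; apply/derivable1_diffP.
  by have := is_derive_raw_step z; case.
by rewrite in_itv/=; exists z.
Qed.

Lemma raw_step1_gt0 : 0 < raw_step 1.
Proof.
have [z z01] := raw_step_mvt (@ltr01 R).
by rewrite (@raw_step_left 0)// subr0 subr0 mulr1 => ->; exact: bell_gt0.
Qed.

Lemma raw_step_homo x y : x <= y -> raw_step x <= raw_step y.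
Proof.
rewrite le_eqVlt => /predU1P[->//|xy]; have [z _ h] := raw_step_mvt xy.
by rewrite -subr_ge0 h mulr_ge0 ?bell_ge0// subr_ge0 ltW.
Qed.

Lemma raw_step_right x : 1 <= x -> raw_step x = raw_step 1.
Proof.
rewrite le_eqVlt => /predU1P[->//|x1]; have [z /andP[z1 _] h] := raw_step_mvt x1.
by apply/eqP; rewrite -subr_eq0 h bell_right ?mul0r// ltW.
Qed.

Lemma step_left (x : R) : x <= 0 -> step x = 0.
Proof. by move=> x0; rewrite /step raw_step_left// mul0r. Qed.

Lemma step_right x : 1 <= x -> step x = 1.
Proof. by move=> x1; rewrite /step raw_step_right// mulfV// gt_eqF// raw_step1_gt0. Qed.

Lemma step_01 x : 0 <= step x <= 1.
Proof.
have [x0|x0] := leP x 0; first by rewrite step_left// lexx ler01.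
have [x1|x1] := leP 1 x; first by rewrite step_right// lexx ler01.
have c0 := raw_step1_gt0; rewrite /step ler_pdivrMr// mul1r raw_step_homo ?andbT; last exact: ltW.
rewrite divr_ge0 ?(ltW c0)//.
by rewrite -(@raw_step_left 0)// raw_step_homo// ltW.
Qed.

Lemma smooth_step : smooth step.
Proof.
have := @smooth_affine raw_step (raw_step 1)^-1 1 0 (smooth_primitive smooth_bell is_derive_raw_step).
by congr smooth; apply/funext => x; rewrite mul1r addr0 mulrC.
Qed.

Lemma is_derive_ramp (x : R) : is_derive x 1 ramp (step x).
Proof. by apply: prim_smooth_is_derive; [exact: smooth_continuous smooth_step|exact: step_left]. Qed.

Lemma smooth_ramp : smooth ramp.
Proof. exact: smooth_primitive smooth_step is_derive_ramp. Qed.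

Lemma ramp_left x : x <= 0 -> ramp x = 0.
Proof. by move=> x0; apply: prim_eq0 => t tx; apply: step_left; exact: le_trans x0. Qed.

Lemma ramp_right x : 1 <= x -> ramp x = ramp 1 + (x - 1).
Proof.
rewrite le_eqVlt => /predU1P[<-|x1]; first by rewrite subrr addr0.
have [|z] := MVT x1 (fun z _ => is_derive_ramp z).
  apply: continuous_subspaceT; exact: smooth_continuous smooth_ramp.
rewrite in_itv/= => /andP[z1 _]; rewrite step_right ?ltW// mul1r => <-.
by rewrite addrC subrK.
Qed.

End Smooth.

(** * Weak derivatives in one variable *)

Section Weak.
Context {R : realType}.
Local Notation mu := (@lebesgue_measure R).
Implicit Types (D : set R) (f g : R -> R).

(** A ramp starting at c, with slope 1 after a transition zone of width 1/k. *)
Definition ramp_at (k c x : R) : R := k^-1 * ramp (k * x + - (k * c)).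

Lemma smooth_ramp_at k c : smooth (ramp_at k c).
Proof. exact: smooth_affine smooth_ramp. Qed.

Lemma is_derive_ramp_at k c (x : R) : 0 < k -> is_derive x 1 (ramp_at k c) (step (k * x + - (k * c))).
Proof.
move=> k0; have da : is_derive x 1 (fun x : R => k * x + - (k * c)) k.
  have := is_deriveD (is_deriveZ k (is_derive_id x (1 : R))) (is_derive_cst (- (k * c)) x (1 : R)).
  by move=> /is_derive_eq; apply; rewrite addr0 /GRing.scale/= mulr1.
have fc := @is_derive1_comp _ _ (fun x : R => k * x + - (k * c)) x _ _ (is_derive_ramp _) da.
apply: (is_derive_eq (is_deriveZ k^-1 fc)).
by rewrite /GRing.scale/= mulrC mulfK// gt_eqF.
Qed.

Lemma ramp_at_left k c x : 0 < k -> x <= c -> ramp_at k c x = 0.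
Proof.
by move=> k0 xc; rewrite /ramp_at ramp_left ?mulr0// -mulrBr mulr_ge0_le0 ?subr_le0// ltW.
Qed.

Lemma ramp_at_right k c x : 0 < k -> c + k^-1 <= x -> ramp_at k c x = k^-1 * (ramp 1 - 1) + (x - c).
Proof.
move=> k0 xc; have k00 : k != 0 by rewrite gt_eqF.
rewrite /ramp_at ramp_right; first by field.
rewrite -mulrBr -(@ler_pM2l _ k^-1) ?invr_gt0// mulr1 mulKf// lerBrDl//.
Qed.

Lemma step_cvg (c x : R) :
  step (n.+1%:R * x + - (n.+1%:R * c)) @[n --> \oo] --> ((c < x)%R%:R : R).
Proof.
have [cx|xc] := ltP c x; last first.
  rewrite (_ : (fun n => _) = fun=> 0); first exact: cvg_cst.
  by apply/funext => n; rewrite step_left// -mulrBr mulr_ge0_le0// subr_le0.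
apply: (@cvg_trans _ ((fun=> 1) @ \oo)); last exact: cvg_cst.
apply: near_eq_cvg; near=> n.
rewrite step_right// -mulrBr -ler_pdivrMr ?subr_gt0//.
rewrite (@le_trans _ _ n%:R)//; last by rewrite ler_nat.
near: n; exact: nbhs_infty_ger.
Unshelve. all: by end_near. Qed.

(** Each difference of two ramps becomes the constant d on the right;
    subtracting two such differences leaves a compact support, and this is
    how test functions with a prescribed derivative are produced. *)
Lemma dipole_test (l r a b d k : R) : 0 < k -> 0 < d -> l < a -> l < b ->
  a + d + k^-1 < r -> b + d + k^-1 < r ->
  let phi x := ramp_at k a x - ramp_at k (a + d) x - (ramp_at k b x - ramp_at k (b + d) x) in
  test_function `]l, r[ phi.
Proof.
move=> k0 d0 la lb ar br phi; split.
  by apply: smoothB; apply: smoothB; exact: smooth_ramp_at.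
exists `[Num.min a b, Num.max a b + d + k^-1]%classic.
  split; first exact: segment_compact.
  move=> x; rewrite /= !in_itv/= => /andP[x1 x2].
  rewrite (lt_le_trans _ x1)//=; last by rewrite lt_min la.
  by rewrite (le_lt_trans x2)//; case: (leP a b).
move=> x; rewrite /= in_itv/= => /negP; rewrite negb_and -!ltNge => /orP[|].
  rewrite lt_min => /andP[xa xb].
  rewrite /phi !ramp_at_left ?subrr//; first [exact: ltW|by rewrite (le_trans (ltW xa))// lerDl ltW|by rewrite (le_trans (ltW xb))// lerDl ltW].
move=> hx.
have /andP[xa xb] : (a + d + k^-1 < x) && (b + d + k^-1 < x).
  by apply/andP; split; apply: le_lt_trans hx; rewrite !lerD2r le_max lexx ?orbT.
rewrite /phi !ramp_at_right//; first ring; apply: ltW.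
all: try by [].
- by apply: lt_trans xb; rewrite ltrD2r ltrDl.
- by apply: lt_trans xa; rewrite ltrD2r ltrDl.
Qed.

(** The derivative of the dipole converges boundedly, as k grows, to the
    difference of the indicator functions of ]a, a + d] and ]b, b + d]. *)
Lemma dipole_cvg (l r a b d : R) (u : R -> R) : 0 < d -> l < a -> l < b -> a + d < r -> b + d < r ->
  mu.-integrable `]l, r[ (EFin \o u) ->
  (forall phi, test_function `]l, r[ phi -> \int[mu]_(x in `]l, r[) (u x * derive1 phi x) = 0) ->
  \int[mu]_(x in `]l, r[) (u x * ((a < x)%R%:R - (a + d < x)%R%:R - ((b < x)%R%:R - (b + d < x)%R%:R))) = 0.
Proof.
move=> d0 la lb ar br u1 H.
pose s n (c x : R) : R := step (n.+1%:R * x + - (n.+1%:R * c)).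
pose psi n x : R := s n a x - s n (a + d) x - (s n b x - s n (b + d) x).
have mu' : measurable_fun `]l, r[ u by exact: L1_measurable u1.
have ms n c : measurable_fun `]l, r[ (s n c).
  have /smooth_continuous cs := @smooth_affine _ step 1 n.+1%:R (- (n.+1%:R * c)) smooth_step.
  apply: measurable_funTS; apply: continuous_measurable_fun.
  by move=> x; have := cs x; under eq_fun do rewrite mul1r.
have mi c : measurable_fun `]l, r[ (fun x : R => (c < x)%R%:R : R).
  apply: measurable_funTS.
  rewrite (_ : (fun _ => _) = \1_(`]c, +oo[%classic : set R)).
    by apply: measurable_indic.
  apply/funext => x; rewrite indicE; congr (nat_of_bool _)%:R.
  by apply/idP/idP; rewrite inE/= in_itv/= andbT.
have sb n c x : 0 <= s n c x <= 1 by exact: step_01.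
have bd n x : `]l, r[%classic x -> `|u x * psi n x| <= 2 * `|u x|.
  move=> _; rewrite normrM mulrC ler_wpM2r//.
  have := sb n a x; have := sb n (a + d) x; have := sb n b x; have := sb n (b + d) x.
  by rewrite /psi ler_norml => /andP[? ?] /andP[? ?] /andP[? ?] /andP[? ?]; apply/andP; split; lra.
have [_ C] := @Rintegral_dominated _ `]l, r[ (fun n x => u x * psi n x)
  (fun x => u x * ((a < x)%R%:R - (a + d < x)%R%:R - ((b < x)%R%:R - (b + d < x)%R%:R)))
  (fun x => 2 * `|u x|) (measurable_itv _)
  (fun n => measurable_funM mu' (measurable_funB (measurable_funB (ms n a) (ms n (a + d))) (measurable_funB (ms n b) (ms n (b + d)))))
  (measurable_funM mu' (measurable_funB (measurable_funB (mi a) (mi (a + d))) (measurable_funB (mi b) (mi (b + d)))))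
  (fun x _ => cvgM (cvg_cst (u x)) (cvgB (cvgB (@step_cvg a x) (@step_cvg (a+d) x)) (cvgB (@step_cvg b x) (@step_cvg (b+d) x))))
  (L1Z 2 (measurable_itv _) (integrable_norm u1)) bd.
apply/(@cvg_unique _ _ _ _ _ _ C); first exact: Rhausdorff.
pose e := Num.min (r - (a + d)) (r - (b + d)).
have e0 : 0 < e by rewrite lt_min !subr_gt0 ar.
apply: (@cvg_trans _ ((fun=> 0) @ \oo)); last exact: cvg_cst.
apply: near_eq_cvg; near=> n.
have n0 : (0 : R) < n.+1%:R by [].
have ne : n.+1%:R^-1 < e.
  by near: n; exact: near_infty_natSinv_lt (PosNum e0).
move: ne; rewrite lt_min => /andP[na nb].
have T := @dipole_test l r a b d n.+1%:R n0 d0 la lb.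
rewrite -(H _ (T _ _)); [|by rewrite addrC -ltrBrDr..].
apply: eq_Rintegral => x _; congr (_ * _).
rewrite derive1E.
have dt c := @is_derive_ramp_at n.+1%:R c x n0.
have := is_deriveB (is_deriveB (dt a) (dt (a + d))) (is_deriveB (dt b) (dt (b + d))).
by case=> _ /esym.
Unshelve. all: by end_near. Qed.

(** Testing against dipoles shows that the increment over an interval of
    length d of the primitive of u does not depend on the position of the
    interval. Dividing by d and letting d tend to 0 at two points where this
    primitive has derivative u (almost all points are such) gives equal
    values of u. *)
Lemma du_bois_reymond (l r : R) (u : R -> R) : l < r ->
  mu.-integrable setT (EFin \o u) ->
  (forall phi, test_function `]l, r[ phi -> \int[mu]_(x in `]l, r[) (u x * derive1 phi x) = 0) ->
  exists c, {ae mu, forall x, l < x < r -> u x = c}.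
Proof.
move=> lr u1 H; pose U := prim l u.
have u1S D : measurable D -> mu.-integrable D (EFin \o u).
  by move=> mD; apply: L1_subset u1.
have uE c : l < c -> c < r -> \int[mu]_(x in `]l, r[) (u x * (c < x)%R%:R) = U r - U c.
  move=> lc cr; rewrite /U /prim Rintegral_itvB ?bnd_simp ?ltW//; last exact: u1S.
  rewrite -Rintegral_itv_bndo_bndc; last exact: u1S.
  rewrite Rintegral_mkcond [RHS]Rintegral_mkcond; apply: eq_Rintegral => x _.
  rewrite !patchE !mem_setE !in_itv/=.
  have [cx|xc] := ltP c x; first by rewrite mulr1 (lt_trans lc cx).
  by rewrite mulr0 if_same.
have i1 c : mu.-integrable `]l, r[ (EFin \o (fun x => u x * (c < x)%R%:R)).
  apply: (@L1_mul_bounded _ _ _ _ 1) => //; first exact: u1S.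
    apply: measurable_funTS.
    rewrite (_ : (fun _ => _) = \1_(`]c, +oo[%classic : set R)).
      by apply: measurable_indic.
    apply/funext => x; rewrite indicE; congr (nat_of_bool _)%:R.
    by apply/idP/idP; rewrite inE/= in_itv/= andbT.
  by move=> x _; case: (c < x)%R; rewrite ?normr1 ?normr0.
have UE a b d : 0 < d -> l < a -> l < b -> a + d < r -> b + d < r ->
    U (a + d) - U a = U (b + d) - U b.
  move=> d0 la lb ar br.
  have := dipole_cvg d0 la lb ar br (u1S _ (measurable_itv _)) H.
  under eq_Rintegral do rewrite mulrBr !(mulrBr (u _)).
  have lad : l < a + d by rewrite (lt_trans la)// ltrDl.
  have lbd : l < b + d by rewrite (lt_trans lb)// ltrDl.
  have ar' : a < r by rewrite (lt_trans _ ar)// ltrDl.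
  have br' : b < r by rewrite (lt_trans _ br)// ltrDl.
  by rewrite !RintegralB ?uE//; try (by apply: L1B); lra.
have good : {ae mu, forall x, l < x -> derivable U x 1 /\ derive1 U x = u x}.
  apply: (@FTC1 R u (BLeft l)); first by move=> y; exact: u1S.
  by apply: open_integrable_locally => //; exact: openT.
have [E [mE E0 sE]] := good.
(* E is the null set where the primitive U fails to have derivative u; y
   is a reference point outside of it. *)
have [y [lyr Ey]] : exists y, l < y < r /\ ~ E y.
  apply: contrapT => /forallNP nE.
  have : (mu `]l, r[ <= mu E)%E.
    apply: le_measure; rewrite ?inE// => x /=; rewrite in_itv/= => xlr.
    by apply: contrapT => nEx; exact: (nE x).
  by rewrite E0 lebesgue_measure_itv/= lte_fin lr leNgt -EFinB lte_fin subr_gt0 lr.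
have gy x : ~ E x -> l < x -> is_derive x 1 U (u x).
  move=> nEx lx; have : (l < x -> derivable U x 1 /\ derive1 U x = u x).
    by apply: contrapT => nh; apply: nEx; exact: sE.
  by move=> /(_ lx)[d1 d2]; apply: (DeriveDef d1); rewrite -derive1E; exact: d2.
exists (u y); exists E; split => // x /= nx; apply: contrapT => nEx; apply: nx => /andP[lx xr].
case/andP: lyr => ly yr.
have dq (z : R) : is_derive z 1 U (u z) -> h^-1 * (U (z + h) - U z) @[h --> 0^'+] --> u z.
  move=> [/cvg_ex[/= L LU] Uz]; have := LU; rewrite -Uz /derive (cvg_lim _ LU)// => {}LU.
  suff -> : (fun h : R => h^-1 * (U (z + h) - U z)) =
      (fun h : R => h^-1 *: ((U \o shift z) (h *: (1 : R)) - U z)).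
    exact: cvg_dnbhs_at_right.
  by apply/funext => h; rewrite /GRing.scale/= mulr1 [h + z]addrC.
have q1 := dq _ (gy _ nEx lx); have q2 := dq _ (gy _ Ey ly).
apply/(@cvg_unique _ (@Rhausdorff R) _ _ _ _ q1).
apply: cvg_trans q2; apply: near_eq_cvg.
(* Increments of length less than e keep both intervals inside ]l, r[. *)
pose e := Num.min (r - x) (r - y).
have e0 : 0 < e by rewrite lt_min !subr_gt0 xr.
near=> h.
have h0 : 0 < h by near: h; exact: nbhs_right_gt.
have : h < e by near: h; exact: nbhs_right_lt.
rewrite lt_min => /andP[hx hy].
by rewrite (UE x y h)//; [rewrite addrC -ltrBrDr..].
Unshelve. all: by end_near. Qed.

Lemma ae_imp (P Q : R -> Prop) : (forall x, P x -> Q x) ->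
  {ae mu, forall x, P x} -> {ae mu, forall x, Q x}.
Proof. by move=> PQ; apply: filterS; first exact: (ae_filter_ringOfSetsType mu). Qed.

Lemma ae_imp2 (P Q S : R -> Prop) : (forall x, P x -> Q x -> S x) ->
  {ae mu, forall x, P x} -> {ae mu, forall x, Q x} -> {ae mu, forall x, S x}.
Proof. by move=> PQ; apply: filterS2; first exact: (ae_filter_ringOfSetsType mu). Qed.

Lemma ae_exists_itv (l r : R) (P : R -> Prop) : l < r -> {ae mu, forall x, P x} ->
  exists2 x, l < x < r & P x.
Proof.
move=> lr [E [mE E0 sE]]; apply: contrapT => nE.
have : (mu `]l, r[ <= mu E)%E.
  apply: le_measure; rewrite ?inE// => x /=; rewrite in_itv/= => xlr.
  by apply: sE => /= Px; apply: nE; exists x.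
by rewrite E0 lebesgue_measure_itv/= lte_fin lr leNgt -EFinB lte_fin subr_gt0 lr.
Qed.

Lemma within_cont_dist (A : set R) f (x e : R) : {within A, continuous f} ->
  A x -> 0 < e -> exists2 d, 0 < d & forall y, A y -> `|y - x| < d -> `|f y - f x| < e.
Proof.
move=> /subspace_continuousP cf Ax e0; have /cvgrPdist_lt /(_ _ e0) := cf x Ax.
rewrite near_withinE => /nbhs_ballP[d /= d0 H].
exists d => // y Ay yx; rewrite distrC; apply: H => //.
by rewrite /ball/= distrC.
Qed.

Lemma within_cont_distP (A : set R) f :
  (forall x e : R, A x -> 0 < e -> exists2 d, 0 < d & forall y, A y -> `|y - x| < d -> `|f y - f x| < e) ->
  {within A, continuous f}.
Proof.
move=> H; apply/subspace_continuousP => x Ax; apply/cvgrPdist_lt => e e0.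
have [d d0 Hd] := H x e Ax e0.
rewrite near_withinE; apply/nbhs_ballP; exists d => //= y; rewrite /ball/= => yx Ay.
by rewrite distrC; apply: Hd => //; rewrite distrC.
Qed.

(** Two continuous functions that differ at one point differ on an interval,
    which has positive measure. *)
Lemma ae_cont_eq (l r : R) f g : l < r -> {within `[l, r], continuous f} ->
  {within `[l, r], continuous g} -> {ae mu, forall x, l < x < r -> f x = g x} ->
  forall x, l <= x <= r -> f x = g x.
Proof.
move=> lr cf cg fg x xlr; apply/eqP; apply: contrapT => /negP nfg.
have [e e0 He] : exists2 e, 0 < e & forall y, l <= y <= r -> `|y - x| < e -> f y != g y.
  have ch : {within `[l, r], continuous (fun x => f x - g x)} by move=> y; exact: cvgB (cf y) (cg y).
  have hx : `|f x - g x| > 0 by rewrite normr_gt0 subr_eq0.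
  have xI : `[l, r]%classic x by rewrite /= in_itv.
  have [e e0 He] := within_cont_dist ch xI hx; exists e => // y ylr yx; apply/eqP => fgy.
  have := He y; rewrite /= in_itv/= => /(_ ylr yx).
  by rewrite fgy subrr sub0r normrN ltxx.
have := @ae_exists_itv (Num.max l (x - e)) (Num.min r (x + e)) _ _ fg.
case.
  move: xlr => /andP[lx xr].
  by rewrite lt_min !gt_max lr/= ; apply/and3P; split; lra.
move=> y; rewrite gt_max lt_min => /andP[/andP[ly xy] /andP[yr yx]] /(_ _)/eqP.
rewrite ly yr => /(_ isT)/eqP E; have := He y.
have yxe : `|y - x| < e by rewrite ltr_distl; apply/andP; split; lra.
by rewrite (ltW ly) (ltW yr) E eqxx => /(_ isT yxe).
Qed.

Lemma ae_eq_Rintegral D f g : measurable D -> measurable_fun D f -> measurable_fun D g ->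
  {ae mu, forall x, D x -> f x = g x} ->
  \int[mu]_(x in D) f x = \int[mu]_(x in D) g x.
Proof.
move=> mD mf mg fg; congr fine; apply: ae_eq_integral => //.
- by apply/measurable_EFinP.
- by apply/measurable_EFinP.
- by apply: ae_imp fg => x H Dx; rewrite /= H.
Qed.

(** The problem data live on the open interval, primitives on the closed
    one; this lemma is the bridge. *)
Lemma Rintegral_oo_cc (l r : R) f : mu.-integrable `[l, r] (EFin \o f) ->
  \int[mu]_(x in `]l, r[) f x = \int[mu]_(x in `[l, r]) f x.
Proof.
move=> f1; rewrite -Rintegral_itv_obnd_cbnd; last first.
  by apply: L1_subset f1 => //; exact: subset_itv_oc_cc.
rewrite -Rintegral_itv_bndo_bndc//.
by apply: L1_subset f1 => //; exact: subset_itv_oo_cc.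
Qed.

Lemma test_function_smooth D phi : test_function D phi -> smooth phi.
Proof. by case. Qed.

Lemma test_function_out D phi x : test_function D phi -> ~ D x -> phi x = 0.
Proof. by move=> [_ [K [_ KD] K0]] nDx; apply: K0 => /KD. Qed.

Lemma derive1_test_function D phi : test_function D phi -> test_function D (derive1 phi).
Proof.
move=> [sphi [K [cK KD] K0]]; split; first exact: smooth_derive1.
exists K => // x nKx; rewrite derive1E.
have oK : open (~` K) by apply: closed_openC; apply: compact_closed => //; exact: Rhausdorff.
rewrite -(@derive_cst R R R (0 : R) 1 x); apply: near_eq_derive.
by apply: filterS (oK _ nKx) => y; exact: K0.
Qed.

Lemma test_function_sub D D' phi : D `<=` D' -> test_function D phi -> test_function D' phi.
Proof. by move=> DD' [s [K [cK KD] K0]]; split => //; exists K => //; split => //; exact: subset_trans DD'. Qed.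

Lemma Rintegral_widen D D' f : measurable D -> measurable D' -> D `<=` D' -> (forall x, ~ D x -> f x = 0) ->
  \int[mu]_(x in D') f x = \int[mu]_(x in D) f x.
Proof.
move=> mD mD' DD' f0; rewrite Rintegral_mkcond [RHS]Rintegral_mkcond.
apply: eq_Rintegral => x _; rewrite !patchE; case: ifPn => xD'; case: ifPn => xD //.
- by rewrite f0// => Dx; move/negP: xD; apply; rewrite inE.
- by move/negP: xD'; case; rewrite inE; apply: DD'; rewrite -inE.
Qed.

Lemma weak_derivative_sub D D' u g : measurable D -> measurable D' -> D `<=` D' ->
  is_weak_derivative D' u g -> is_weak_derivative D u g.
Proof.
move=> mD mD' DD' H phi tphi; have tphi' := test_function_sub DD' tphi.
rewrite -(Rintegral_widen mD mD' DD'); last first.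
  by move=> x nDx; rewrite (test_function_out (derive1_test_function tphi) nDx) mulr0.
rewrite -(Rintegral_widen mD mD' DD'); last first.
  by move=> x nDx; rewrite (test_function_out tphi nDx) mulr0.
exact: H.
Qed.

Lemma square_integrable_sub D D' u : measurable D -> measurable D' -> D `<=` D' ->
  square_integrable D' u -> square_integrable D u.
Proof.
move=> mD mD' DD' [mu' iu]; split; first exact: measurable_funS mu'.
exact: L1_subset iu.
Qed.

Lemma smooth_prim (l x : R) phi : smooth phi -> l <= x -> phi x = phi l + prim l (derive1 phi) x.
Proof.
move=> sphi; rewrite le_eqVlt => /predU1P[<-|lx]; first by rewrite prim_left addr0.
have cd : continuous (derive1 phi) by apply: smooth_continuous; exact: smooth_derive1.
have FTC : (\int[mu]_(t in `[l, x]) (derive1 phi t)%:E = (phi x)%:E - (phi l)%:E)%E.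
  apply: continuous_FTC2 => //; first exact: continuous_subspaceT.
  have cphi := smooth_continuous sphi; split.
  - by move=> t _; exact: (sphi 0%N).
  - by apply: cvg_at_right_filter; exact: cphi.
  - by apply: cvg_at_left_filter; exact: cphi.
by rewrite /prim /Rintegral FTC/= addrCA subrr addr0.
Qed.

Lemma prim_bd (l r c : R) g x : mu.-integrable `[l, r] (EFin \o g) -> `[l, r]%classic x ->
  `|c + prim l g x| <= `|c| + \int[mu]_(t in `[l, r]) `|g t|.
Proof.
rewrite /= in_itv/= => g1 /andP[_ xr].
by rewrite (le_trans (ler_normD _ _))// lerD2l; exact: le_norm_prim.
Qed.

(** A smooth function is bounded on a segment, being the primitive of its
    derivative. *)
Lemma L1_smooth (l r : R) g phi : mu.-integrable `[l, r] (EFin \o g) -> smooth phi ->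
  mu.-integrable `[l, r] (EFin \o (fun x => g x * phi x)).
Proof.
move=> g1 sphi; have d1 : mu.-integrable `[l, r] (EFin \o derive1 phi).
  by apply: cont_L1; apply: smooth_continuous; exact: smooth_derive1.
apply: (@L1_mul_bounded _ _ _ _ (`|phi l| + \int[mu]_(t in `[l, r]) `|derive1 phi t|)) => //.
  by apply: measurable_funTS; apply: continuous_measurable_fun; exact: smooth_continuous.
move=> x xlr; have lx : l <= x by move: xlr; rewrite /= in_itv/= => /andP[].
by rewrite (smooth_prim sphi lx); exact: prim_bd.
Qed.

Lemma ibp_smooth (l r c : R) g phi : l <= r -> mu.-integrable `[l, r] (EFin \o g) -> smooth phi ->
  \int[mu]_(x in `[l, r]) ((c + prim l g x) * derive1 phi x) =
  (c + prim l g r) * phi r - c * phi l - \int[mu]_(x in `[l, r]) (g x * phi x).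
Proof.
move=> lr g1 sphi.
have d1 : mu.-integrable `[l, r] (EFin \o derive1 phi).
  by apply: cont_L1; apply: smooth_continuous; exact: smooth_derive1.
have bp := @ibp R l r c (phi l) g (derive1 phi) lr g1 d1.
rewrite -(@smooth_prim l r) // in bp.
have -> : \int[mu]_(x in `[l, r]) (g x * phi x) =
   \int[mu]_(x in `[l, r]) (g x * (phi l + prim l (derive1 phi) x)).
  apply: eq_Rintegral => x; rewrite inE/= in_itv/= => /andP[lx _].
  by rewrite -smooth_prim.
by rewrite bp opprB addrC subrK.
Qed.

Lemma weak_derivative_prim (l r c : R) g : l <= r -> mu.-integrable `[l, r] (EFin \o g) ->
  is_weak_derivative `]l, r[ (fun x => c + prim l g x) g.
Proof.
move=> lr g1 phi tphi; have sphi := test_function_smooth tphi.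
have out x : ~ (l < x < r) -> phi x = 0.
  by move=> nx; apply: test_function_out tphi _; rewrite /= in_itv.
rewrite !Rintegral_oo_cc; last 2 first.
- exact: L1_smooth.
- apply: (eq_L1 _ (fun x _ => mulrC (derive1 phi x) (c + prim l g x))) => //.
  apply: (@L1_mul_bounded _ _ _ _ (`|c| + \int[mu]_(t in `[l, r]) `|g t|)) => //.
  + by apply: cont_L1; apply: smooth_continuous; exact: smooth_derive1.
  + by apply: measurable_funD => //; exact: prim_meas.
  + by move=> x; exact: prim_bd.
by rewrite ibp_smooth// !out ?ltxx ?andbF// !mulr0 subrr sub0r.
Qed.

Lemma oo_fin (l r : R) : (mu `]l, r[ < +oo)%E.
Proof. by rewrite lebesgue_measure_itv; case: ifP; rewrite ?ltry// -EFinB ltry. Qed.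

Lemma restrict_in (D : set R) (g : R -> R) x : D x -> (g \_ D) x = g x.
Proof. by move=> Dx; rewrite patchE mem_set. Qed.

Lemma L1_cc_restrict (l r a b : R) g : mu.-integrable `]l, r[ (EFin \o g) ->
  mu.-integrable `[a, b] (EFin \o (g \_ `]l, r[)).
Proof. by move=> g1; apply: (@L1_subset _ setT) => //; exact: L1_restrict. Qed.

Lemma L1_oo_smooth (l r : R) g phi : mu.-integrable `]l, r[ (EFin \o g) -> smooth phi ->
  mu.-integrable `]l, r[ (EFin \o (fun x => g x * phi x)).
Proof.
move=> g1 sphi; have g0 := L1_cc_restrict l r g1.
apply: (@eq_L1 _ _ (fun x => (g \_ `]l, r[) x * phi x)) => //.
  by move=> x Dx; rewrite restrict_in.
by apply: (@L1_subset _ `[l, r]) => //; [exact: subset_itv_oo_cc|exact: L1_smooth].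
Qed.

(** The difference of u and the primitive of g has weak derivative zero, so
    it is constant by the lemma of du Bois-Reymond. *)
Lemma weak_derivative_rep (l r : R) u g : l < r -> square_integrable `]l, r[ u ->
  square_integrable `]l, r[ g -> is_weak_derivative `]l, r[ u g ->
  exists c, {ae mu, forall x, l < x < r -> u x = c + prim l (g \_ `]l, r[) x}.
Proof.
move=> lr Hu Hg H.
have u1 := L2_L1 (measurable_itv _) (oo_fin l r) Hu.
have g1 := L2_L1 (measurable_itv _) (oo_fin l r) Hg.
pose g0 := g \_ `]l, r[.
have g01 : mu.-integrable `[l, r] (EFin \o g0) by exact: L1_cc_restrict.
have p1 : mu.-integrable `]l, r[ (EFin \o prim l g0).
  by apply: (@L1_subset _ `[l, r]) => //; [exact: subset_itv_oo_cc|exact: L1_prim (ltW lr) g01].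
have w1 := L1B (measurable_itv _) u1 p1.
have [phi tphi|c Hc] := du_bois_reymond lr (L1_restrict (measurable_itv _) w1).
  have sphi := test_function_smooth tphi.
  have sd := smooth_derive1 sphi.
  transitivity (\int[mu]_(x in `]l, r[) (u x * derive1 phi x - prim l g0 x * derive1 phi x)).
    by apply: eq_Rintegral => x; rewrite inE => Dx; rewrite restrict_in// mulrBl.
  rewrite RintegralB//; try exact: L1_oo_smooth.
  have := weak_derivative_prim 0 (ltW lr) g01 tphi.
  under eq_Rintegral do rewrite add0r.
  move=> ->; rewrite H// opprK addrC; apply/eqP; rewrite subr_eq0; apply/eqP.
  by apply: eq_Rintegral => x; rewrite inE => Dx; rewrite /g0 restrict_in.
exists c; apply: ae_imp Hc => x Hx lxr; move: (Hx lxr).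
by rewrite restrict_in ?in_itv//= => <-; rewrite subrK.
Qed.

Lemma prim_cst (l x c : R) : l <= x -> prim l (fun=> c) x = c * (x - l).
Proof.
rewrite le_eqVlt => /predU1P[->|lx]; first by rewrite prim_left subrr mulr0.
by rewrite /prim Rintegral_cst//= lebesgue_measure_itv/= lte_fin lx -EFinB.
Qed.

(** The fundamental lemma of the calculus of variations. Derivatives of test
    functions are test functions, so g is a constant c; and g is a weak
    derivative of 0, so the primitive of g, which is c (x - l), is constant.
    Hence c = 0. *)
Lemma weak_zero (l r : R) g : l < r -> square_integrable `]l, r[ g ->
  (forall phi, test_function `]l, r[ phi -> \int[mu]_(x in `]l, r[) (g x * phi x) = 0) ->
  {ae mu, forall x, l < x < r -> g x = 0}.
Proof.
move=> lr Hg H.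
have g1 := L2_L1 (measurable_itv _) (oo_fin l r) Hg.
have [phi tphi|c Hc] := du_bois_reymond lr (L1_restrict (measurable_itv _) g1).
  rewrite -[RHS](H _ (derive1_test_function tphi)).
  by apply: eq_Rintegral => x; rewrite inE => Dx; rewrite restrict_in.
have z2 : square_integrable `]l, r[ (cst 0).
  by apply: (@L2_bounded _ _ _ 0) => //; [exact: oo_fin|move=> x _; rewrite normr0].
have [phi tphi|d Hd] := weak_derivative_rep lr z2 Hg.
  rewrite H// oppr0 (@eq_Rintegral _ _ _ _ _ (cst 0)) => [|x _]; last by rewrite mul0r.
  by rewrite Rintegral_cst// mul0r.
suff c0 : c = 0.
  apply: ae_imp Hc => x Hx lxr; move: (Hx lxr).
  by rewrite restrict_in ?in_itv//= c0.
have E x : l <= x -> x < r -> prim l (g \_ `]l, r[) x = c * (x - l).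
  move=> lx xr; rewrite -prim_cst// /prim -!Rintegral_oo_cc//; last exact: L1_cc_restrict.
    apply: ae_eq_Rintegral => //.
      by apply: measurable_funTS; apply: L1_measurable; exact: L1_restrict.
    apply: ae_imp Hc => t Ht; rewrite /= in_itv/= => /andP[lt tx]; apply: Ht.
    by rewrite lt (lt_trans tx).
  by apply: cont_L1; exact: cst_continuous.
pose m := (l + r) / 2; have lm : l < m by rewrite /m; lra. have mr : m < r by rewrite /m; lra.
have [x /andP[lx xm] Ex] := ae_exists_itv lm Hd; have [y /andP[my yr] Ey] := ae_exists_itv mr Hd.
have lxr : l < x < r by apply/andP; split; lra.
have lyr : l < y < r by apply/andP; split; lra.
have h1 : 0 = d + c * (x - l) by have := Ex lxr; rewrite E//; lra.
have h2 : 0 = d + c * (y - l) by have := Ey lyr; rewrite E//; lra.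
have : c * (y - x) = 0 by rewrite -[LHS]addr0 -[X in _ + X](subrr (c * (x - l))) -[RHS](subrr (d + c * (x - l))) -{1}h1 h2; ring.
by move/eqP; rewrite mulf_eq0 => /orP[/eqP//|]; rewrite subr_eq0 => /eqP; lra.
Qed.

Lemma weak_unique (l r : R) u g1 g2 : l < r ->
  square_integrable `]l, r[ g1 -> square_integrable `]l, r[ g2 ->
  is_weak_derivative `]l, r[ u g1 -> is_weak_derivative `]l, r[ u g2 ->
  {ae mu, forall x, l < x < r -> g1 x = g2 x}.
Proof.
move=> lr s1 s2 w1 w2; apply: ae_imp (weak_zero lr (L2B (measurable_itv _) s1 s2) _).
  by move=> x H /H /eqP; rewrite subr_eq0 => /eqP.
move=> phi tphi; have sphi := test_function_smooth tphi.
under eq_Rintegral do rewrite mulrBl.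
rewrite RintegralB//; try by apply: L1_oo_smooth => //; apply: L2_L1 => //; exact: oo_fin.
by have := w1 _ tphi; rewrite w2// => /oppr_inj ->; rewrite subrr.
Qed.

(** The line is exhausted by bounded intervals, on which uniqueness is
    known. *)
Lemma weak_uniqueT u g1 g2 : square_integrable setT g1 -> square_integrable setT g2 ->
  is_weak_derivative setT u g1 -> is_weak_derivative setT u g2 ->
  {ae mu, forall x, g1 x = g2 x}.
Proof.
move=> s1 s2 w1 w2.
have H n : {ae mu, forall x, - n.+1%:R < x < n.+1%:R -> g1 x = g2 x}.
  apply: (@weak_unique _ _ u) => //; first by rewrite gtrN.
  - exact: square_integrable_sub s1.
  - exact: square_integrable_sub s2.
  - exact: weak_derivative_sub w1.
  - exact: weak_derivative_sub w2.
have := ae_foralln H; apply: ae_imp => x Hx.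
have [n xn] : exists n : nat, `|x| < n.+1%:R.
  exists (Num.truncn `|x|); exact: truncnS_gt.
by apply: (Hx n); rewrite -ltr_norml.
Qed.

Lemma wderivP D u g : square_integrable D g -> is_weak_derivative D u g ->
  square_integrable D (wderiv D u) /\ is_weak_derivative D u (wderiv D u).
Proof.
move=> sg wg; rewrite /wderiv; apply: (@xgetPex _ _ [set g | square_integrable D g /\ is_weak_derivative D u g]).
by exists g.
Qed.

Lemma H1_wderiv D u : sobolevH1 D u ->
  square_integrable D (wderiv D u) /\ is_weak_derivative D u (wderiv D u).
Proof. by move=> [_ [g sg wg]]; exact: wderivP sg wg. Qed.

Lemma wderiv_ae (l r : R) u g : l < r -> square_integrable `]l, r[ g ->
  is_weak_derivative `]l, r[ u g ->
  {ae mu, forall x, l < x < r -> wderiv `]l, r[ u x = g x}.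
Proof.
move=> lr sg wg; have [s w] := wderivP sg wg.
exact: (weak_unique lr s sg w wg).
Qed.

Lemma wderiv_aeT u g : square_integrable setT g -> is_weak_derivative setT u g ->
  {ae mu, forall x, wderiv setT u x = g x}.
Proof.
move=> sg wg; have [s w] := wderivP sg wg.
exact: (weak_uniqueT s sg w wg).
Qed.

Lemma weak_derivative_ae D u u' g : measurable D -> measurable_fun D u -> measurable_fun D u' ->
  {ae mu, forall x, D x -> u x = u' x} -> is_weak_derivative D u g -> is_weak_derivative D u' g.
Proof.
move=> mD m1 m2 uu' H phi tphi; rewrite -H//.
have md : measurable_fun D (derive1 phi).
  apply: measurable_funTS; apply: continuous_measurable_fun; apply: smooth_continuous.
  by apply: smooth_derive1; exact: test_function_smooth tphi.
apply: ae_eq_Rintegral => //; try by apply: measurable_funM.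
by apply: ae_imp uu' => x Hx /Hx ->.
Qed.

Lemma eq_prim_ae (l r x : R) f g : mu.-integrable `[l, r] (EFin \o f) ->
  mu.-integrable `[l, r] (EFin \o g) -> {ae mu, forall t, l < t < r -> f t = g t} ->
  x <= r -> prim l f x = prim l g x.
Proof.
move=> f1 g1 fg xr.
have sub : `[l, x] `<=` `[l, r] by apply: subset_itvl; rewrite bnd_simp.
have sub' : `]l, x[ `<=` `[l, r] by apply: subset_trans sub; exact: subset_itv_oo_cc.
rewrite /prim -!Rintegral_oo_cc; try by apply: L1_subset sub _.
apply: ae_eq_Rintegral => //.
- by apply: L1_measurable; apply: L1_subset f1.
- by apply: L1_measurable; apply: L1_subset g1.
- apply: ae_imp fg => t H; rewrite /= in_itv/= => /andP[lt tx].
  by apply: H; rewrite lt (lt_le_trans tx).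
Qed.

Lemma within_contD (A : set R) f g : {within A, continuous f} -> {within A, continuous g} ->
  {within A, continuous (fun x => f x + g x)}.
Proof. by move=> cf cg x; exact: cvgD (cf x) (cg x). Qed.

(** The primitive of g is the continuous representative of u up to a
    constant; the value at the left end fixes the constant, the value at the
    right end gives the condition on g. *)
Lemma H1_ends (r : R) u g : 0 < r -> square_integrable `]- r, r[ u ->
  square_integrable `]- r, r[ g -> is_weak_derivative `]- r, r[ u g ->
  vanishes_at_ends r u ->
  {ae mu, forall x, - r < x < r -> u x = prim (- r) (g \_ `]- r, r[) x} /\
  prim (- r) (g \_ `]- r, r[) r = 0.
Proof.
move=> r0 su sg wg [w [cw uw wl wr]].
have lr : - r < r by rewrite gtrN.
have [c Hc] := weak_derivative_rep lr su sg wg.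
have g1 : mu.-integrable `[- r, r] (EFin \o (g \_ `]- r, r[)).
  by apply: L1_cc_restrict; apply: L2_L1 => //; exact: oo_fin.
have E : forall x, - r <= x <= r -> w x = c + prim (- r) (g \_ `]- r, r[) x.
  apply: ae_cont_eq => //.
  - apply: within_contD; first by apply: continuous_subspaceT; exact: cst_continuous.
    exact: prim_cont (ltW lr) g1.
  - by apply: ae_imp2 Hc uw => x H1 H2 xlr; rewrite -H1// -H2.
have c0 : c = 0.
  by have := E (- r); rewrite lexx (ltW lr) wl prim_left addr0 => /(_ isT).
split; last by have := E r; rewrite lexx (ltW lr) wr c0 add0r => /(_ isT).
by apply: ae_imp Hc => x H /H; rewrite c0 add0r.
Qed.

(** The space of v in H^2 with v and v' vanishing at both ends, parametrised
    by h = v'': then v' and v are the iterated primitives of h from -r, so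
    that the conditions at -r hold automatically and the two conditions at r
    are linear conditions on h. *)
Definition clamped (r : R) (h : R -> R) : Prop :=
  [/\ square_integrable `[- r, r] h, prim (- r) h r = 0 & prim (- r) (prim (- r) h) r = 0].

Lemma L2_restrict (D : set R) f : measurable D -> square_integrable D f ->
  square_integrable setT (f \_ D).
Proof.
move=> mD [mf f2]; split; first by apply/(measurable_restrictT f mD).
have := L1_restrict mD f2; apply: eq_L1 => // x _.
by rewrite !patchE; case: ifP => //; rewrite expr0n.
Qed.

(** With clamped_H20, the identification of the Sobolev space with the
    concrete space of second derivatives. *)
Lemma H20_clamped (r : R) v : 0 < r -> sobolevH20 r v ->
  let v1 := wderiv `]- r, r[ v in
  let h := (wderiv `]- r, r[ v1) \_ (`]- r, r[) in
  [/\ clamped r h,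
   {ae mu, forall x, - r < x < r -> v x = prim (- r) (prim (- r) h) x},
   {ae mu, forall x, - r < x < r -> v1 x = prim (- r) h x} &
   {ae mu, forall x, - r < x < r -> (wderiv `]- r, r[ v1) x = h x}].
Proof.
move=> r0 [[Hv Hv1] ve v1e] v1 h.
have lr : - r < r by rewrite gtrN.
have [s1 w1] := H1_wderiv Hv; have [s2 w2] := H1_wderiv Hv1.
have [v1E Ih] := H1_ends r0 s1 s2 w2 v1e.
have [vE Iv1] := H1_ends r0 (proj1 Hv) s1 w1 ve.
have h2 : square_integrable `[- r, r] h.
  by apply: square_integrable_sub (L2_restrict _ s2).
have h1 := L2_L1 (measurable_itv _) (itv_fin _ _) h2.
have v11 : mu.-integrable `[- r, r] (EFin \o (v1 \_ `]- r, r[)).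
  by apply: L1_cc_restrict; apply: L2_L1 => //; exact: oo_fin.
have EE x : x <= r -> prim (- r) (v1 \_ `]- r, r[) x = prim (- r) (prim (- r) h) x.
  move=> xr; apply: (eq_prim_ae v11 (L1_prim (ltW lr) h1) _ xr).
  by apply: ae_imp v1E => t H tlr; rewrite restrict_in; [exact: H|rewrite /= in_itv].
split.
- by split; [exact: h2|exact: Ih|rewrite -(EE r (lexx r)); exact: Iv1].
- by apply: ae_imp vE => x H /[dup] /andP[_ xr] /H ->; rewrite EE// ltW.
- exact: v1E.
- by apply: aeW => x xlr; rewrite /h restrict_in//= in_itv.
Qed.

Lemma clamped_H20 (r : R) h : 0 < r -> clamped r h ->
  let v := prim (- r) (prim (- r) h) in
  [/\ sobolevH20 r v,
   {ae mu, forall x, - r < x < r -> wderiv `]- r, r[ v x = prim (- r) h x} &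
   {ae mu, forall x, - r < x < r -> wderiv `]- r, r[ (wderiv `]- r, r[ v) x = h x}].
Proof.
move=> r0 [h2 Ih IIh] v.
have lr : - r < r by rewrite gtrN.
have oc : `]- r, r[ `<=` `[- r, r] by exact: subset_itv_oo_cc.
have h1 := L2_L1 (measurable_itv _) (itv_fin _ _) h2.
have Ih1 := L1_prim (ltW lr) h1.
have sv : square_integrable `]- r, r[ v by apply: square_integrable_sub oc (L2_prim (ltW lr) Ih1).
have sIh : square_integrable `]- r, r[ (prim (- r) h) by apply: square_integrable_sub oc (L2_prim (ltW lr) h1).
have sh : square_integrable `]- r, r[ h by apply: square_integrable_sub oc h2.
have wE f : (fun x => 0 + f x) = f :> (R -> R) by apply/funext => x; rewrite add0r.
have w1 : is_weak_derivative `]- r, r[ v (prim (- r) h).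
  by have := weak_derivative_prim 0 (ltW lr) Ih1; rewrite wE.
have w2 : is_weak_derivative `]- r, r[ (prim (- r) h) h.
  by have := weak_derivative_prim 0 (ltW lr) h1; rewrite wE.
have E1 := wderiv_ae lr sIh w1.
have [s1 ww1] := wderivP sIh w1.
have w2' : is_weak_derivative `]- r, r[ (wderiv `]- r, r[ v) h.
  apply: weak_derivative_ae w2 => //; [by case: sIh|by case: s1|].
  by apply: ae_imp E1 => x H; rewrite /= in_itv/= => /H.
have E2 := wderiv_ae lr sh w2'.
split => //; split.
- split; first by split => //; exists (prim (- r) h).
  by split => //; exists h.
- exists v; split => //; [exact: prim_cont (ltW lr) Ih1|exact: aeW|exact: prim_left].
- exists (prim (- r) h); split => //; [exact: prim_cont (ltW lr) h1|exact: prim_left].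
Qed.

End Weak.

(** * Maximisation of the energy on an interval *)

Section Var.
Context {R : realType}.
Local Notation mu := (@lebesgue_measure R).
Context (r q : R) (r0 : 0 < r) (q1 : 1 < q).
Implicit Types (D : set R) (f g : R -> R).
Local Notation C := (`[- r, r]%classic : set R).
Local Notation I := (prim (- r)).
Local Notation L2 := (square_integrable C).

Let lr : - r <= r. Proof. by rewrite ge0_cp// ltW. Qed.
Let ltlr : - r < r. Proof. by rewrite gtrN. Qed.
Let mC : measurable C := measurable_itv _.

Definition ip (f g : R -> R) : R := \int[mu]_(x in C) (f x * g x).

Lemma ipC f g : ip f g = ip g f.
Proof. by apply: eq_Rintegral => x _; rewrite mulrC. Qed.

Lemma eq_ip f f' g g' : (forall x, C x -> f x = f' x) -> (forall x, C x -> g x = g' x) -> ip f g = ip f' g'.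
Proof. by move=> ff gg; apply: eq_Rintegral => x; rewrite inE => Cx; rewrite ff// gg. Qed.

Lemma ipDl f g h : L2 f -> L2 g -> L2 h -> ip (fun x => f x + g x) h = ip f h + ip g h.
Proof.
move=> Hf Hg Hh; rewrite /ip -RintegralD//; [|exact: L2_mul..].
by apply: eq_Rintegral => x _; rewrite mulrDl.
Qed.

Lemma ipZl k f h : L2 f -> L2 h -> ip (fun x => k * f x) h = k * ip f h.
Proof.
move=> Hf Hh; rewrite /ip -RintegralZl//; last exact: L2_mul.
by apply: eq_Rintegral => x _; rewrite mulrA.
Qed.

Lemma ipBl f g h : L2 f -> L2 g -> L2 h -> ip (fun x => f x - g x) h = ip f h - ip g h.
Proof.
move=> Hf Hg Hh; rewrite /ip -RintegralB//; [|exact: L2_mul..].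
by apply: eq_Rintegral => x _; rewrite mulrBl.
Qed.

Lemma ipDr f g h : L2 f -> L2 g -> L2 h -> ip h (fun x => f x + g x) = ip h f + ip h g.
Proof. by move=> *; rewrite ipC ipDl// ![ip _ h]ipC. Qed.

Lemma ipZr k f h : L2 f -> L2 h -> ip h (fun x => k * f x) = k * ip h f.
Proof. by move=> *; rewrite ipC ipZl// ![ip _ h]ipC. Qed.

Lemma ip_ge0 f : 0 <= ip f f.
Proof. by apply: Rintegral_ge0 => x _; rewrite -expr2 sqr_ge0. Qed.

Lemma L2L1 f : L2 f -> mu.-integrable C (EFin \o f).
Proof. by apply: L2_L1 => //; exact: itv_fin. Qed.

Lemma L2I f : L2 f -> L2 (I f).
Proof. by move=> Hf; apply: L2_prim lr _; exact: L2L1. Qed.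

Lemma L2cst c : L2 (fun=> c).
Proof. by apply: (@L2_bounded _ _ _ `|c|) => //; exact: itv_fin. Qed.

Lemma segment_norm x : C x -> `|x| <= r.
Proof. by rewrite /= in_itv/= ler_norml. Qed.

Lemma L2id : L2 (fun x => x).
Proof. by apply: (@L2_bounded _ _ _ r) => //; [exact: itv_fin|exact: segment_norm]. Qed.

(** Integration by parts in the form used below: taking primitives is
    skew-adjoint up to the boundary term at r. *)
Lemma ip_prim f g : L2 f -> L2 g -> ip f (I g) = I f r * I g r - ip (I f) g.
Proof. by move=> Hf Hg; rewrite /ip ibp_prim0//; exact: L2L1. Qed.

Lemma clampedD h k : clamped r h -> clamped r k -> clamped r (fun x => h x + k x).
Proof.
move=> [Hh h1 h2] [Hk k1 k2]; have ih := L2L1 Hh; have ik := L2L1 Hk.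
split; [exact: L2D|by rewrite (primD ih ik)// h1 k1 addr0|].
rewrite (@eq_prim _ _ _ _ (fun x => I h x + I k x)) => [|x /andP[_ xr]]; last exact: primD ih ik xr.
by rewrite (@primD _ (- r) r)// ?h2 ?k2 ?addr0//; exact: L1_prim.
Qed.

Lemma clampedZ c h : clamped r h -> clamped r (fun x => c * h x).
Proof.
move=> [Hh h1 h2]; have ih := L2L1 Hh.
split; [exact: L2Z|by rewrite (primZ _ ih)// h1 mulr0|].
rewrite (@eq_prim _ _ _ _ (fun x => c * I h x)) => [|x /andP[_ xr]]; last exact: primZ ih xr.
by rewrite (@primZ _ (- r) r)// ?h2 ?mulr0//; exact: L1_prim.
Qed.

Lemma prim2D h k x : L2 h -> L2 k -> x <= r ->
  I (I (fun x => h x + k x)) x = I (I h) x + I (I k) x.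
Proof.
move=> Hh Hk xr; have ih := L2L1 Hh; have ik := L2L1 Hk.
rewrite (@eq_prim _ _ _ _ (fun x => I h x + I k x)) => [|y /andP[_ yr]]; last exact: primD ih ik (le_trans yr xr).
by rewrite (@primD _ (- r) r)//; exact: L1_prim.
Qed.

Lemma prim2Z c h x : L2 h -> x <= r -> I (I (fun x => c * h x)) x = c * I (I h) x.
Proof.
move=> Hh xr; have ih := L2L1 Hh.
rewrite (@eq_prim _ _ _ _ (fun x => c * I h x)) => [|y /andP[_ yr]]; last exact: primZ ih (le_trans yr xr).
by rewrite (@primZ _ (- r) r)//; exact: L1_prim.
Qed.

Lemma clamped_ip_prim h k : clamped r h -> clamped r k -> ip (I h) (I k) = - ip (I (I h)) k.
Proof.
by move=> [Hh _ _] [Hk k1 _]; rewrite ip_prim//; [rewrite k1 mulr0 sub0r|exact: L2I].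
Qed.

Lemma clamped_ip_prim2 k f : clamped r k -> L2 f -> ip f (I (I k)) = ip (I (I f)) k.
Proof.
move=> [Hk k1 k2] Hf; rewrite ip_prim//; last exact: L2I.
rewrite k2 mulr0 sub0r ip_prim//; last exact: L2I.
by rewrite k1 mulr0 sub0r opprK.
Qed.

Lemma ip1 f : ip f (fun=> 1) = I f r.
Proof. by rewrite /ip; under eq_Rintegral do rewrite mulr1. Qed.

(** The iterated primitive of f at r is the integral of (r - x) f. Hence h
    is clamped exactly when it is orthogonal to 1 and to x. *)
Lemma prim2_end f : L2 f -> I (I f) r = r * I f r - ip f (fun x => x).
Proof.
move=> Hf; rewrite -ip1 ipC ip_prim//; last exact: L2cst.
rewrite (_ : I (fun=> 1) r = r + r); last by rewrite prim_cst// mul1r opprK.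
rewrite (@eq_ip _ (fun x => r + x) f f) => [||//]; last first.
  by move=> x; rewrite /= in_itv/= => /andP[rx _]; rewrite prim_cst// mul1r opprK addrC.
rewrite ipDl//; [|exact: L2cst|exact: L2id].
rewrite (_ : ip (fun=> r) f = r * I f r).
  by rewrite [X in _ = _ - X]ipC; ring.
by rewrite -ip1 -ipZr; [rewrite ipC; apply: eq_ip => // x _; rewrite mulr1|exact: L2cst|].
Qed.

Lemma clampedP f : L2 f -> ip f (fun=> 1) = 0 -> ip f (fun x => x) = 0 -> clamped r f.
Proof. by move=> Hf f1 fx; split; [exact: Hf|by rewrite -ip1|by rewrite prim2_end// -ip1 f1 fx mulr0 subrr]. Qed.

Lemma clamped_ip1 f : clamped r f -> ip f (fun=> 1) = 0.
Proof. by move=> [_ f1 _]; rewrite ip1. Qed.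

Lemma clamped_ipx f : clamped r f -> ip f (fun x => x) = 0.
Proof. by move=> [Hf f1 f2]; have := prim2_end Hf; rewrite f1 f2 mulr0 sub0r => /eqP; rewrite eq_sym oppr_eq0 => /eqP. Qed.

(** The nonlinearity q s^+ - s^-; Gq is the corresponding quadratic form, of
    derivative 2 gq. *)
Definition gq (s : R) : R := q * Num.max s 0 - Num.max (- s) 0.
Definition Gq (s : R) : R := q * Num.max s 0 ^+ 2 + Num.max (- s) 0 ^+ 2.

Lemma posneg (s : R) : (s <= 0 /\ (Num.max s 0 = 0 /\ Num.max (- s) 0 = - s)) \/
  (0 <= s /\ (Num.max s 0 = s /\ Num.max (- s) 0 = 0)).
Proof.
have [s0|s0] := leP s 0; [left|right].
  by split => //; split => //; rewrite max_l// oppr_ge0.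
by split; [exact: ltW|split => //; rewrite max_r// oppr_le0 ltW].
Qed.

Lemma gq_mul s : gq s * s = Gq s.
Proof. by rewrite /gq /Gq; have [[_ [-> ->]]|[_ [-> ->]]] := posneg s; ring. Qed.

(** The upper second order Taylor estimate of a function whose derivative 2
    gq is 2 q-Lipschitz. *)
Lemma Gq_quad s t : Gq (s + t) <= Gq s + 2 * gq s * t + q * t ^+ 2.
Proof.
rewrite /gq /Gq; have q1' := q1.
have [[h1 [-> ->]]|[h1 [-> ->]]] := posneg (s + t);
have [[h2 [-> ->]]|[h2 [-> ->]]] := posneg s; rewrite -subr_ge0.
- by rewrite (_ : _ - _ = (q - 1) * t ^+ 2); [rewrite mulr_ge0 ?sqr_ge0//; lra|ring].
- rewrite (_ : _ - _ = (q - 1) * (s + t) ^+ 2); last by ring.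
  by rewrite mulr_ge0 ?sqr_ge0//; lra.
- rewrite (_ : _ - _ = (q - 1) * (- s) * (2 * (s + t) + - s)); last by ring.
  by rewrite mulr_ge0//; [rewrite mulr_ge0//; lra|lra].
- by rewrite (_ : _ - _ = 0) //; ring.
Qed.

Lemma gq_mono (s t : R) : t <= s -> 0 <= gq s - gq t <= q * (s - t).
Proof.
have q1' := q1; rewrite /gq => ts.
by have [[h1 [-> ->]]|[h1 [-> ->]]] := posneg s;
have [[h2 [-> ->]]|[h2 [-> ->]]] := posneg t; apply/andP; split; nra.
Qed.

Lemma gq_lip s t : `|gq s - gq t| <= q * `|s - t|.
Proof.
wlog ts : s t / t <= s => [H|].
  by have [|/ltW] := leP t s; [exact: H|rewrite distrC [`|s - t|]distrC; exact: H].
have /andP[h1 h2] := gq_mono ts.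
by rewrite (ger0_norm h1) ger0_norm// subr_ge0.
Qed.

Lemma Gq_ge (s : R) : s ^+ 2 <= Gq s.
Proof.
have q1' := q1; rewrite /Gq.
by have [[h2 [-> ->]]|[h2 [-> ->]]] := posneg s; nra.
Qed.

Lemma GqZ c s : 0 <= c -> Gq (c * s) = c ^+ 2 * Gq s.
Proof.
move=> c0; rewrite /Gq.
have E (u : R) : Num.max (c * u) 0 = c * Num.max u 0 by rewrite maxr_pMr// mulr0.
by rewrite -mulrN !E !exprMn mulrDr mulrCA.
Qed.

Lemma gq_cont : continuous gq.
Proof.
move=> s; apply/cvgrPdist_lt => e e0; have q0 : 0 < q by apply: lt_trans q1.
apply/nbhs_ballP; exists (e / q); first by rewrite /= divr_gt0.
move=> t; rewrite /ball/= ltr_pdivlMr// mulrC => H.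
exact: le_lt_trans (gq_lip _ _) H.
Qed.

Lemma gq0 : gq 0 = 0. Proof. by rewrite /gq oppr0 maxxx mulr0 subrr. Qed.

Lemma gq_le s : `|gq s| <= q * `|s|.
Proof. by have := gq_lip s 0; rewrite gq0 !subr0. Qed.

(** In terms of v'' = h: mass is the integral of q (v^+)^2 + (v^-)^2 that
    the constraint normalises, and energy is the integral of 2 (v')^2 -
    (v'')^2. *)
Definition mass h := \int[mu]_(x in C) Gq (I (I h) x).
Definition energy h := 2 * ip (I h) (I h) - ip h h.

Lemma L2g f : L2 f -> L2 (fun x => gq (f x)).
Proof.
move=> [mf f2]; have mg : measurable_fun C (fun x => gq (f x)).
  apply: (@measurableT_comp _ _ _ _ _ _ gq) => //.
  by apply: continuous_measurable_fun; exact: gq_cont.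
split => //; apply: (@le_integrable _ _ _ mu C _ _ (EFin \o (fun x => q ^+ 2 * f x ^+ 2))) => //.
- by apply/measurable_EFinP; exact: measurable_funX.
- move=> x _ /=; rewrite lee_fin normrX -exprMn normrX lerXn2r ?nnegrE//.
  by rewrite normrM (ger0_norm (ltW (lt_trans ltr01 q1))) gq_le.
- exact: L1Z.
Qed.

Lemma mass_ip h : mass h = ip (fun x => gq (I (I h) x)) (I (I h)).
Proof. by apply: eq_Rintegral => x _; rewrite gq_mul. Qed.

Lemma L1G f : L2 f -> mu.-integrable C (EFin \o (fun x => Gq (f x))).
Proof.
move=> Hf; have := L2_mul mC (L2g Hf) Hf.
by apply: eq_L1 => // x _; rewrite gq_mul.
Qed.

Lemma le_Rintegral_segment f g : mu.-integrable C (EFin \o f) -> mu.-integrable C (EFin \o g) ->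
  (forall x, C x -> f x <= g x) -> \int[mu]_(x in C) f x <= \int[mu]_(x in C) g x.
Proof. by move=> Hf Hg H; apply: le_Rintegral. Qed.

Lemma ip_le_mass h : L2 h -> ip (I (I h)) (I (I h)) <= mass h.
Proof.
move=> Hh; apply: le_Rintegral_segment; [|exact: L1G (L2I (L2I Hh))|by move=> x _; rewrite -expr2 Gq_ge].
by apply: L2_mul => //; do 2 apply: L2I.
Qed.

Lemma energy_expand h : clamped r h -> energy h = - (2 * ip (I (I h)) h + ip h h).
Proof. by move=> Ch; rewrite /energy clamped_ip_prim//; ring. Qed.

(** The integral of (v + v'')^2 is nonnegative, and that of v v'' is minus
    that of (v')^2; so the energy is at most the integral of v^2. *)
Lemma energy_le_mass h : clamped r h -> energy h <= mass h.
Proof.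
move=> Ch; have Hh : L2 h by case: Ch.
have Hv := L2I (L2I Hh); apply: le_trans (ip_le_mass Hh).
have := ip_ge0 (fun x => I (I h) x + h x).
rewrite ipDl//; last exact: L2D.
rewrite !ipDr// energy_expand// [ip h (I _)]ipC.
lra.
Qed.

(** The same completion of the square with 2 v + v'': along a maximising
    sequence the second derivatives stay bounded in L^2. *)
Lemma energy_ge0_bound h : clamped r h -> 0 <= energy h -> ip h h <= 4 * mass h.
Proof.
move=> Ch; have Hh : L2 h by case: Ch.
have Hv := L2I (L2I Hh).
have := ip_ge0 (fun x => 2 * I (I h) x + h x).
have H2 : L2 (fun x => 2 * I (I h) x) by exact: L2Z.
rewrite ipDl//; last exact: L2D.
rewrite !ipDr// ?ipZl// ?ipZr// energy_expand// [ip h (I _)]ipC.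
have := ip_le_mass Hh; lra.
Qed.

Lemma energyZ c h : clamped r h -> energy (fun x => c * h x) = c ^+ 2 * energy h.
Proof.
move=> Ch; have Hh : L2 h by case: Ch.
have HI := L2I Hh.
rewrite /energy (@eq_ip (I (fun x => c * h x)) (fun x => c * I h x) (I (fun x => c * h x)) (fun x => c * I h x)); last 2 first.
- by move=> x; rewrite /= in_itv/= => /andP[_ xr]; exact: primZ (L2L1 Hh) xr.
- by move=> x; rewrite /= in_itv/= => /andP[_ xr]; exact: primZ (L2L1 Hh) xr.
by rewrite !ipZl// ?ipZr//; [ring|exact: L2Z..].
Qed.

Lemma massZ c h : clamped r h -> 0 <= c -> mass (fun x => c * h x) = c ^+ 2 * mass h.
Proof.
move=> Ch c0; have Hh : L2 h by case: Ch.
rewrite /mass -RintegralZl//; last exact: L1G (L2I (L2I Hh)).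
apply: eq_Rintegral => x; rewrite inE /= in_itv/= => /andP[_ xr].
by rewrite prim2Z// GqZ.
Qed.

Lemma mass_ge0 h : 0 <= mass h.
Proof. by apply: Rintegral_ge0 => x _; apply: le_trans (Gq_ge _); rewrite sqr_ge0. Qed.

Lemma ip_quad f g t : L2 f -> L2 g ->
  ip (fun x => f x + t * g x) (fun x => f x + t * g x) = ip f f + 2 * t * ip f g + t ^+ 2 * ip g g.
Proof.
move=> Hf Hg; have Hk := L2Z t mC Hg.
have Hs := L2D mC Hf Hk.
rewrite ipDl// ipZl// !ipDr// !ipZr// [ip g f]ipC; ring.
Qed.

Lemma energyD h k t : clamped r h -> clamped r k ->
  energy (fun x => h x + t * k x) =
  energy h + 2 * t * (2 * ip (I h) (I k) - ip h k) + t ^+ 2 * energy k.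
Proof.
move=> Ch Ck; have Hh : L2 h by case: Ch. have Hk : L2 k by case: Ck.
have HI := L2I Hh; have KI := L2I Hk.
have E x : C x -> I (fun x => h x + t * k x) x = I h x + t * I k x.
  rewrite /= in_itv/= => /andP[_ xr].
  by rewrite (@primD _ (- r) r)//; [rewrite (primZ _ (L2L1 Hk))|exact: L2L1|apply: L2L1; exact: L2Z].
rewrite /energy (eq_ip E E).
rewrite (ip_quad t HI KI) (ip_quad t Hh Hk).
have arith (a c d a' c' d' : R) : 2 * (a + 2 * t * c + t ^+ 2 * d) - (a' + 2 * t * c' + t ^+ 2 * d') =
  2 * a - a' + 2 * t * (2 * c - c') + t ^+ 2 * (2 * d - d') by ring.
exact: arith.
Qed.

Lemma massD h k t : clamped r h -> clamped r k ->
  mass (fun x => h x + t * k x) <=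
  mass h + 2 * t * ip (fun x => gq (I (I h) x)) (I (I k)) + t ^+ 2 * (q * ip (I (I k)) (I (I k))).
Proof.
move=> Ch Ck; have Hh : L2 h by case: Ch. have Hk : L2 k by case: Ck.
have HI := L2I (L2I Hh); have KI := L2I (L2I Hk).
have gv := L2g HI; have tk := L2Z t mC Hk.
have i1 := L1G HI; have i2 := L1Z (2 * t) mC (L2_mul mC gv KI).
have i3 := L1Z (t ^+ 2 * q) mC (L2_mul mC KI KI).
rewrite mulrA /mass /ip -!RintegralZl//; last 2 first.
- exact: L2_mul.
- exact: L2_mul.
rewrite -RintegralD// -RintegralD//; last exact: L1D.
apply: le_Rintegral_segment; [exact: L1G (L2I (L2I (L2D mC Hh tk)))|by apply: L1D => //; exact: L1D|].
move=> x; rewrite /= in_itv/= => /andP[_ xr].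
rewrite prim2D// prim2Z//; apply: le_trans (Gq_quad _ _) _.
by rewrite le_eqVlt; apply/orP; left; apply/eqP; ring.
Qed.

Lemma ftc_prim (l x : R) F f : (forall x : R, is_derive x 1 F (f x)) -> continuous f -> l <= x ->
  prim l f x = F x - F l.
Proof.
move=> dF cf; rewrite le_eqVlt => /predU1P[<-|lx]; first by rewrite prim_left subrr.
have cF : continuous F.
  move=> y; apply: differentiable_continuous; apply/derivable1_diffP.
  by have := dF y; case.
have FTC : (\int[mu]_(t in `[l, x]) (f t)%:E = (F x)%:E - (F l)%:E)%E.
  apply: continuous_FTC2 => //; first exact: continuous_subspaceT.
  - split.
    + by move=> t _; have := dF t; case.
    + by apply: cvg_at_right_filter; exact: cF.
    + by apply: cvg_at_left_filter; exact: cF.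
  - by move=> t _; rewrite derive1E; have := dF t; case=> _ ->.
by rewrite /prim /Rintegral FTC.
Qed.

Lemma ip11 : ip (fun=> 1) (fun=> 1) = 2 * r.
Proof. by rewrite ip1 prim_cst// mul1r opprK mulr2n mulrDl mul1r. Qed.

Lemma ipx1 : ip (fun x => x) (fun=> 1) = 0.
Proof.
have dF (x : R) : is_derive x 1 (fun x : R => 2^-1 * (x * x)) x.
  have := is_deriveZ (2^-1 : R) (is_deriveM (is_derive_id x (1 : R)) (is_derive_id x (1 : R))).
  by move=> /is_derive_eq; apply; rewrite /GRing.scale/=; field.
have cf : continuous (fun x : R => x) by move=> x; exact: cvg_id.
by rewrite ip1 (ftc_prim dF cf lr) mulrNN subrr.
Qed.

Lemma ipxx : ip (fun x => x) (fun x => x) = 2 / 3 * r ^+ 3.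
Proof.
have dF (x : R) : is_derive x 1 (fun x : R => 3^-1 * (x * (x * x))) (x * x).
  have dx := is_derive_id x (1 : R).
  have := is_deriveZ (3^-1 : R) (is_deriveM dx (is_deriveM dx dx)).
  by move=> /is_derive_eq; apply; rewrite /GRing.scale/= !fctE; field.
have cf : continuous (fun x : R => x * x) by move=> x; apply: cvgM; exact: cvg_id.
by transitivity (prim (- r) (fun x => x * x) r) => //; rewrite (ftc_prim dF cf lr); field.
Qed.

(** The orthogonal projection of L^2 onto the span of 1 and x, in the
    orthogonal basis (1, x). *)
Definition affine_proj p (x : R) := ip p (fun=> 1) / (2 * r) + 3 * ip p (fun x => x) / (2 * r ^+ 3) * x.

Lemma L2_affine_proj p : L2 (affine_proj p).
Proof. by apply: L2D => //; [exact: L2cst|apply: L2Z => //; exact: L2id]. Qed.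

Lemma ip_affine_proj p f : L2 f ->
  ip (affine_proj p) f = ip p (fun=> 1) / (2 * r) * ip (fun=> 1) f +
    3 * ip p (fun x => x) / (2 * r ^+ 3) * ip (fun x => x) f.
Proof.
move=> Hf; rewrite ipDl//; [|exact: L2cst|by apply: L2Z => //; exact: L2id].
rewrite (@ipZl _ (fun x => x) f L2id Hf).
congr (_ + _); rewrite -(@ipZl _ (fun=> 1) f (L2cst 1) Hf).
by apply: eq_ip => // x _; rewrite mulr1.
Qed.

Lemma clamped_sub_affine_proj p : L2 p -> clamped r (fun x => affine_proj p x - p x).
Proof.
move=> Hp; have H1 := L2cst 1; have Hx := L2id; have Hl := L2_affine_proj p.
apply: clampedP; first exact: L2B.
- rewrite ipBl// ip_affine_proj// ip11 ipx1 mulr0 addr0 divfK ?subrr//.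
  by rewrite mulf_neq0// gt_eqF.
- rewrite ipBl// ip_affine_proj// ipxx [ip (fun=> 1) _]ipC ipx1 mulr0 add0r.
  by field; rewrite gt_eqF.
Qed.

Lemma ip_affine_proj_clamped p k : clamped r k -> ip (affine_proj p) k = 0.
Proof.
move=> Ck; have Hk : L2 k by case: Ck.
have E1 : ip (fun=> 1) k = 0 by rewrite ipC clamped_ip1.
have Ex : ip (fun x => x) k = 0 by rewrite ipC clamped_ipx.
by rewrite ip_affine_proj// E1 Ex !mulr0 addr0.
Qed.

(** The equation v'''' + 2 v'' + b gq(v) = 0 integrated twice reads v'' = l
    - el_potential v with l affine; el_rhs takes for l the projection of
    el_potential v, the only affine function that makes the right-hand side
    clamped. Thus v is a solution with clamped ends exactly when v is the
    iterated primitive of el_rhs v. *)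
Definition el_potential (b : R) v (x : R) := 2 * v x + b * I (I (fun y => gq (v y))) x.
Definition el_rhs (b : R) v (x : R) := affine_proj (el_potential b v) x - el_potential b v x.

Lemma L2_el_potential b v : L2 v -> L2 (el_potential b v).
Proof. by move=> Hv; apply: L2D => //; apply: L2Z => //; do 2 apply: L2I; exact: L2g. Qed.

Lemma clamped_el_rhs b v : L2 v -> clamped r (el_rhs b v).
Proof. by move=> Hv; apply: clamped_sub_affine_proj; exact: L2_el_potential. Qed.

Definition norm1 (k : R -> R) : R := \int[mu]_(x in C) `|k x|.

Lemma norm1_ge0 k : 0 <= norm1 k. Proof. by apply: Rintegral_ge0 => x _; exact: normr_ge0. Qed.

Lemma norm1_sq k : L2 k -> norm1 k ^+ 2 <= 2 * r * ip k k.
Proof.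
move=> Hk; have Ha : L2 (fun x => `|k x|).
  case: Hk => mk k2; split; first exact: measurableT_comp.
  by apply: eq_L1 k2 => // x _; rewrite real_normK// num_real.
have E : ip (fun x => `|k x|) (fun x => `|k x|) = ip k k.
  by apply: eq_Rintegral => x _; rewrite -!expr2 real_normK// num_real.
have H1 := L2cst 1.
have := ip_ge0 (fun x => `|k x| + - (norm1 k / (2 * r)) * 1).
rewrite ip_quad// E ip11 (_ : ip _ (fun=> 1) = norm1 k); last first.
  by rewrite ip1.
have r0' : r != 0 by rewrite gt_eqF.
rewrite (_ : _ + _ = ip k k - norm1 k ^+ 2 / (2 * r)); last by field.
by rewrite subr_ge0 ler_pdivrMr ?mulr_gt0// mulrC.
Qed.

Lemma prim_norm1 k x : L2 k -> C x -> `|I k x| <= norm1 k.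
Proof. by move=> Hk; rewrite /= in_itv/= => /andP[_ xr]; apply: le_norm_prim => //; exact: L2L1. Qed.

Lemma norm1_le k M : L2 k -> (forall x, C x -> `|k x| <= M) -> norm1 k <= 2 * r * M.
Proof.
move=> Hk kM; apply: (@le_trans _ _ (prim (- r) (fun=> M) r)).
  apply: le_Rintegral_segment => //; first by apply: integrable_norm; exact: L2L1.
  by apply: L2L1; exact: L2cst.
by rewrite prim_cst// opprK; lra.
Qed.

Lemma prim2_norm1 k x : L2 k -> C x -> `|I (I k) x| <= 2 * r * norm1 k.
Proof.
move=> Hk Cx; apply: (le_trans (prim_norm1 (L2I Hk) Cx)).
by apply: norm1_le => [|y Cy]; [exact: L2I|exact: prim_norm1].
Qed.

Lemma ip_prim2_le k : L2 k -> ip (I (I k)) (I (I k)) <= 16 * r ^+ 4 * ip k k.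
Proof.
move=> Hk; have Hw := L2I (L2I Hk).
apply: (@le_trans _ _ (prim (- r) (fun=> (2 * r * norm1 k) ^+ 2) r)).
  apply: le_Rintegral_segment; [exact: L2_mul|by apply: L2L1; exact: L2cst|].
  move=> x Cx; rewrite -expr2 -real_normK ?num_real//.
  by rewrite lerXn2r ?nnegrE ?mulr_ge0 ?norm1_ge0 ?prim2_norm1// ltW.
rewrite prim_cst// opprK.
have := norm1_sq Hk; move: (norm1 k ^+ 2) (ip k k) (exprMn 2 (2 * r) (norm1 k)) => A B -> AB.
rewrite (_ : _ * (r + r) = 8 * r ^+ 3 * A); last by ring.
rewrite (_ : 16 * _ * B = 8 * r ^+ 3 * (2 * r * B)); last by ring.
by rewrite ler_wpM2l// mulr_ge0// exprn_ge0// ltW.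
Qed.

Lemma prim2B h k x : L2 h -> L2 k -> x <= r ->
  I (I (fun x => h x - k x)) x = I (I h) x - I (I k) x.
Proof.
move=> Hh Hk xr; have := prim2D Hh (L2Z (-1) mC Hk) xr.
rewrite prim2Z// mulN1r => <-.
by do 2 (apply: eq_prim => ? _); rewrite mulN1r.
Qed.

(** The arithmetic of one step of steepest descent, of length 1/M, for b
    mass - energy: A is the square norm of the direction and half of the
    slope along it, M bounds the curvature. *)
Lemma descent_bound (b e A a1 a2 W Ek eh ms : R) : 0 < b ->
  let M := 1 + 16 * b * q * r ^+ 4 in
  b - e <= eh ->
  b * a1 - a2 = A -> W <= 16 * r ^+ 4 * A -> - Ek <= A ->
  ms <= 1 + 2 * - M^-1 * a1 + (- M^-1) ^+ 2 * (q * W) ->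
  eh + 2 * - M^-1 * a2 + (- M^-1) ^+ 2 * Ek <= b * ms -> A <= M * e.
Proof.
move=> b0 M ehb key WA EA m1 m2.
have M0 : 0 < M.
  rewrite /M ltr_pwDl// !mulr_ge0 ?exprn_ge0// ltW//.
  by apply: lt_trans q1.
have B : b * (q * W) - Ek <= M * A.
  have : b * q * W <= b * q * (16 * r ^+ 4 * A).
    by rewrite ler_wpM2l// mulr_ge0// ltW// (lt_trans _ q1).
  rewrite /M; lra.
have m3 : b * ms <= b * (1 + 2 * - M^-1 * a1 + M^-1 ^+ 2 * (q * W)).
  by rewrite ler_wpM2l ?(ltW b0)//; move: m1; rewrite sqrrN.
move: m2; rewrite sqrrN => m2.
have m4 : M^-1 ^+ 2 * (b * (q * W) - Ek) <= M^-1 ^+ 2 * (M * A).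
  by rewrite ler_wpM2l// exprn_ge0// invr_ge0 ltW.
have m5 : M^-1 ^+ 2 * (M * A) = M^-1 * A.
  by rewrite expr2 -mulrA mulKf// gt_eqF.
have m6 : M^-1 * A <= e.
  have m7 : M^-1 * A = M^-1 * (b * a1) - M^-1 * a2 by rewrite -key mulrBr.
  lra.
by rewrite -ler_pdivrMl.
Qed.

(** The nonnegative functional b mass - energy takes a value at most e at h,
    and its half gradient there, in the space of clamped functions with the
    L^2 product of second derivatives, is the k below. Since the curvature
    is at most M = 1 + 16 b q r^4, a step of length 1/M decreases the
    functional by at least the square norm of k divided by M; positivity
    then bounds that norm. So almost maximisers almost satisfy the
    Euler-Lagrange equation, with b itself as the multiplier. *)
Lemma euler_lagrange_estimate b e h : 0 < b ->
  (forall k, clamped r k -> energy k <= b * mass k) ->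
  clamped r h -> mass h = 1 -> b - e <= energy h ->
  let k x := h x - el_rhs b (I (I h)) x in
  clamped r k /\ ip k k <= (1 + 16 * b * q * r ^+ 4) * e.
Proof.
move=> b0 Hup Ch mh eh k.
have Hh : L2 h by case: Ch. have Hv := L2I (L2I Hh).
have CT := clamped_el_rhs b Hv; have HT : L2 (el_rhs b (I (I h))) by case: CT.
have Ck : clamped r k.
  have := clampedD Ch (clampedZ (-1) CT).
  by congr clamped; apply/funext => x; rewrite mulN1r.
have Hk : L2 k by case: Ck.
split => //.
have Hp := L2_el_potential b Hv; have Hl := L2_affine_proj (el_potential b (I (I h))).
have gv := L2g Hv.
(* The first variation in the direction k, moved onto k by two
   integrations by parts, is the product of h - el_rhs v = k with k: the
   affine part is orthogonal to k. *)
have key : b * ip (fun x => gq (I (I h) x)) (I (I k)) - (2 * ip (I h) (I k) - ip h k) = ip k k.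
  rewrite clamped_ip_prim// (clamped_ip_prim2 Ck gv).
  have kE x : C x -> k x = h x + el_potential b (I (I h)) x - affine_proj (el_potential b (I (I h))) x.
    by move=> _; rewrite /k /el_rhs; ring.
  rewrite [RHS](eq_ip kE (fun x _ => erefl (k x))).
  rewrite ipBl//; last exact: L2D.
  have HII := L2I (L2I gv).
  rewrite ip_affine_proj_clamped// subr0 ipDl// /el_potential ipDl//; [|by apply: L2Z..].
  rewrite (@ipZl 2 (I (I h)) k Hv Hk) (@ipZl b _ k HII Hk).
  have arith (a c d : R) : b * a - (2 * - c - d) = d + (2 * c + b * a) by ring.
  exact: arith.
have m2 := Hup _ (clampedD Ch (clampedZ (- (1 + 16 * b * q * r ^+ 4)^-1) Ck)).
rewrite energyD// in m2.
have m1 := massD (- (1 + 16 * b * q * r ^+ 4)^-1) Ch Ck; rewrite mh in m1.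
apply: (descent_bound b0 eh key (ip_prim2_le Hk) _ m1 m2).
by rewrite /energy opprB lerBlDr lerDl mulr_ge0// ip_ge0.
Qed.

(** A Lipschitz constant of el_rhs for the uniform norm: 2 + 4 r^2 b q for
    el_potential, and a factor 5 = 4 + 1 for subtracting the projection. *)
Definition el_lipschitz b := 5 * (2 + b * (4 * r ^+ 2 * q)).

Lemma affine_proj_le p c x : L2 p -> (forall x, C x -> `|p x| <= c) -> C x -> `|affine_proj p x| <= 4 * c.
Proof.
move=> Hp pc Cx.
have i1 : `|ip p (fun=> 1)| <= 2 * r * c.
  rewrite ip1; apply: le_trans (norm1_le Hp pc); apply: prim_norm1 => //.
  by rewrite /= in_itv/= lexx lr.
have Hpx : mu.-integrable C (EFin \o (fun x => p x * x)) by apply: L2_mul => //; exact: L2id.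
have i2 : `|ip p (fun x => x)| <= 2 * r * (c * r).
  rewrite /ip; apply: le_trans (le_normr_Rintegral _ _) _ => //.
  apply: (@le_trans _ _ (prim (- r) (fun=> c * r) r)); last by rewrite prim_cst// opprK; lra.
  apply: le_Rintegral_segment => //; first exact: integrable_norm.
    by apply: L2L1; exact: L2cst.
  by move=> y Cy; rewrite normrM ler_pM ?pc ?segment_norm.
have r3 : 0 < r ^+ 3 by rewrite exprn_gt0.
rewrite /affine_proj (le_trans (ler_normD _ _))// (_ : 4 * c = c + 3 * c); last by ring.
rewrite lerD//.
  by rewrite normrM normfV (gtr0_norm (_ : 0 < 2 * r)) ?mulr_gt0// ler_pdivrMr ?mulr_gt0// mulrC.
rewrite normrM normrM normfV (gtr0_norm (_ : 0 < 2 * r ^+ 3)) ?mulr_gt0// normrM (ger0_norm (_ : 0 <= 3))//.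
have c0 : 0 <= c by apply: le_trans (pc x Cx).
apply: (@le_trans _ _ (3 * (2 * r * (c * r)) / (2 * r ^+ 3) * r)).
  by rewrite ler_pM ?mulr_ge0 ?segment_norm// ?ler_wpM2r ?ler_wpM2l// invr_ge0 ltW// mulr_gt0.
by rewrite le_eqVlt; apply/orP; left; apply/eqP; field; rewrite gt_eqF.
Qed.

Lemma affine_projB p p' x : L2 p -> L2 p' ->
  affine_proj (fun x => p x - p' x) x = affine_proj p x - affine_proj p' x.
Proof.
move=> Hp Hp'; rewrite /affine_proj (ipBl Hp Hp' (L2cst 1)) (ipBl Hp Hp' L2id).
have arith (a a' c c' k l y : R) :
  (a - a') / k + 3 * (c - c') / l * y = (a / k + 3 * c / l * y) - (a' / k + 3 * c' / l * y).
  by ring.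
exact: arith.
Qed.

Lemma el_rhs_lip b v w d : 0 < b -> L2 v -> L2 w -> (forall x, C x -> `|v x - w x| <= d) ->
  forall x, C x -> `|el_rhs b v x - el_rhs b w x| <= el_lipschitz b * d.
Proof.
move=> b0 Hv Hw vw.
have gv := L2g Hv; have gw := L2g Hw.
have q0 : 0 < q by apply: lt_trans q1.
have pd x : C x -> `|el_potential b v x - el_potential b w x| <= (2 + b * (4 * r ^+ 2 * q)) * d.
  move=> Cx; have xr : x <= r by move: Cx; rewrite /= in_itv/= => /andP[].
  rewrite (_ : _ - _ = 2 * (v x - w x) + b * I (I (fun x => gq (v x) - gq (w x))) x); last first.
    rewrite (prim2B gv gw xr) /el_potential.
    have arith (a a' c c' : R) : 2 * a + b * c - (2 * a' + b * c') = 2 * (a - a') + b * (c - c') by ring.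
    exact: arith.
  rewrite (le_trans (ler_normD _ _))// [leRHS]mulrDl lerD//.
    by rewrite normrM ger0_norm// ler_wpM2l// vw.
  rewrite normrM gtr0_norm// -mulrA ler_wpM2l//; first exact: ltW.
  rewrite (le_trans (prim2_norm1 _ Cx))//; first exact: L2B.
  rewrite (_ : 4 * r ^+ 2 * q * d = 2 * r * (2 * r * (q * d))); last by ring.
  rewrite ler_wpM2l//; first by rewrite mulr_ge0// ltW.
  apply: norm1_le => [|y Cy]; first exact: L2B.
  by rewrite (le_trans (gq_lip _ _))// ler_wpM2l ?vw// ltW.
move=> x Cx; set c := _ * d in pd.
have Hp := L2B mC (L2_el_potential b Hv) (L2_el_potential b Hw).
rewrite (_ : _ - _ = affine_proj (fun x => el_potential b v x - el_potential b w x) x - (el_potential b v x - el_potential b w x)); last first.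
  rewrite (affine_projB _ (L2_el_potential b Hv) (L2_el_potential b Hw)) /el_rhs.
  have arith (a c1 c2 c3 : R) : a - c1 - (c2 - c3) = a - c2 - (c1 - c3) by ring.
  exact: arith.
rewrite (le_trans (ler_normB _ _))// (_ : _ * d = 4 * c + c); last by rewrite /el_lipschitz /c; ring.
by rewrite lerD ?pd//; apply: affine_proj_le.
Qed.

(** A product of segments is compact by the theorem of Tychonoff, so the
    sequence has a cluster point for pointwise convergence. *)
Lemma pointwise_cluster (M0 : R) (f_ : nat -> R -> R) : (forall n x, `|f_ n x| <= M0) ->
  exists f : R -> R, forall (s : seq R) (e : R) N, 0 < e ->
    exists2 n, (N <= n)%N & forall x, x \in s -> `|f_ n x - f x| < e.
Proof.
move=> fM.
have co := @tychonoff R (fun=> R) (fun=> `[- M0, M0]%classic) (fun=> @segment_compact R (- M0) M0).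
have [|f [_ cf]] := co (f_ @ \oo) _.
  by exists 0%N => // n _ x; rewrite /= in_itv/= -ler_norml.
exists f => s e N e0.
pose F : set_system (R -> R) := nbhs (f : prod_topology (fun=> R)).
have FF : Filter F by exact: (@nbhs_filter (prod_topology (fun=> R)) f).
have nb : F [set g | forall x, x \in s -> `|g x - f x| < e].
  elim: s => [|a s IH]; first by apply: (@filterS _ F FF setT) => [g _ x|]; rewrite ?in_nil//; exact: filterT.
  have na : F [set g | `|g a - f a| < e].
    have /cvgrPdist_lt /(_ _ e0) := @proj_continuous R (fun=> R) a f.
    by apply: (@filterS _ F FF) => g; rewrite distrC.
  apply: (@filterS2 _ F FF _ _ _ _ na IH) => g ga gs x; rewrite inE => /predU1P[->//|]; exact: gs.
have Nn : (f_ @ \oo) [set g | exists2 n, (N <= n)%N & g = f_ n].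
  by exists N => // n /= Nn; exists n.
by have [g [[n Nn' ->] H]] := cf _ _ Nn nb; exists n.
Qed.

(** The compactness of the theorem of Ascoli: for equi-Lipschitz functions,
    closeness on a finite net gives uniform closeness. *)
Lemma lipschitz_cluster (M0 L : R) (f_ : nat -> R -> R) : 0 <= L -> (forall n x, `|f_ n x| <= M0) ->
  (forall n x y, C x -> C y -> `|f_ n x - f_ n y| <= L * `|x - y|) ->
  exists f : R -> R, (forall x y, C x -> C y -> `|f x - f y| <= L * `|x - y|) /\
  forall (e : R) N, 0 < e -> exists2 n, (N <= n)%N & forall x, C x -> `|f_ n x - f x| <= e.
Proof.
move=> L0 fM fL; have [f Hf] := pointwise_cluster fM; exists f.
have Lf x y : C x -> C y -> `|f x - f y| <= L * `|x - y|.
  move=> Cx Cy; apply/ler_addgt0Pr => e e0.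
  have e2 : 0 < e / 2 by rewrite divr_gt0.
  have [n _ H] := Hf [:: x; y] _ 0%N e2.
  have := fL n _ _ Cx Cy; have := H x; have := H y; rewrite !inE !eqxx ?orbT => /(_ isT) h1 /(_ isT) h2 h3.
  rewrite (_ : f x - f y = (f_ n y - f y) - (f_ n x - f x) + (f_ n x - f_ n y)); last by ring.
  apply: le_trans (ler_normD _ _) _; rewrite addrC lerD//.
  apply: le_trans (ler_normB _ _) _; lra.
split => // e N e0.
(* A net of mesh d = 2 r / m with L d <= e / 3. *)
pose m := (Num.truncn (6 * r * L / e)).+1.
have m0 : (0 : R) < m%:R by rewrite ltr0n.
pose d := 2 * r / m%:R.
have d0 : 0 < d by rewrite divr_gt0// mulr_gt0.
have Ld : L * d <= e / 3.
  have : 6 * r * L / e < m%:R by exact: truncnS_gt.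
  rewrite ltr_pdivrMr// => h.
  rewrite /d mulrA ler_pdivrMr//; lra.
have e3 : 0 < e / 3 by rewrite divr_gt0.
have [n Nn H] := Hf [seq - r + i%:R * d | i <- iota 0 m.+1] _ N e3.
exists n => // x Cx.
pose i := Num.truncn ((x + r) / d).
have /andP[rx xr] : - r <= x <= r by move: Cx; rewrite /= in_itv.
have xr0 : 0 <= (x + r) / d by rewrite divr_ge0 ?(ltW d0)//; lra.
have /andP[i1 i2] := truncn_itv xr0.
rewrite -/i ler_pdivlMr// in i1; rewrite -/i ltr_pdivrMr// in i2.
have im : (i < m.+1)%N.
  rewrite ltnS -(ler_nat R) /i.
  apply: (@le_trans _ _ ((x + r) / d)); first by rewrite -/i ler_pdivlMr.
  by rewrite ler_pdivrMr// /d mulrCA mulfV ?gt_eqF//; lra.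
pose y := - r + i%:R * d.
have Cy : C y.
  rewrite /= in_itv/= /y; apply/andP; split; last lra.
  by rewrite lerDl mulr_ge0// ltW.
have hy : `|f_ n y - f y| < e / 3.
  by apply: H; apply/mapP; exists i => //; rewrite mem_iota.
have xy : `|x - y| <= d.
  move: i2; rewrite -natr1 mulrDl mul1r => i2.
  by rewrite ler_norml /y; apply/andP; split; lra.
have g1 : `|f_ n x - f_ n y| <= e / 3.
  by rewrite (le_trans (fL _ _ _ Cx Cy))// (le_trans _ Ld)// ler_wpM2l.
have g2 : `|f y - f x| <= e / 3.
  by rewrite (le_trans (Lf _ _ Cy Cx))// (le_trans _ Ld)// ler_wpM2l// distrC.
rewrite (_ : f_ n x - f x = (f_ n x - f_ n y) + (f_ n y - f y) + (f y - f x)); last by ring.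
apply: le_trans (ler_normD _ _) _; apply: (@le_trans _ _ (e / 3 + e / 3 + e / 3)); last lra.
by rewrite lerD// (le_trans (ler_normD _ _))// lerD// ltW.
Qed.

Lemma Gq_le s : Gq s <= q * s ^+ 2.
Proof.
have := Gq_quad 0 s; rewrite add0r gq0 mulr0 mul0r addr0.
by rewrite {2}/Gq oppr0 maxxx expr0n /= mulr0 !add0r.
Qed.

Lemma segment_bounds x : C x -> - r <= x /\ x <= r.
Proof. by rewrite /= in_itv/= => /andP[]. Qed.

Lemma prim2_lip h x y : L2 h -> C x -> C y -> `|I (I h) x - I (I h) y| <= norm1 h * `|x - y|.
Proof.
move=> Hh; wlog xy : x y / y <= x => [H Cx Cy|].
  by have [|/ltW] := leP y x => yx; [exact: H|rewrite distrC [`|x - y|]distrC; exact: H].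
move=> Cx Cy; have [ry _] := segment_bounds Cy; have [_ xr] := segment_bounds Cx.
have i1 := L2L1 (L2I Hh).
rewrite (prim_sub i1 ry xy xr) (ger0_norm (_ : 0 <= x - y)) ?subr_ge0//.
have sub : `[y, x]%classic `<=` C.
  by move=> z; rewrite /= !in_itv/= => /andP[yz zx]; rewrite (le_trans ry yz) (le_trans zx xr).
have i2 : mu.-integrable `[y, x] (EFin \o I h) by apply: L1_subset i1.
apply: (le_trans (le_normr_Rintegral _ i2)) => //.
rewrite -(prim_cst _ xy); apply: le_Rintegral => //.
- exact: integrable_norm.
- by apply: (@L1_subset _ C) => //; apply: L2L1; exact: L2cst.
- by move=> z /sub Cz; exact: prim_norm1.
Qed.

Lemma lip_L2 v L : (forall x y, C x -> C y -> `|v x - v y| <= L * `|x - y|) ->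
  {within C, continuous v} /\ L2 v.
Proof.
move=> vL; have cv : {within C, continuous v}.
  apply: within_cont_distP => x e Cx e0; exists (e / (`|L| + 1)).
    by rewrite divr_gt0// ltr_wpDl.
  move=> y Cy; rewrite ltr_pdivlMr ?ltr_wpDl// => yx.
  rewrite (le_lt_trans (vL _ _ Cy Cx))// (le_lt_trans _ yx)// mulrC ler_wpM2l//.
  by rewrite (le_trans (ler_norm _))// lerDl.
split=> //; apply: (@L2_bounded _ _ _ (`|v 0| + `|L| * r)) => //.
- exact: itv_fin.
- exact: subspace_continuous_measurable_fun.
move=> x Cx; have C0 : C 0 by rewrite /= in_itv/= oppr_le0 ltW//= ltW.
rewrite -[v x](subrK (v 0)) addrC (le_trans (ler_normD _ _))// lerD2l.
rewrite (le_trans (vL _ _ Cx C0))// subr0 (le_trans (ler_norm _))// normrM normr_id.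
by rewrite ler_wpM2l// segment_norm.
Qed.

(** If v is uniformly small then its mass is small; hence a uniform cluster
    point of functions of mass 1 is not zero. *)
Lemma mass_small h d : L2 h -> 0 <= d -> (forall x, C x -> `|I (I h) x| <= d) ->
  mass h <= 2 * r * q * d ^+ 2.
Proof.
move=> Hh d0 Hd; apply: (@le_trans _ _ (prim (- r) (fun=> q * d ^+ 2) r)).
  apply: le_Rintegral_segment; [exact: L1G (L2I (L2I Hh))|by apply: L2L1; exact: L2cst|].
  move=> x Cx; rewrite (le_trans (Gq_le _))// ler_wpM2l//.
    by apply/ltW; apply: lt_trans q1.
  by rewrite -real_normK ?num_real// lerXn2r ?nnegrE// Hd.
rewrite prim_cst// opprK; lra.
Qed.

Local Opaque el_rhs prim.
(** Maximising functions of second derivative h_n and mass 1 are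
    equi-Lipschitz, because h_n is bounded in L^2. They satisfy v_n = I (I
    k_n) + I (I (el_rhs v_n)) with k_n tending to 0 in L^2. A uniform
    cluster point v inherits v = I (I (el_rhs v)) since el_rhs is Lipschitz
    for the uniform norm, and v is not zero by mass_small. *)
Lemma exists_extremal b : 0 < b ->
  (forall k, clamped r k -> energy k <= b * mass k) ->
  (forall e, 0 < e -> exists h, [/\ clamped r h, mass h = 1 & b - e <= energy h]) ->
  exists v : R -> R, [/\ {within C, continuous v}, L2 v,
    forall x, C x -> v x = I (I (el_rhs b v)) x & exists2 x, C x & v x != 0].
Proof.
move=> b0 Hup Hsup.
have en0 n : 0 < b / n.+1%:R by rewrite divr_gt0.
have [h_ Hh_] := choice (fun n => Hsup (b / n.+1%:R) (en0 n)).
have Ch n : clamped r (h_ n) by case: (Hh_ n).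
have mh n : mass (h_ n) = 1 by case: (Hh_ n).
have eh n : b - b / n.+1%:R <= energy (h_ n) by case: (Hh_ n).
have Hh n : L2 (h_ n) by case: (Ch n).
pose v_ n := I (I (h_ n)).
have n1h n : norm1 (h_ n) <= 1 + 8 * r.
  have e0 : 0 <= energy (h_ n).
    apply: le_trans (eh n); rewrite subr_ge0 ler_pdivrMr// ler_peMr ?(ltW b0)//.
    by rewrite ler1n.
  have := energy_ge0_bound (Ch n) e0; rewrite mh => h4.
  have := norm1_sq (Hh n); have : 2 * r * ip (h_ n) (h_ n) <= 2 * r * (4 * 1).
    by rewrite ler_wpM2l// mulr_ge0// ltW.
  move: (norm1 (h_ n)) (ip _ _) => t A A4 tA.
  have := sqr_ge0 (t - 2^-1); rewrite sqrrB -mulr_natr; lra.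
have [v [vL Hv]] : exists v : R -> R,
   (forall x y, C x -> C y -> `|v x - v y| <= (1 + 8 * r) * `|x - y|) /\
   forall (e : R) N, 0 < e -> exists2 n, (N <= n)%N & forall x, C x -> `|v_ n x - v x| <= e.
  have r8 : 0 <= 1 + 8 * r by rewrite addr_ge0// mulr_ge0// ltW.
  have [||f [fL Hf]] := @lipschitz_cluster (2 * r * (1 + 8 * r)) (1 + 8 * r) (fun n => (v_ n) \_ C) r8.
  - move=> n x; rewrite patchE; case: ifPn => [|_]; last first.
      by rewrite normr0 !mulr_ge0// ltW.
    rewrite inE => Cx; rewrite (le_trans (prim2_norm1 _ Cx))// ler_wpM2l//.
    by rewrite mulr_ge0// ltW.
  - move=> n x y Cx Cy; rewrite !restrict_in//.
    by rewrite (le_trans (prim2_lip _ _ _))// ler_wpM2r.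
  exists f; split => // e N e0; have [n Nn H] := Hf e N e0; exists n => // x Cx.
  by have := H x Cx; rewrite restrict_in.
have [cv L2v] := lip_L2 vL.
have CT := clamped_el_rhs b L2v.
have HT : L2 (el_rhs b v) by case: CT.
have q0 : 0 < q by apply: lt_trans q1.
have K0 : 0 <= el_lipschitz b.
  by rewrite mulr_ge0// addr_ge0// !mulr_ge0// ?exprn_ge0// ltW.
pose k_ n x := h_ n x - el_rhs b (v_ n) x.
have Hk n : clamped r (k_ n) /\ ip (k_ n) (k_ n) <= (1 + 16 * b * q * r ^+ 4) * (b / n.+1%:R).
  exact: euler_lagrange_estimate.
have L2vn n : L2 (v_ n) by exact: L2I (L2I (Hh n)).
have HTn n : L2 (el_rhs b (v_ n)) by case: (clamped_el_rhs b (L2vn n)).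
have ksmall e : 0 < e -> exists N, forall n, (N <= n)%N -> 2 * r * norm1 (k_ n) <= e.
  move=> e0; pose M := 1 + 16 * b * q * r ^+ 4.
  have M0 : 0 < M by rewrite /M ltr_pwDl// !mulr_ge0 ?exprn_ge0// ltW.
  pose A := (2 * r) ^+ 2 * (2 * r) * (M * b).
  have A0 : 0 < A by rewrite !mulr_gt0// exprn_gt0// mulr_gt0.
  exists (Num.truncn (A / e ^+ 2)).+1 => n nN.
  have An : A / e ^+ 2 <= n.+1%:R.
    apply: (@le_trans _ _ (Num.truncn (A / e ^+ 2)).+1%:R); first by apply/ltW; exact: truncnS_gt.
    by rewrite ler_nat (leq_trans nN).
  rewrite ler_pdivrMr ?exprn_gt0// in An.
  have [[Hkn _ _] ipk] := Hk n.
  rewrite -ler_sqr ?nnegrE ?mulr_ge0 ?norm1_ge0 ?(ltW r0) ?(ltW e0)// exprMn.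
  apply: (@le_trans _ _ ((2 * r) ^+ 2 * (2 * r * (M * (b / n.+1%:R))))).
    rewrite ler_wpM2l ?sqr_ge0// (le_trans (norm1_sq Hkn))// ler_wpM2l//.
    by rewrite mulr_ge0// ltW.
  rewrite (_ : _ * _ = A / n.+1%:R); last by rewrite /A !mulrA.
  by rewrite ler_pdivrMr// mulrC.
exists v; split => //.
- move=> x Cx; have [_ xr] := segment_bounds Cx.
  apply/eqP; rewrite -subr_eq0 -normr_le0; apply/ler_addgt0Pr => e' e'0; rewrite add0r.
  (* The three errors are e for v_n - v, e for I (I k_n), and the
     Lipschitz term; their sum is Z e. *)
  pose Z := 2 + 2 * r * (2 * r * el_lipschitz b).
  have r2 : 0 <= 2 * r by rewrite mulr_ge0// ltW.
  have Z0 : 0 < Z by rewrite ltr_pwDl//; do 2 apply: mulr_ge0 => //.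
  pose e := e' / Z; have e0 : 0 < e by rewrite divr_gt0.
  have [N HN] := ksmall e e0.
  have [n Nn Hn] := Hv e N e0.
  have E : v_ n x = I (I (k_ n)) x + I (I (el_rhs b (v_ n))) x.
    have -> : I (I (k_ n)) x = v_ n x - I (I (el_rhs b (v_ n))) x := prim2B (Hh n) (HTn n) xr.
    by rewrite subrK.
  have t1 : `|I (I (el_rhs b (v_ n))) x - I (I (el_rhs b v)) x| <= 2 * r * (2 * r * (el_lipschitz b * e)).
    have HL : L2 (fun x => el_rhs b (v_ n) x - el_rhs b v x) := L2B mC (HTn n) HT.
    rewrite -(prim2B (HTn n) HT xr); apply: (le_trans (prim2_norm1 HL Cx)).
    apply: (ler_wpM2l r2); apply: (norm1_le HL) => y Cy.
    exact: (el_rhs_lip b0 (L2vn n) L2v Hn Cy).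
  have t2 : `|I (I (k_ n)) x| <= e.
    by have [[Hkn _ _] _] := Hk n; apply: (le_trans (prim2_norm1 Hkn Cx)); exact: HN.
  have t3 := Hn x Cx; rewrite distrC in t3.
  have arith (a a' c d d' : R) : a' = c + d -> a - d' = (a - a') + c + (d - d').
    by move=> ->; ring.
  rewrite (arith _ _ _ _ _ E) (le_trans (ler_normD _ _))//.
  apply: (@le_trans _ _ (e + e + 2 * r * (2 * r * (el_lipschitz b * e)))).
    by apply: lerD t1; apply: (le_trans (ler_normD _ _)); exact: lerD t3 t2.
  rewrite le_eqVlt; apply/orP; left; apply/eqP.
  rewrite (_ : _ + _ = Z * e); last by rewrite /Z; ring.
  by rewrite /e mulrC divfK// gt_eqF.
- apply: contrapT => /forall2NP nv.
  have vz x : C x -> v x = 0.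
    by move=> Cx; have [//|/negP] := nv x; rewrite negbK => /eqP.
  (* If v were 0, some v_n would be bounded by 1 / A, of mass at most 2 r
     q / A^2 < 1. *)
  pose A := 2 * r * q + 1.
  have A0 : 0 < A by rewrite /A ltr_wpDl// !mulr_ge0// ltW.
  have A1 : 1 <= A by rewrite /A lerDr !mulr_ge0// ltW.
  have Ai0 : 0 < A^-1 by rewrite invr_gt0.
  have [n _ Hn] := Hv A^-1 0%N Ai0.
  have hn x : C x -> `|I (I (h_ n)) x| <= A^-1.
    by move=> Cx; have := Hn x Cx; rewrite vz// subr0.
  have := mass_small (Hh n) (ltW Ai0) hn; rewrite mh.
  have : A^-1 ^+ 2 <= A^-1 by rewrite expr2 ler_piMr ?(ltW Ai0)// invf_le1.
  move=> hA; have : 2 * r * q * A^-1 ^+ 2 <= 2 * r * q * A^-1.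
    by rewrite ler_wpM2l// !mulr_ge0// ltW.
  have : 2 * r * q * A^-1 < 1 by rewrite ltr_pdivrMr// mul1r /A ltrDl.
  move=> h1 h2 h3; have := le_lt_trans (le_trans h3 h2) h1; by rewrite ltxx.
Qed.
Local Transparent el_rhs prim.

End Var.

(** * Chains of derivatives on an open interval *)

Section Chain.
Context {R : realType}.
Local Notation mu := (@lebesgue_measure R).
Implicit Types (D : set R) (f g : R -> R).

Lemma near_oo (l r x : R) : l < x < r -> \forall y \near x, l < y < r.
Proof.
move=> /andP[lx xr]; near=> y; apply/andP; split; near: y.
  exact: lt_nbhsr.
exact: lt_nbhsl.
Unshelve. all: by end_near. Qed.

(** Classical solutions are defined by iterated derivatives; these can be
    exhibited as a chain F 0, F 1, F 2 instead of being computed. *)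
Lemma derive1n_chain (l r : R) (F : nat -> R -> R) m :
  (forall k, (k < m)%N -> forall x : R, l < x < r -> is_derive x 1 (F k) (F k.+1 x)) ->
  forall n, (n <= m)%N -> (forall x, l < x < r -> derive1n n (F 0%N) x = F n x) /\
    ((n < m)%N -> forall x, l < x < r -> derivable (derive1n n (F 0%N)) x 1).
Proof.
move=> H n nm.
have nearE (f g : R -> R) : (forall y, l < y < r -> f y = g y) ->
    forall x, l < x < r -> \forall y \near x, f y = g y.
  by move=> fg x /near_oo; apply: filterS => y; exact: fg.
have E : forall x, l < x < r -> derive1n n (F 0%N) x = F n x.
  elim: n nm => [//|n IH nm] x xlr.
  have /near_eq_is_derive := nearE _ _ (fun y ylr => esym (IH (ltnW nm) y ylr)) x xlr.
  by move=> /(_ _ _ (H n nm x xlr))[_]; rewrite derive1nS derive1E.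
split => // {}nm x xlr.
have /near_eq_is_derive := nearE _ _ (fun y ylr => esym (E y ylr)) x xlr.
by move=> /(_ _ _ (H n nm x xlr))[].
Qed.

Lemma is_derive_cont (F : R -> R) (x d : R) : is_derive x 1 F d -> {for x, continuous F}.
Proof. by case=> dF _; apply: differentiable_continuous; apply/derivable1_diffP. Qed.

Lemma mvt_oo (l r : R) F f : (forall x : R, l < x < r -> is_derive x 1 F (f x)) ->
  forall x y, l < x -> x < y -> y < r -> exists2 z, l < z < r & F y - F x = f z * (y - x).
Proof.
move=> dF x y lx xy yr.
have inD z : x <= z <= y -> l < z < r.
  by move=> /andP[xz zy]; rewrite (lt_le_trans lx xz) (le_lt_trans zy yr).
have [||z] := @MVT _ F f _ _ xy.
- by move=> z; rewrite in_itv/= => /andP[/ltW xz /ltW zy]; apply: dF; apply: inD; rewrite xz.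
- apply: continuous_in_subspaceT => z; rewrite inE/= in_itv/= => xzy.
  exact: is_derive_cont (dF _ (inD _ xzy)).
- by rewrite in_itv/= => /andP[/ltW xz /ltW zy] e; exists z => //; apply: inD; rewrite xz.
Qed.

Lemma bounded_of_derive (l r B : R) F f : l < r -> (forall x : R, l < x < r -> is_derive x 1 F (f x)) ->
  (forall x, l < x < r -> `|f x| <= B) -> exists M, forall x, l < x < r -> `|F x| <= M.
Proof.
move=> lr dF fB; pose m := (l + r) / 2.
have lm : l < m by rewrite /m; lra. have mr : m < r by rewrite /m; lra.
have B0 : 0 <= B by apply: le_trans (fB m _); rewrite ?lm.
exists (`|F m| + B * (r - l)) => x /andP[lx xr].
have key y z : l < y -> y < z -> z < r -> `|F z - F y| <= B * (r - l).
  move=> ly yz zr; have [t tlr ->] := mvt_oo dF ly yz zr.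
  rewrite normrM ler_pM ?fB// gtr0_norm ?subr_gt0//; lra.
rewrite -[F x](subrK (F m)) addrC (le_trans (ler_normD _ _))// lerD2l.
have [xm|mx|->] := ltgtP x m.
- by rewrite distrC; exact: key.
- exact: key.
- by rewrite subrr normr0 mulr_ge0// subr_ge0 ltW.
Qed.

Lemma prim_is_derive_at (l r x : R) f : mu.-integrable `[l, r] (EFin \o f) -> l < x < r ->
  {for x, continuous f} -> is_derive x 1 (prim l f) (f x).
Proof.
move=> f1 /andP[lx xr] cf.
by have [d1 d2] := continuous_FTC1_closed xr f1 lx cf; apply: (DeriveDef d1); rewrite -derive1E; exact: d2.
Qed.

Lemma cont_restrict (l r x : R) f : l < x < r -> {for x, continuous f} ->
  {for x, continuous (f \_ `]l, r[)}.
Proof.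
move=> xlr cf; rewrite /prop_for /continuous_at restrict_in; last by rewrite /= in_itv.
apply: cvg_trans cf; apply: near_eq_cvg.
by apply: filterS (near_oo xlr) => y ylr; rewrite restrict_in//= in_itv.
Qed.

Lemma L2_oo (l r B : R) f : (forall x, l < x < r -> {for x, continuous f}) ->
  (forall x, l < x < r -> `|f x| <= B) -> square_integrable setT (f \_ `]l, r[).
Proof.
move=> cf fB; apply: L2_restrict => //; apply: (@L2_bounded _ _ _ B) => //.
- exact: oo_fin.
- apply: open_continuous_measurable_fun => //.
  by move=> x; rewrite inE/= in_itv/=; exact: cf.
Qed.

(** A C^1 function on an open interval with square-integrable derivative is
    a primitive of that derivative, by the mean value theorem. *)
Lemma primitive_rep (l r : R) F f : l < r -> (forall x : R, l < x < r -> is_derive x 1 F (f x)) ->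
  (forall x, l < x < r -> {for x, continuous f}) -> square_integrable setT (f \_ `]l, r[) ->
  exists c, forall x, l < x < r -> F x = c + prim l (f \_ `]l, r[) x.
Proof.
move=> lr dF cf f2.
have f1 : mu.-integrable `[l, r] (EFin \o (f \_ `]l, r[)).
  by apply: L2_L1 => //; [exact: itv_fin|exact: square_integrable_sub f2].
have dG (x : R) : l < x < r -> is_derive x 1 (fun y => F y - prim l (f \_ `]l, r[) y) 0.
  move=> xlr; have := is_deriveB (dF x xlr) (prim_is_derive_at f1 xlr (cont_restrict xlr (cf x xlr))).
  by move=> /is_derive_eq; apply; rewrite restrict_in ?in_itv//= subrr.
pose m := (l + r) / 2.
have lm : l < m by rewrite /m; lra. have mr : m < r by rewrite /m; lra.
exists (F m - prim l (f \_ `]l, r[) m) => x /andP[lx xr].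
apply/eqP; rewrite -subr_eq; apply/eqP.
have [xm|mx|->//] := ltgtP x m.
- by have [z _ /eqP] := mvt_oo dG lx xm mr; rewrite mul0r subr_eq0 => /eqP ->.
- by have [z _ /eqP] := mvt_oo dG lm mx xr; rewrite mul0r subr_eq0 => /eqP ->.
Qed.

Lemma prim_ends (l r : R) f : l < r -> mu.-integrable `[l, r] (EFin \o f) ->
  prim l f x @[x --> l^'+] --> (0 : R) /\ prim l f x @[x --> r^'-] --> prim l f r.
Proof.
move=> lr f1; have [_ + ?] := (continuous_within_itvP _ lr).1 (prim_cont (ltW lr) f1).
by rewrite prim_left.
Qed.

End Chain.

(** * Classical solutions and the maximum over a Fucik ray *)

Section Classical.
Context {R : realType}.
Local Notation mu := (@lebesgue_measure R).
Context (r q : R) (r0 : 0 < r) (q1 : 1 < q).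
Implicit Types (D : set R) (f g : R -> R).
Local Notation C := (`[- r, r]%classic : set R).
Local Notation I := (prim (- r)).
Local Notation L2 := (square_integrable C).
Let lr : - r <= r. Proof. by rewrite ge0_cp// ltW. Qed.
Let ltlr : - r < r. Proof. by rewrite gtrN. Qed.
Let mC : measurable C := measurable_itv _.

(** Regularity by inspection: in v'' = l - 2 v - b I (I (gq v)) the
    right-hand side is twice differentiable, because gq v is continuous. *)
Lemma classical_of_extremal b (v : R -> R) : {within C, continuous v} -> L2 v ->
  (forall x, C x -> v x = I (I (el_rhs r q b v)) x) ->
  classical_solution r (q * b) b v.
Proof.
move=> cv L2v vE.
have [HT T1 T2] := clamped_el_rhs r0 q1 b L2v.
have gv : L2 (fun x => gq q (v x)) by exact: L2g.
have iT := L2L1 HT; have iIT := L2L1 (L2I r0 HT).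
have ig := L2L1 gv; have iIg := L2L1 (L2I r0 gv).
pose a0 := ip r (el_potential r q b v) (fun=> 1) / (2 * r).
pose a1 := 3 * ip r (el_potential r q b v) (fun x => x) / (2 * r ^+ 3).
(* The derivatives of v as dictated by the equation; a0 and a1 are the
   coefficients of the projection. *)
pose F (n : nat) : R -> R := match n with
  | 0%N => v | 1%N => I (el_rhs r q b v) | 2%N => el_rhs r q b v
  | 3%N => (fun x => a1 - 2 * I (el_rhs r q b v) x - b * I (fun y => gq q (v y)) x)
  | _ => (fun x => - (2 * el_rhs r q b v x) - b * gq q (v x)) end.
have cvin x : - r < x < r -> {for x, continuous v}.
  move=> xlr; have [ci _ _] := (continuous_within_itvP _ ltlr).1 cv.
  by apply: ci; rewrite in_itv.
have vE' x : - r < x < r -> v x = I (I (el_rhs r q b v)) x.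
  by move=> /andP[rx xr]; apply: vE; rewrite /= in_itv/= !ltW.
have cIf f (x : R) : mu.-integrable C (EFin \o f) -> - r < x < r -> {for x, continuous (I f)}.
  move=> f1 xlr; have [ci _ _] := (continuous_within_itvP _ ltlr).1 (prim_cont lr f1).
  by apply: ci; rewrite in_itv.
have d0 (x : R) : - r < x < r -> is_derive x 1 v (I (el_rhs r q b v) x).
  move=> xlr; have := @prim_is_derive_at _ _ _ _ _ iIT xlr (cIf _ _ iT xlr).
  apply: near_eq_is_derive; apply: filterS (near_oo xlr) => y ylr.
  by rewrite vE'.
have cg (x : R) : - r < x < r -> {for x, continuous (fun y => gq q (v y))}.
  by move=> xlr; apply: continuous_comp (cvin _ xlr) _; exact: gq_cont.
have d2 (x : R) : - r < x < r -> is_derive x 1 (el_rhs r q b v) (F 3%N x).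
  move=> xlr.
  have h1 := is_deriveD (is_derive_cst a0 x (1 : R)) (is_deriveZ a1 (is_derive_id x (1 : R))).
  have h2 := is_deriveD (is_deriveZ 2 (d0 x xlr)) (is_deriveZ b (@prim_is_derive_at _ _ _ _ _ iIg xlr (cIf _ _ ig xlr))).
  have h3 := is_deriveB h1 h2.
  apply: (is_derive_eq h3); rewrite /GRing.scale/= mulr1 add0r opprD addrA//.
have d1 (x : R) : - r < x < r -> is_derive x 1 (I (el_rhs r q b v)) (el_rhs r q b v x).
  by move=> xlr; exact: (@prim_is_derive_at _ _ _ _ _ iT xlr (is_derive_cont (d2 x xlr))).
have d3 (x : R) : - r < x < r -> is_derive x 1 (F 3%N) (F 4%N x).
  move=> xlr.
  have h2 := is_deriveZ b (@prim_is_derive_at _ _ _ _ _ ig xlr (cg x xlr)).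
  have h3 := is_deriveB (is_deriveB (is_derive_cst a1 x (1 : R)) (is_deriveZ 2 (d1 x xlr))) h2.
  by apply: (is_derive_eq h3); rewrite /GRing.scale/= sub0r.
have chain : forall k, (k < 4)%N -> forall x : R, - r < x < r -> is_derive x 1 (F k) (F k.+1 x).
  by move=> [|[|[|[|//]]]] _; [exact: d0|exact: d1|exact: d2|exact: d3].
have DF := derive1n_chain chain.
have c4 (x : R) : - r < x < r -> {for x, continuous (F 4%N)}.
  move=> xlr; apply: cvgB; last by apply: cvgM; [exact: cvg_cst|exact: cg].
  by apply: cvgN; apply: cvgM; [exact: cvg_cst|exact: is_derive_cont (d2 x xlr)].
have nearF n (x : R) : (n <= 4)%N -> - r < x < r -> \forall y \near x, derive1n n v y = F n y.
  move=> n4 xlr; have [E _] := DF n n4.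
  by apply: filterS (near_oo xlr) => y; exact: E.
split.
- move=> x xlr n n4; have [_ D] := DF n (ltnW n4).
  exact: D.
- move=> x xlr; have [E _] := DF 4%N isT.
  rewrite /prop_for /continuous_at (E x xlr).
  apply: cvg_trans (c4 x xlr); apply: near_eq_cvg.
  by apply: filterS (nearF 4%N x isT xlr).
- move=> x xlr; have [E4 _] := DF 4%N isT; have [E2 _] := DF 2%N isT.
  rewrite (E4 x xlr) (E2 x xlr) /F /gq /funrpos /funrneg; ring.
- have nearends n f : (n <= 4)%N -> (forall x, - r < x < r -> F n x = f x) ->
      f x @[x --> (- r)^'+] --> (0 : R) -> f x @[x --> r^'-] --> (0 : R) ->
      derive1n n v x @[x --> (- r)^'+] --> (0 : R) /\ derive1n n v x @[x --> r^'-] --> (0 : R).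
    move=> n4 Ff h1 h2; have [E _] := DF n n4; split.
      apply: cvg_trans h1; apply: near_eq_cvg; near=> y.
      have yl : - r < y by near: y; exact: nbhs_right_gt.
      have yr : y < r by near: y; exact: nbhs_right_lt.
      by rewrite (E y) ?yl// Ff ?yl.
    apply: cvg_trans h2; apply: near_eq_cvg; near=> y.
    have yr : y < r by near: y; exact: nbhs_left_lt.
    have yl : - r < y by near: y; exact: nbhs_left_gt.
    by rewrite (E y) ?yl// Ff ?yl.
  move=> [|[|//]] _.
  + have [e1 e2] := prim_ends ltlr iIT; rewrite T2 in e2.
    by apply: (nearends 0%N _ isT vE').
  + have [e1 e2] := prim_ends ltlr iT; rewrite T1 in e2.
    by apply: (nearends 1%N _ isT (fun x _ => erefl _)).
Unshelve. all: by end_near. Qed.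

(** Extended by 0, f becomes continuous on the closed interval. *)
Lemma ends_bounded f : (forall x, - r < x < r -> {for x, continuous f}) ->
  f x @[x --> (- r)^'+] --> (0 : R) -> f x @[x --> r^'-] --> (0 : R) ->
  exists M, forall x, - r < x < r -> `|f x| <= M.
Proof.
move=> cf fl fr; pose f0 := f \_ `]- r, r[.
have f0out x : ~ (- r < x < r) -> f0 x = 0.
  by move=> nx; rewrite /f0 patchE memNset//= in_itv.
have f0in x : - r < x < r -> f0 x = f x by move=> xlr; rewrite /f0 restrict_in//= in_itv.
have cf0 : {within C, continuous f0}.
  apply/(continuous_within_itvP _ ltlr); split.
  - by move=> x; rewrite in_itv/= => xlr; apply: cont_restrict => //; exact: cf.
  - rewrite f0out ?ltxx//; apply: cvg_trans fl; apply: near_eq_cvg; near=> y.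
    have yl : - r < y by near: y; exact: nbhs_right_gt.
    have yr : y < r by near: y; exact: nbhs_right_lt.
    by rewrite f0in// yl.
  - rewrite (f0out r) ?ltxx ?andbF//; apply: cvg_trans fr; apply: near_eq_cvg; near=> y.
    have yr : y < r by near: y; exact: nbhs_left_lt.
    have yl : - r < y by near: y; exact: nbhs_left_gt.
    by rewrite f0in// yl.
have cn : {within C, continuous (fun x => `|f0 x|)}.
  by move=> x; apply: cvg_norm; exact: cf0.
have [c _ Hc] := EVT_max lr cn.
exists `|f0 c| => x xlr; rewrite -f0in//; apply: Hc.
by move: xlr => /andP[? ?]; rewrite in_itv/= !ltW.
Unshelve. all: by end_near. Qed.

Lemma eq_ip_in f f' g : L2 f -> L2 f' -> L2 g -> (forall x, - r < x < r -> f x = f' x) ->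
  ip r f g = ip r f' g.
Proof.
move=> Hf Hf' Hg ff; rewrite /ip -!Rintegral_oo_cc; [|exact: L2_mul..].
by apply: eq_Rintegral => x; rewrite inE/= in_itv/= => xlr; rewrite ff.
Qed.

Lemma ibp_ip d f g : L2 f -> L2 g -> I f r = 0 -> ip r f (fun x => d + I g x) = - ip r (I f) g.
Proof.
move=> Hf Hg f0; rewrite /ip (@ibp _ (- r) r 0 d)//; [|exact: L2L1..].
rewrite f0 addr0 !mul0r subrr sub0r; congr (- _).
by apply: eq_Rintegral => x _; rewrite add0r.
Qed.

(** The identity energy = b mass comes from testing the equation against v
    and integrating by parts. It is stated for the derivatives of h as
    primitives, whose constants c2 and c3 are unknown: a classical solution
    has no prescribed values of v'' and v''' at the ends, and the boundary
    terms vanish because those of v and v' do. *)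
Lemma energy_identity b h g3 g4 c2 c3 : clamped r h -> L2 g3 -> L2 g4 ->
  (forall x, - r < x < r -> h x = c2 + I g3 x) ->
  (forall x, - r < x < r -> g3 x = c3 + I g4 x) ->
  (forall x, - r < x < r -> g4 x = - 2 * h x + - b * gq q (I (I h) x)) ->
  energy r h = b * mass r q h.
Proof.
move=> Ch H3 H4 E2 E3 E4; have [Hh h1 h2] := Ch.
have Hv := L2I r0 (L2I r0 Hh); have HI := L2I r0 Hh; have gv := L2g q1 Hv.
have cI c g : L2 g -> L2 (fun x => c + I g x).
  by move=> Hg; exact: (L2D mC (L2cst r c) (L2I r0 Hg)).
have s1 : ip r h h = - ip r (I h) g3.
  by rewrite (eq_ip_in Hh (cI c2 _ H3) Hh E2) ipC; exact: ibp_ip.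
have s2 : ip r (I h) g3 = - ip r (I (I h)) g4.
  by rewrite ipC (eq_ip_in H3 (cI c3 _ H4) HI E3) ipC; exact: ibp_ip.
have Hm := L2Z (- 2) mC Hh; have Hbg := L2Z (- b) mC gv.
have s3 : ip r (I (I h)) g4 = - 2 * ip r (I (I h)) h + - b * mass r q h.
  rewrite ipC (eq_ip_in H4 (L2D mC Hm Hbg) Hv E4) (ipDl Hm Hbg Hv).
  by rewrite (ipZl (- 2) Hh Hv) (ipZl (- b) gv Hv) mass_ip// [ip r h _]ipC.
rewrite energy_expand// s1 s2 s3.
have arith (A B : R) : - (2 * A + - - (- 2 * A + - b * B)) = b * B by ring.
exact: arith.
Qed.

(** The boundary behaviour of v'' and v''' is not part of the notion of
    solution. But v''' + 2 v' has the bounded derivative - b gq(v), so it is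
    bounded, and with v' also v''' is; integrating, v'' is bounded, and then
    v''''. Every derivative up to order 4 is therefore square-integrable and
    v is clamped. *)
Lemma classical_clamped b (v : R -> R) : classical_solution r (q * b) b v ->
  exists h, [/\ clamped r h, forall x, - r < x < r -> v x = I (I h) x &
    energy r h = b * mass r q h].
Proof.
move=> [dv c4 ode ends].
pose w n := derive1n n v.
have dW k (x : R) : (k < 4)%N -> - r < x < r -> is_derive x 1 (w k) (w k.+1 x).
  by move=> k4 xlr; apply: DeriveDef; [exact: dv|rewrite /w derive1nS derive1E].
have odew x : - r < x < r -> w 4%N x = - 2 * w 2%N x - b * gq q (v x).
  have arith (a c d e : R) : a + 2 * c + q * b * d - b * e = 0 -> a = - 2 * c - b * (q * d - e) by lra.
  by move=> xlr; exact: arith (ode x xlr).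
have cw k x : (k <= 4)%N -> - r < x < r -> {for x, continuous (w k)}.
  rewrite leq_eqVlt => /predU1P[->|k4] xlr; first exact: c4.
  exact: is_derive_cont (dW k x k4 xlr).
have [M0 HM0] : exists M, forall x, - r < x < r -> `|w 0%N x| <= M.
  by have [? ?] := ends 0%N isT; apply: ends_bounded => // x; exact: cw.
have [M1 HM1] : exists M, forall x, - r < x < r -> `|w 1%N x| <= M.
  by have [e1 e2] := ends 1%N isT; exact: (ends_bounded (fun x => cw 1%N x isT) e1 e2).
have gM x : - r < x < r -> `|b * gq q (v x)| <= `|b| * (q * M0).
  move=> xlr; rewrite normrM ler_wpM2l// (le_trans (gq_le q1 _))// ler_wpM2l//.
    by apply: ltW; apply: lt_trans q1.
  exact: HM0.
have [M3' HM3'] : exists M, forall x, - r < x < r -> `|w 3%N x + 2 * w 1%N x| <= M.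
  apply: (@bounded_of_derive _ (- r) r (`|b| * (q * M0)) _ (fun x => - (b * gq q (v x))) ltlr).
    move=> x xlr; have h := is_deriveD (dW 3%N x isT xlr) (is_deriveZ 2 (dW 1%N x isT xlr)).
    apply: (is_derive_eq h); rewrite odew// /GRing.scale/=; ring.
  by move=> x xlr; rewrite normrN gM.
have HM3 x : - r < x < r -> `|w 3%N x| <= M3' + 2 * M1.
  move=> xlr; rewrite -[w 3%N x](addrK (2 * w 1%N x)) (le_trans (ler_normB _ _))//.
  by rewrite lerD ?HM3'// normrM ger0_norm// ler_wpM2l// HM1.
have [M2 HM2] := bounded_of_derive ltlr (fun x xlr => dW 2%N x isT xlr) HM3.
have HM4 x : - r < x < r -> `|w 4%N x| <= 2 * M2 + `|b| * (q * M0).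
  move=> xlr; rewrite odew// mulNr (le_trans (ler_normB _ _))// normrN lerD ?gM//.
  by rewrite normrM ger0_norm// ler_wpM2l// HM2.
pose z n := w n \_ `]- r, r[.
have zT n M : (n <= 4)%N -> (forall x, - r < x < r -> `|w n x| <= M) -> square_integrable setT (z n).
  by move=> n4; apply: L2_oo => x; exact: cw.
have z1 := zT 1%N _ isT HM1. have z2 := zT 2%N _ isT HM2.
have z3 := zT 3%N _ isT HM3. have z4 := zT 4%N _ isT HM4.
have zC n : square_integrable setT (z n) -> L2 (z n) by move=> Hz; exact: square_integrable_sub Hz.
have zin n x : - r < x < r -> z n x = w n x by move=> xlr; rewrite /z restrict_in//= in_itv.
have rep n : (n < 4)%N -> square_integrable setT (z n.+1) ->
    exists c, forall x, - r < x < r -> w n x = c + I (z n.+1) x.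
  move=> n4 Hz; apply: (primitive_rep ltlr _ _ Hz) => x xlr; first exact: (dW n x n4 xlr).
  exact: (cw n.+1 x n4 xlr).
have rep0 n : (n < 2)%N -> square_integrable setT (z n.+1) ->
    (forall x, - r < x < r -> w n x = I (z n.+1) x) /\ I (z n.+1) r = 0.
  move=> n2 Hz; have [c Hc] := rep n (@leq_trans 2 _ 4 n2 isT) Hz.
  have iz := L2L1 (zC _ Hz).
  have [pl pr] := prim_ends ltlr iz; have [el er] := ends n n2.
  have c0 : c = 0.
    have cl : c + I (z n.+1) x @[x --> (- r)^'+] --> c + 0 by apply: cvgD => //; exact: cvg_cst.
    rewrite -[c]addr0; apply/esym/(@cvg_unique _ (@Rhausdorff R) _ _ _ _ el).
    apply: cvg_trans cl; apply: near_eq_cvg; near=> y.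
    have yl : - r < y by near: y; exact: nbhs_right_gt.
    have yr : y < r by near: y; exact: nbhs_right_lt.
    by rewrite -/(w n) Hc// yl.
  rewrite c0 in Hc; split => [x xlr|]; first by rewrite Hc// add0r.
  apply/esym/(@cvg_unique _ (@Rhausdorff R) _ _ _ _ er).
  apply: cvg_trans pr; apply: near_eq_cvg; near=> y.
  have yr : y < r by near: y; exact: nbhs_left_lt.
  have yl : - r < y by near: y; exact: nbhs_left_gt.
  by rewrite -/(w n) Hc ?add0r// yl.
have [E0 F0] := rep0 0%N isT z1. have [E1 F1] := rep0 1%N isT z2.
have [c2 E2] := rep 2%N isT z3. have [c3 E3] := rep 3%N isT z4.
pose h := z 2%N; exists h.
have Hh : L2 h := zC _ z2.
have z1h x : x <= r -> I (z 1%N) x = I (I h) x.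
  move=> xr; apply: (eq_prim_ae (L2L1 (zC _ z1)) (L2L1 (L2I r0 Hh)) _ xr).
  by apply: aeW => t tlr; rewrite zin// E1.
have Ch : clamped r h by split => //; rewrite -z1h.
have vh x : - r < x < r -> v x = I (I h) x.
  by move=> /[dup] xlr /andP[_ xr]; rewrite -z1h ?(ltW xr)//; exact: E0.
split => //.
apply: (energy_identity Ch (zC _ z3) (zC _ z4) (c2 := c2) (c3 := c3)) => x xlr.
- by rewrite /h zin// E2.
- by rewrite zin// E3.
- by rewrite zin// odew// /h zin// -vh// [- b * _]mulNr.
Unshelve. all: by end_near. Qed.

(** A vanishing mass would make the primitive of v vanish, hence v at each
    of its continuity points. *)
Lemma mass_gt0 h x : L2 h -> - r < x < r -> I (I h) x != 0 -> 0 < mass r q h.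
Proof.
move=> Hh xlr vx; rewrite lt_neqAle mass_ge0// andbT; apply/eqP => m0.
have Hv := L2I r0 (L2I r0 Hh); have iv := L2L1 Hv.
have := norm1_sq r0 Hv; have := ip_le_mass r0 q1 Hh; rewrite -m0 => ip0 nle.
have n0 : norm1 r (I (I h)) = 0.
  apply/eqP; rewrite -sqrf_eq0 eq_le sqr_ge0 andbT (le_trans nle)//.
  by rewrite mulr_ge0_le0// mulr_ge0// ltW.
have Iv y : C y -> I (I (I h)) y = 0.
  by move=> Cy; apply/eqP; rewrite -normr_le0 -n0; exact: prim_norm1.
have cv : {for x, continuous (I (I h))}.
  have [ci _ _] := (continuous_within_itvP _ ltlr).1 (prim_cont lr (L2L1 (L2I r0 Hh))).
  by apply: ci; rewrite in_itv.
have [_ d1] := prim_is_derive_at iv xlr cv.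
have nz : \forall y \near x, (cst 0 : R -> R) y = I (I (I h)) y.
  apply: filterS (near_oo xlr) => y /andP[ry yr].
  by rewrite Iv//= in_itv/= !ltW.
have [_ d2] := near_eq_is_derive nz (is_derive_cst (0 : R) x (1 : R)).
by move: vx; rewrite -d1 d2 eqxx.
Qed.

(** This is where r > sqrt 2 pi / 2 enters: the function with second
    derivative cos (pi x / r) is clamped and has energy r (2 r^2 / pi^2 -
    1). *)
Lemma cos_clamped : Num.sqrt 2 * pi / 2 < r -> exists h, clamped r h /\ 0 < energy r h.
Proof.
move=> rpi; pose k : R := pi / r.
have pi0 : 0 < pi :> R by exact: pi_gt0.
have k0 : 0 < k by rewrite divr_gt0.
have kn0 : k != 0 by rewrite gt_eqF.
have kr : k * r = pi by rewrite /k divfK// gt_eqF.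
have dk (x : R) : is_derive x 1 (fun x : R => k * x) k.
  apply: (is_derive_eq (is_deriveZ k (is_derive_id x (1 : R)))).
  by rewrite /GRing.scale/= mulr1.
have ds (x : R) : is_derive x 1 (fun x => sin (k * x)) (cos (k * x) * k).
  exact: (@is_derive1_comp _ sin (fun x => k * x) x _ _ (is_derive_sin _) (dk x)).
have dc (x : R) : is_derive x 1 (fun x => cos (k * x)) (- sin (k * x) * k).
  exact: (@is_derive1_comp _ cos (fun x => k * x) x _ _ (is_derive_cos _) (dk x)).
have cs : continuous (fun x : R => sin (k * x)) by move=> x; exact: is_derive_cont (ds x).
have cc : continuous (fun x : R => cos (k * x)) by move=> x; exact: is_derive_cont (dc x).
pose h (x : R) := cos (k * x); exists h.
have bL2 (f : R -> R) : continuous f -> L2 f.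
  move=> cf; have cn : {within C, continuous f} by exact: continuous_subspaceT.
  have cnn : {within C, continuous (fun x => `|f x|)} by move=> x; apply: cvg_norm; exact: cn.
  have [c _ Hc] := EVT_max lr cnn.
  by apply: (@L2_bounded _ _ _ `|f c|) => //; [exact: itv_fin|exact: subspace_continuous_measurable_fun].
have Hh : L2 h by exact: bL2.
have Ihx x : - r <= x -> I h x = k^-1 * sin (k * x).
  move=> rx; have dF (y : R) : is_derive y 1 (fun y => k^-1 * sin (k * y)) (h y).
    apply: (is_derive_eq (is_deriveZ k^-1 (ds y))).
    by rewrite /GRing.scale/= mulrC mulfK.
  by rewrite (ftc_prim dF cc rx) mulrN kr sinN sinpi oppr0 mulr0 subr0.
have IIhx x : - r <= x -> I (I h) x = - (k ^- 2) * (cos (k * x) + 1).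
  move=> rx; have dF (y : R) : is_derive y 1 (fun y => - (k ^- 2) * cos (k * y)) (k^-1 * sin (k * y)).
    apply: (is_derive_eq (is_deriveZ (- (k ^- 2)) (dc y))).
    by rewrite /GRing.scale/=; field.
  have cI : continuous (fun y => k^-1 * sin (k * y)) by move=> y; apply: cvgM; [exact: cvg_cst|exact: cs].
  rewrite (@eq_prim _ _ _ _ (fun y => k^-1 * sin (k * y))) => [|t /andP[rt _]]; last exact: Ihx.
  by rewrite (ftc_prim dF cI rx) mulrN kr cosN cospi; ring.
split.
  by split => //; [rewrite Ihx// kr sinpi mulr0|rewrite IIhx// kr cospi addNr mulr0].
pose s (x : R) := sin (k * x).
have Hs : L2 s by exact: bL2.
have E : energy r h = 2 * (k ^- 2 * ip r s s) - ip r h h.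
  rewrite /energy; congr (2 * _ - _).
  have HIs : L2 (fun x => k^-1 * s x) by exact: L2Z.
  have EI x : - r < x < r -> I h x = k^-1 * s x.
    by move=> /andP[rx _]; rewrite Ihx// ltW.
  have HI := L2I r0 Hh.
  rewrite (eq_ip_in HI HIs HI EI) ipC (eq_ip_in HI HIs HIs EI).
  by rewrite ipZl// ipZr// mulrA -invfM.
have S1 : ip r h h + ip r s s = 2 * r.
  rewrite -(ip11 r0) /ip -RintegralD//; [|exact: L2_mul..].
  by apply: eq_Rintegral => x _; rewrite -!expr2 cos2Dsin2 expr1n.
(* The antiderivative of cos^2 - sin^2 is sin cos / k, which vanishes at
   both ends; with S1, both squares have integral r. *)
have S2 : ip r h h - ip r s s = 0.
  rewrite /ip -RintegralB//; [|exact: L2_mul..].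
  have dF (y : R) : is_derive y 1 (fun y => k^-1 * (sin (k * y) * cos (k * y))) (h y * h y - s y * s y).
    apply: (is_derive_eq (is_deriveZ k^-1 (is_deriveM (ds y) (dc y)))).
    by rewrite /GRing.scale/= /h /s; field.
  have cf : continuous (fun y => h y * h y - s y * s y).
    by move=> y; apply: cvgB; apply: cvgM; try exact: cs; exact: cc.
  rewrite -[LHS]/(I (fun y => h y * h y - s y * s y) r) (ftc_prim dF cf lr).
  by rewrite mulrN kr sinN sinpi; ring.
have hr : ip r h h = r by lra. have sr : ip r s s = r by lra.
rewrite E hr sr.
have r2 : pi ^+ 2 < 2 * r ^+ 2.
  have sq : Num.sqrt (2 : R) ^+ 2 = 2 by rewrite sqr_sqrtr.
  have : (Num.sqrt 2 * pi / 2) ^+ 2 < r ^+ 2.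
    by rewrite ltr_sqr ?nnegrE ?(ltW r0)// divr_ge0// mulr_ge0// ?sqrtr_ge0// ltW.
  by rewrite !exprMn sq; lra.
have k2 : k ^- 2 = r ^+ 2 / pi ^+ 2 by rewrite /k exprMn exprVn invfM invrK mulrC.
have : 1 < 2 * k ^- 2 by rewrite k2 mulrA ltr_pdivlMr ?exprn_gt0// mul1r.
move=> h1; rewrite subr_gt0 mulrA -[ltLHS]mul1r ltr_pM2r//.
Qed.

(** The energies over the constraint set, read on second derivatives;
    beta_star_r is their supremum. *)
Definition energy_values : set R := [set energy r h | h in [set h | clamped r h /\ mass r q h = 1]].

Lemma clamped_energyE v h : clamped r h ->
  measurable_fun `]- r, r[ (wderiv `]- r, r[ v) ->
  measurable_fun `]- r, r[ (wderiv `]- r, r[ (wderiv `]- r, r[ v)) ->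
  {ae mu, forall x, - r < x < r -> wderiv `]- r, r[ v x = I h x} ->
  {ae mu, forall x, - r < x < r -> wderiv `]- r, r[ (wderiv `]- r, r[ v) x = h x} ->
  clamped_energy r v = energy r h.
Proof.
move=> [Hh _ _] m1 m2 e1 e2; have HI := L2I r0 Hh.
have i1 := L1Z 2 mC (L2_mul mC HI HI); have i2 := L2_mul mC Hh Hh.
have i3 := L1B mC i1 i2.
have [mh _] := Hh; have [mI _] := HI.
have sub : `]- r, r[%classic `<=` C by exact: subset_itv_oo_cc.
transitivity (\int[mu]_(x in `]- r, r[) (2 * (I h x * I h x) - h x * h x)).
  apply: ae_eq_Rintegral => //.
  - by apply: measurable_funB; [apply: measurable_funM => //|]; exact: measurable_funX.
  - by apply: measurable_funS sub _ => //; exact: L1_measurable i3.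
  - apply: ae_imp2 e1 e2 => x h1 h2; rewrite /= in_itv/= => xlr.
    by rewrite h1// h2// !expr2.
by rewrite Rintegral_oo_cc// RintegralB// RintegralZl//; exact: L2_mul.
Qed.

Lemma massE v h : clamped r h -> measurable_fun `]- r, r[ v ->
  {ae mu, forall x, - r < x < r -> v x = I (I h) x} ->
  \int[mu]_(x in `]- r, r[) (q * v^\+ x ^+ 2 + v^\- x ^+ 2) = mass r q h.
Proof.
move=> [Hh _ _] mv e; have Hv := L2I r0 (L2I r0 Hh).
have iG := L1G q1 Hv.
have sub : `]- r, r[%classic `<=` C by exact: subset_itv_oo_cc.
transitivity (\int[mu]_(x in `]- r, r[) (Gq q (I (I h) x))).
  apply: ae_eq_Rintegral => //.
  - apply: measurable_funD; last by apply: measurable_funX; exact: measurable_funrneg.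
    by apply: measurable_funM => //; apply: measurable_funX; exact: measurable_funrpos.
  - by apply: measurable_funS sub _ => //; exact: L1_measurable iG.
  - by apply: ae_imp e => x h1; rewrite /= in_itv/= => xlr; rewrite /funrpos /funrneg h1.
by rewrite Rintegral_oo_cc.
Qed.

Lemma H20_values v : sobolevH20 r v -> exists h, [/\ clamped r h,
  clamped_energy r v = energy r h &
  \int[mu]_(x in `]- r, r[) (q * v^\+ x ^+ 2 + v^\- x ^+ 2) = mass r q h].
Proof.
move=> Hv; have [Ch e0 e1 e2] := H20_clamped r0 Hv.
have [[H1 H2] _ _] := Hv; have [[m1 _] _] := H1_wderiv H1; have [[m2 _] _] := H1_wderiv H2.
exists ((wderiv `]- r, r[ (wderiv `]- r, r[ v)) \_ (`]- r, r[)); split => //.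
- exact: clamped_energyE.
- by apply: massE => //; case: H1 => [[]].
Qed.

Lemma values_H20 h : clamped r h -> exists v, [/\ sobolevH20 r v,
  clamped_energy r v = energy r h &
  \int[mu]_(x in `]- r, r[) (q * v^\+ x ^+ 2 + v^\- x ^+ 2) = mass r q h].
Proof.
move=> Ch; have [Hv e1 e2] := clamped_H20 r0 Ch.
have [[H1 H2] _ _] := Hv; have [[m1 _] _] := H1_wderiv H1; have [[m2 _] _] := H1_wderiv H2.
exists (I (I h)); split => //.
- exact: clamped_energyE.
- by apply: massE => //; [case: H1 => [[]]|exact: aeW].
Qed.

Lemma beta_star_rE : beta_star_r r q = ereal_sup (EFin @` energy_values).
Proof.
rewrite /beta_star_r; congr ereal_sup; apply/seteqP; split => x /=.
- move=> [v [Hv mv] <-]; have [h [Ch eh mh]] := H20_values Hv.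
  by exists (energy r h); [exists h => //; split => //; rewrite -mh|rewrite eh].
- move=> [_ [h [Ch mh] <-] <-]; have [v [Hv ev mv]] := values_H20 Ch.
  by exists v; [split => //; rewrite mv|rewrite ev].
Qed.

Lemma has_sup_values : Num.sqrt 2 * pi / 2 < r -> has_sup energy_values /\ 0 < sup energy_values.
Proof.
move=> rpi; have [h [Ch eh]] := cos_clamped rpi.
have hub : has_ubound energy_values.
  by exists 1 => _ [k [Ck mk] <-]; rewrite -mk; exact: energy_le_mass.
have m0 : 0 < mass r q h by apply: lt_le_trans eh _; exact: energy_le_mass.
pose c := (Num.sqrt (mass r q h))^-1.
have c0 : 0 < c by rewrite invr_gt0 sqrtr_gt0.
have c2 : c ^+ 2 = (mass r q h)^-1 by rewrite exprVn sqr_sqrtr// ltW.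
have v0 : energy_values (c ^+ 2 * energy r h).
  exists (fun x => c * h x); last by rewrite energyZ.
  split; first exact: clampedZ.
  by rewrite massZ// ?ltW// c2 mulVf// gt_eqF.
split; first by split => //; exists (c ^+ 2 * energy r h).
apply: (@lt_le_trans _ _ (c ^+ 2 * energy r h)); first by rewrite mulr_gt0// exprn_gt0.
by apply: ub_le_sup.
Qed.

(** By homogeneity the constraint can be dropped. For mass 0 no rescaling is
    possible, and the bound energy_le_mass is used. *)
Lemma energy_le_sup k : has_sup energy_values -> 0 < sup energy_values -> clamped r k -> energy r k <= sup energy_values * mass r q k.
Proof.
move=> [_ hub] b0 Ck.
have [m0|] := ltP 0 (mass r q k).
  pose c := (Num.sqrt (mass r q k))^-1.
  have c0 : 0 < c by rewrite invr_gt0 sqrtr_gt0.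
  have c2 : c ^+ 2 = (mass r q k)^-1 by rewrite exprVn sqr_sqrtr// ltW.
  have : c ^+ 2 * energy r k <= sup energy_values.
    apply: ub_le_sup => //; exists (fun x => c * k x); last by rewrite energyZ.
    split; first exact: clampedZ.
    by rewrite massZ// ?ltW// c2 mulVf// gt_eqF.
  by rewrite c2 mulrC ler_pdivrMr.
move=> m0; have -> : mass r q k = 0.
  by apply/eqP; rewrite eq_le m0 mass_ge0.
by rewrite mulr0 (le_trans (energy_le_mass r0 q1 Ck)).
Qed.

(** Any point of the Fucik spectrum on the ray is a Rayleigh quotient of
    energy by mass, whence the upper bound in fucik_max. *)
Lemma fucik_ray_value b : fucik_ray r q b ->
  exists h, [/\ clamped r h, 0 < mass r q h & energy r h = b * mass r q h].
Proof.
move=> [_ [v cv [x xlr vx]]].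
have [h [Ch vh eh]] := classical_clamped cv.
exists h; split => //; have [Hh _ _] := Ch.
by apply: (mass_gt0 Hh xlr); rewrite -vh.
Qed.

(** The supremum is attained, and its maximiser solves the equation with b
    the supremum; conversely every b on the ray is a quotient of energy by
    mass, so is at most the supremum. *)
Lemma fucik_max : Num.sqrt 2 * pi / 2 < r ->
  is_max (fucik_ray r q) (sup energy_values) /\ beta_star_r r q = (sup energy_values)%:E.
Proof.
move=> rpi; have [hs b0] := has_sup_values rpi.
split; last by rewrite beta_star_rE ereal_sup_EFin//; [case: hs|case: hs].
split.
  have [|v [cv L2v vE [x Cx vx]]] := exists_extremal r0 q1 b0 (fun k => energy_le_sup hs b0).
    move=> e e0; have [_ [h [Ch mh] <-] eh] := sup_adherent e0 hs.
    by exists h; split => //; exact: ltW.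
  split => //; exists v; first exact: classical_of_extremal.
  have [T0 T1 T2] := clamped_el_rhs r0 q1 (sup energy_values) L2v.
  exists x => //; move: (Cx); rewrite /= in_itv/= !le_eqVlt => /andP[/predU1P[xl|->] /predU1P[xr|->]] //.
  - by move: vx; rewrite vE// -xl prim_left eqxx.
  - by move: vx; rewrite vE// -xl prim_left eqxx.
  - by move: vx; rewrite vE// xr T2 eqxx.
move=> b fb; have [h [Ch m0 eh]] := fucik_ray_value fb.
by rewrite -(ler_pM2r m0) -eh; exact: energy_le_sup.
Qed.

End Classical.

(** * Passing from intervals to the whole line *)

Section Whole.
Context {R : realType}.
Local Notation mu := (@lebesgue_measure R).
Implicit Types (D : set R) (f g u phi psi : R -> R).

Lemma Rintegral_restrictM (D : set R) f g :
  \int[mu]_x ((f \_ D) x * g x) = \int[mu]_(x in D) (f x * g x).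
Proof.
rewrite [RHS]Rintegral_mkcond; apply: eq_Rintegral => x _.
by rewrite !patchE; case: ifP => //; rewrite mul0r.
Qed.

(** A primitive vanishing at both ends has no jump when it is extended by
    zero. *)
Lemma zero_extension_weak (l r : R) g : l <= r -> mu.-integrable `[l, r] (EFin \o g) -> prim l g r = 0 ->
  is_weak_derivative setT ((prim l g) \_ `]l, r[) (g \_ `]l, r[).
Proof.
move=> lr g1 gr phi tphi; have sphi := test_function_smooth tphi.
have ip1 := L1_prim lr g1.
rewrite !Rintegral_restrictM !Rintegral_oo_cc; last 2 first.
- exact: L1_smooth.
- exact: L1_smooth ip1 (smooth_derive1 sphi).
have := ibp_smooth 0 lr g1 sphi; rewrite gr addr0 !mul0r subrr sub0r => <-.
by apply: eq_Rintegral => x _; rewrite add0r.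
Qed.

(** Zero extension turns energy = b mass on an interval into J = 0 on the
    line. *)
Lemma zero_extension_J (r q b : R) h : 0 < r -> 1 < q -> clamped r h -> 0 < mass r q h ->
  energy r h = b * mass r q h ->
  exists v : R -> R, [/\ sobolevH2 setT v, ~ {ae mu, forall x, v x = 0} & J (q * b) b v = 0].
Proof.
move=> r0 q1 Ch m0 eh; have [Hh h1 h2] := Ch.
have lr : - r <= r by rewrite ge0_cp// ltW.
have ltlr : - r < r by rewrite gtrN.
have mC : measurable (`[- r, r]%classic : set R) by exact: measurable_itv.
have Hh1 := L2L1 Hh; have HI := L2I r0 Hh; have HI1 := L2L1 HI; have HV := L2I r0 HI.
have sub : `]- r, r[%classic `<=` (`[- r, r]%classic : set R) by exact: subset_itv_oo_cc.
have rT f : square_integrable `[- r, r] f -> square_integrable setT (f \_ `]- r, r[).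
  by move=> Hf; apply: L2_restrict => //; exact: square_integrable_sub sub Hf.
pose v := (prim (- r) (prim (- r) h)) \_ `]- r, r[.
pose w1 := (prim (- r) h) \_ `]- r, r[.
pose w2 := h \_ `]- r, r[.
have sv : square_integrable setT v by exact: rT.
have s1 : square_integrable setT w1 by exact: rT.
have s2 : square_integrable setT w2 by exact: rT.
have W1 : is_weak_derivative setT v w1 by exact: zero_extension_weak.
have W2 : is_weak_derivative setT w1 w2 by exact: zero_extension_weak.
have E1 := wderiv_aeT s1 W1.
have [sd1 Wd1] := wderivP s1 W1.
have W2' : is_weak_derivative setT (wderiv setT v) w2.
  apply: weak_derivative_ae W2 => //; [by case: s1|by case: sd1|].
  by apply: ae_imp E1 => x -> _.
have E2 := wderiv_aeT s2 W2'.
have [sd2 Wd2] := wderivP s2 W2'.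
exists v; split.
- by split; split => //; [exists w1|exists w2].
- move=> v0; move: m0; rewrite -(massE r0 q1 Ch (v := cst 0))//.
    rewrite (@eq_Rintegral _ _ _ _ _ (cst 0)) => [|x _]; last first.
      by rewrite /funrpos /funrneg /= oppr0 maxxx expr0n /= mulr0 addr0.
    by rewrite Rintegral_cst// mul0r ltxx.
  by apply: ae_imp v0 => x; rewrite /v => vx xlr; rewrite -[LHS]vx restrict_in//= in_itv.
- rewrite /J.
  have iG := L1G q1 HV; have i11 := L2_mul mC HI HI; have i22 := L2_mul mC Hh Hh.
  pose k x := h x * h x - 2 * (prim (- r) h x * prim (- r) h x) + b * Gq q (prim (- r) (prim (- r) h) x).
  have ik : mu.-integrable `[- r, r] (EFin \o k).
    by apply: L1D => //; [apply: L1B => //; exact: L1Z|exact: L1Z].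
  transitivity (\int[mu]_x (k \_ `]- r, r[) x).
    apply: ae_eq_Rintegral => //.
    + apply: measurable_funD; [apply: measurable_funD; [apply: measurable_funB|]|].
      * by apply: measurable_funX; case: sd2.
      * by apply: measurable_funM => //; apply: measurable_funX; case: sd1.
      * by apply: measurable_funM => //; apply: measurable_funX; apply: measurable_funrpos; case: sv.
      * by apply: measurable_funM => //; apply: measurable_funX; apply: measurable_funrneg; case: sv.
    + by apply: L1_measurable; apply: L1_restrict => //; exact: L1_subset sub _.
    + apply: ae_imp2 E1 E2 => x -> -> _; rewrite /w1 /w2 /v /funrpos /funrneg !patchE.
      case: ifP => _; first by rewrite /k /Gq; ring.
      by rewrite oppr0 maxxx expr0n /= !mulr0 subrr !addr0.
  rewrite -Rintegral_mkcond Rintegral_oo_cc// RintegralD//; [|by apply: L1B => //; exact: L1Z|exact: L1Z].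
  rewrite RintegralB//; last exact: L1Z.
  rewrite !RintegralZl//.
  move: eh; rewrite /energy /mass /ip => eh.
  by move: eh; lra.
Qed.

(** A function vanishing outside ]-r, r[ is a primitive of its weak
    derivative, without constant: on a slightly larger interval the
    representation holds up to a constant, which is read off to the left of
    -r, while the condition at r is read off to the right of r. *)
Lemma prim_of_weak_compact (r : R) u g : 0 < r -> square_integrable setT u -> square_integrable setT g ->
  is_weak_derivative setT u g -> (forall x, r <= `|x| -> u x = 0) -> (forall x, r <= `|x| -> g x = 0) ->
  {ae mu, forall x, - r < x < r -> u x = prim (- r) g x} /\ prim (- r) g r = 0.
Proof.
move=> r0 su sg wg u0 g0.
have ltl : - (r + 1) < r + 1 by lra.
pose D : set R := `]- (r + 1), (r + 1)[.
have mD : measurable D by exact: measurable_itv.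
have [||c Hc] := weak_derivative_rep ltl (u := u) (g := g) _ _ (weak_derivative_sub mD measurableT (@subsetT _ _) wg).
- exact: square_integrable_sub su.
- exact: square_integrable_sub sg.
pose h := g \_ D.
have hE x : h x = g x.
  rewrite /h patchE; case: ifPn => // xD; apply/esym/g0.
  rewrite leNgt; apply/negP; rewrite ltr_norml => xr; move/negP: xD; apply.
  by rewrite inE /D /= in_itv/=; move: xr; lra.
have h1 : mu.-integrable `[- (r + 1), r + 1] (EFin \o h).
  apply: L1_cc_restrict; apply: L2_L1; [by []|exact: oo_fin|exact: square_integrable_sub sg].
have left (x : R) : - (r + 1) <= x -> x <= - r -> prim (- (r + 1)) h x = 0.
  move=> lx xr; rewrite -[RHS](mul0r (x - (- (r + 1)))) -prim_cst//.
  apply: eq_prim => t tx; rewrite hE g0// ler0_norm; lra.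
have mid (x : R) : - r <= x -> x <= r + 1 -> prim (- (r + 1)) h x = prim (- r) g x.
  move=> rx xr; have := prim_sub (x := - r) (y := x) h1.
  have rr : - (r + 1) <= - r by lra.
  rewrite (left (- r) rr (lexx _)) subr0 => -> //.
  by apply: eq_prim => t _; rewrite hE.
have c0 : c = 0.
  have ll : - (r + 1) < - r by lra.
  have [x xlr] := ae_exists_itv ll Hc; rewrite u0; last by rewrite ler0_norm; lra.
  rewrite left; [|lra..]; rewrite addr0 => -> //; lra.
split.
  apply: ae_imp Hc => x Hx xlr; rewrite Hx ?c0 ?add0r ?mid//; lra.
have rr : r < r + 1 by lra.
have [x xlr] := ae_exists_itv rr Hc; rewrite u0; last by rewrite ger0_norm; lra.
rewrite c0 add0r mid; [|lra..] => H.
have -> : prim (- r) g r = prim (- r) g x.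
  rewrite -!mid; [|lra..].
  apply/esym/eqP; rewrite -subr_eq0 (prim_sub h1); [|lra..].
  rewrite -/(prim r h x) -(mul0r (x - r)) -prim_cst; last by lra.
  apply/eqP; apply: eq_prim => t tx; rewrite hE g0// ger0_norm; lra.
rewrite -H//; lra.
Qed.

Lemma test_function_bounded D (phi : R -> R) : test_function D phi -> exists B, forall x, `|phi x| <= B.
Proof.
move=> tphi; have sphi := test_function_smooth tphi; have [_ [K [cK KD] K0]] := tphi.
have : compact (phi @` K).
  by apply: continuous_compact => //; apply: continuous_subspaceT; exact: smooth_continuous.
move=> /compact_bounded/ex_strict_bound_gt0[B B0 HB]; exists B => x.
have [Kx|nKx] := pselect (K x); first by apply/ltW/HB; exists x.
by rewrite K0// normr0 ltW.
Qed.

Lemma test_function_L2 (phi : R -> R) : test_function setT phi -> square_integrable setT phi.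
Proof.
move=> tphi; have sphi := test_function_smooth tphi; have [_ [K [cK _] K0]] := tphi.
have [B HB] := test_function_bounded tphi.
have /ex_strict_bound_gt0[N N0 HN] := compact_bounded cK.
have mphi : measurable_fun setT phi.
  by apply: continuous_measurable_fun; exact: smooth_continuous.
have mN : measurable (`[- N, N]%classic : set R) by exact: measurable_itv.
have := @L2_bounded R `[- N, N] phi B mN (itv_fin _ _) (measurable_funTS mphi) (fun x _ => HB x).
move=> /(L2_restrict mN); congr square_integrable; apply/funext => x.
rewrite patchE; case: ifPn => // xN; rewrite K0// => Kx; move/negP: xN; apply.
by rewrite inE /= in_itv/= -ler_norml; apply/ltW/HN.
Qed.

Lemma test_function_mul D (psi phi : R -> R) : smooth psi -> test_function D phi -> test_function D (fun x => psi x * phi x).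
Proof.
move=> spsi [sphi [K KD K0]]; split; first exact: smoothM.
by exists K => // x /K0 ->; rewrite mulr0.
Qed.

Lemma derive1M f g : smooth f -> smooth g ->
  derive1 (fun x => f x * g x) = (fun x => derive1 f x * g x + f x * derive1 g x).
Proof.
move=> sf sg; apply/funext => x; rewrite derive1E.
have df := smooth_is_derive sf x; have dg := smooth_is_derive sg x.
have dfg := is_deriveM df dg.
by rewrite (derive_val (is_derive := dfg)) /GRing.scale/=; ring.
Qed.

Lemma weak_derivativeM (psi u g : R -> R) : smooth psi -> square_integrable setT u -> square_integrable setT g ->
  is_weak_derivative setT u g ->
  is_weak_derivative setT (fun x => psi x * u x) (fun x => psi x * g x + derive1 psi x * u x).
Proof.
move=> spsi su sg wg phi tphi; have sphi := test_function_smooth tphi.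
have sdpsi := smooth_derive1 spsi; have tdphi := derive1_test_function tphi.
have t1 := test_function_mul spsi tphi.
have i1 := L2_mul measurableT sg (test_function_L2 t1).
have i2 := L2_mul measurableT su (test_function_L2 (test_function_mul sdpsi tphi)).
have i3 := L2_mul measurableT su (test_function_L2 (test_function_mul spsi tdphi)).
transitivity (\int[mu]_x (u x * (psi x * derive1 phi x))).
  by apply: eq_Rintegral => x _; ring.
have := wg _ t1; rewrite derive1M//.
under eq_Rintegral do rewrite mulrDr.
rewrite RintegralD// => H.
transitivity (- \int[mu]_x (g x * (psi x * phi x) + u x * (derive1 psi x * phi x))).
  by rewrite RintegralD//; lra.
by congr (- _); apply: eq_Rintegral => x _; ring.
Qed.

Lemma L2_mul_bounded D (f g : R -> R) M : measurable D -> square_integrable D f ->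
  measurable_fun D g -> (forall x, D x -> `|g x| <= M) ->
  square_integrable D (fun x => g x * f x).
Proof.
move=> mD [mf f2] mg gM; split; first exact: measurable_funM.
have mg2 : measurable_fun D (fun x => g x ^+ 2) by exact: measurable_funX.
have := @L1_mul_bounded R D (fun x => f x ^+ 2) (fun x => g x ^+ 2) (M ^+ 2) mD f2 mg2.
move=> H; have {}H := H _; apply: eq_L1 (H _) => //.
  by move=> x _; rewrite exprMn mulrC.
move=> x Dx; have := gM x Dx; rewrite normrX => gx.
by rewrite lerXn2r// nnegrE// (le_trans _ gx).
Qed.

Lemma weak_derivativeD (u g u' g' : R -> R) : square_integrable setT u -> square_integrable setT g ->
  square_integrable setT u' -> square_integrable setT g' ->
  is_weak_derivative setT u g -> is_weak_derivative setT u' g' ->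
  is_weak_derivative setT (fun x => u x + u' x) (fun x => g x + g' x).
Proof.
move=> su sg su' sg' wu wu' phi tphi.
have sphi := test_function_L2 tphi; have sdphi := test_function_L2 (derive1_test_function tphi).
under eq_Rintegral do rewrite mulrDl.
under [X in _ = - X]eq_Rintegral do rewrite mulrDl.
rewrite !RintegralD//; [|exact: L2_mul..].
by rewrite wu// wu'// opprD.
Qed.

Lemma smooth_dilate (f : R -> R) c : smooth f -> smooth (fun x => f (c * x)).
Proof.
move=> sf; have := @smooth_affine _ f 1 c 0 sf; congr smooth.
by apply/funext => x; rewrite mul1r addr0.
Qed.

Lemma derive1_dilate (f : R -> R) c : smooth f ->
  derive1 (fun x => f (c * x)) = (fun x => c * derive1 f (c * x)).
Proof.
move=> sf; apply/funext => x; rewrite derive1E.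
have dc := is_deriveZ c (is_derive_id x (1 : R)).
have dfc : is_derive x 1 (fun y : R => f (c * y)) (derive1 f (c * x) * c).
  have := @is_derive1_comp R f (fun y : R => c * y) x (derive1 f (c * x)) c (smooth_is_derive sf _).
  by apply; move: dc; rewrite /GRing.scale/= mulr1.
by rewrite (derive_val (is_derive := dfc)) mulrC.
Qed.

(** The value 1 at 0 makes the dilated profiles psi (c x) converge pointwise
    to 1 as c tends to 0. *)
Lemma exists_cutoff_profile : exists2 psi : R -> R, test_function `[-2, 2] psi & psi 0 = 1.
Proof.
have b0 : 0 < @bell R 2^-1 by apply: bell_gt0; lra.
exists (fun x => (bell 2^-1)^-1 * bell (4^-1 * x + 2^-1)); last first.
  by rewrite mulr0 add0r mulVf// gt_eqF.
split; first by apply: smooth_affine; exact: smooth_bell.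
exists `[-2, 2]%classic; first by split => //; exact: segment_compact.
move=> x /negP; rewrite in_itv/= negb_and -!ltNge => /orP[x2|x2].
  have h : 4^-1 * x + 2^-1 <= 0 by lra.
  by rewrite (bell_left h) mulr0.
have h : 1 <= 4^-1 * x + 2^-1 by lra.
by rewrite (bell_right h) mulr0.
Qed.

(** The product of v with the dilated profile psi (c x), and its first two
    derivatives by the Leibniz rule, with v1 and v2 in the place of v' and
    v''. *)
Definition cut0 (psi v : R -> R) (c x : R) : R := psi (c * x) * v x.
Definition cut1 (psi v v1 : R -> R) (c x : R) : R := psi (c * x) * v1 x + c * derive1 psi (c * x) * v x.
Definition cut2 (psi v v1 v2 : R -> R) (c x : R) : R :=
  psi (c * x) * v2 x + 2 * c * derive1 psi (c * x) * v1 x + c ^+ 2 * derive1 (derive1 psi) (c * x) * v x.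

(** The hypothesis 2 < c r puts the support of psi (c x) inside ]-r, r[, so
    the truncated function is clamped there and its energy and mass are
    integrals over the whole line. *)
Lemma cutoff_clamped (psi v v1 v2 : R -> R) (c r q : R) : test_function `[-2, 2] psi -> 0 < c -> 2 < c * r -> 0 < r -> 1 < q ->
  square_integrable setT v -> square_integrable setT v1 -> square_integrable setT v2 ->
  is_weak_derivative setT v v1 -> is_weak_derivative setT v1 v2 ->
  [/\ clamped r (cut2 psi v v1 v2 c),
    energy r (cut2 psi v v1 v2 c) = \int[mu]_x (2 * cut1 psi v v1 c x ^+ 2 - cut2 psi v v1 v2 c x ^+ 2) &
    mass r q (cut2 psi v v1 v2 c) = \int[mu]_x Gq q (cut0 psi v c x)].
Proof.
move=> t0 c0 cr r0 q1 sv sv1 sv2 w1 w2.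
have t1 := derive1_test_function t0; have t2 := derive1_test_function t1.
have s0 := test_function_smooth t0; have s1 := test_function_smooth t1; have s2 := test_function_smooth t2.
have LM (f u : R -> R) k : test_function `[-2, 2] f -> square_integrable setT u ->
    square_integrable setT (fun x => k * f (c * x) * u x).
  move=> tf su; have [B HB] := test_function_bounded tf.
  apply: (@L2_mul_bounded _ _ _ (`|k| * B)) => //.
    apply: measurable_funM => //; apply: continuous_measurable_fun.
    by apply: smooth_continuous; apply: smooth_dilate; exact: test_function_smooth tf.
  by move=> x _; rewrite normrM ler_wpM2l.
have LM1 (f u : R -> R) : test_function `[-2, 2] f -> square_integrable setT u ->
    square_integrable setT (fun x => f (c * x) * u x).
  move=> tf su; have := LM _ _ 1 tf su.
  by congr square_integrable; apply/funext => x; rewrite mul1r.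
have S0 : square_integrable setT (cut0 psi v c) by exact: LM1.
have S1 : square_integrable setT (cut1 psi v v1 c) by apply: L2D => //; [exact: LM1|exact: LM].
have S2 : square_integrable setT (cut2 psi v v1 v2 c).
  by apply: L2D => //; [apply: L2D => //; [exact: LM1|exact: LM]|exact: LM].
have W1 : is_weak_derivative setT (cut0 psi v c) (cut1 psi v v1 c).
  have := weak_derivativeM (smooth_dilate (c := c) s0) sv sv1 w1.
  by rewrite (derive1_dilate c s0).
have W2 : is_weak_derivative setT (cut1 psi v v1 c) (cut2 psi v v1 v2 c).
  have Wa := weak_derivativeM (smooth_dilate (c := c) s0) sv1 sv2 w2.
  have sc : smooth (fun x : R => c * derive1 psi (c * x)).
    by rewrite -(derive1_dilate c s0); apply: smooth_derive1; exact: smooth_dilate s0.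
  have Wb := weak_derivativeM sc sv sv1 w1.
  have dE : derive1 (fun x : R => c * derive1 psi (c * x)) = (fun x => c ^+ 2 * derive1 (derive1 psi) (c * x)).
    apply/funext => x; rewrite derive1E.
    have ds := smooth_is_derive (smooth_dilate (c := c) s1) x.
    rewrite (derive1_dilate c s1) in ds.
    by rewrite (derive_val (is_derive := is_deriveZ c ds)) /GRing.scale/= expr2 mulrA.
  rewrite (derive1_dilate c s0) in Wa; rewrite dE in Wb.
  have Sa : square_integrable setT (fun x => psi (c * x) * v2 x + c * derive1 psi (c * x) * v1 x).
    by apply: L2D => //; [exact: LM1|exact: LM].
  have Sb : square_integrable setT (fun x => c * derive1 psi (c * x) * v1 x + c ^+ 2 * derive1 (derive1 psi) (c * x) * v x).
    by apply: L2D => //; exact: LM.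
  have := weak_derivativeD (LM1 _ _ t0 sv1) Sa (LM _ _ c t1 sv) Sb Wa Wb.
  by congr is_weak_derivative; apply/funext => x; rewrite /cut2; ring.
have Z (f : R -> R) x : test_function `[-2, 2] f -> r <= `|x| -> f (c * x) = 0.
  move=> tf rx; apply: (test_function_out tf); rewrite /= in_itv/= -ler_norml normrM (gtr0_norm c0).
  by apply/negP; rewrite -ltNge (lt_le_trans cr)// ler_pM2l.
have Z0 x : r <= `|x| -> cut0 psi v c x = 0 by move=> rx; rewrite /cut0 Z// mul0r.
have Z1 x : r <= `|x| -> cut1 psi v v1 c x = 0 by move=> rx; rewrite /cut1 !Z// mulr0 !mul0r addr0.
have Z2 x : r <= `|x| -> cut2 psi v v1 v2 c x = 0 by move=> rx; rewrite /cut2 !Z// !mulr0 !mul0r !addr0.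
have [E1 P1] := prim_of_weak_compact r0 S0 S1 W1 Z0 Z1.
have [E2 P2] := prim_of_weak_compact r0 S1 S2 W2 Z1 Z2.
have lr : - r <= r by rewrite ge0_cp// ltW.
have mC : measurable (`[- r, r]%classic : set R) by exact: measurable_itv.
have oc : `]- r, r[%classic `<=` (`[- r, r]%classic : set R) by exact: subset_itv_oo_cc.
have C2 : square_integrable `[- r, r] (cut2 psi v v1 v2 c) by apply: square_integrable_sub S2.
have C1 : square_integrable `[- r, r] (cut1 psi v v1 c) by apply: square_integrable_sub S1.
have C2' := L2L1 C2; have C1' := L2L1 C1.
have EE x : x <= r -> prim (- r) (prim (- r) (cut2 psi v v1 v2 c)) x = prim (- r) (cut1 psi v v1 c) x.
  move=> xr; apply: eq_prim_ae xr => //; first exact: L1_prim.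
  by apply: ae_imp E2 => t H /H ->.
have loc (f g : R -> R) : mu.-integrable `[- r, r] (EFin \o f) -> measurable_fun setT g ->
    {ae mu, forall x, - r < x < r -> g x = f x} -> (forall x, r <= `|x| -> g x = 0) ->
    \int[mu]_(x in `[- r, r]) f x = \int[mu]_x g x.
  move=> f1 mg fg g0; rewrite -Rintegral_oo_cc//.
  rewrite [RHS](@Rintegral_widen _ `]- r, r[ setT)//; last first.
    move=> x xr; apply: g0; rewrite leNgt; apply/negP; rewrite ltr_norml => xlr.
    by apply: xr; rewrite /= in_itv.
  apply: ae_eq_Rintegral => //.
  - exact: measurable_funS oc (L1_measurable f1).
  - exact: measurable_funTS.
  - by apply: ae_imp fg => x H; rewrite /= in_itv/= => /H.
split.
- by split => //; rewrite EE.
- rewrite /energy /ip -RintegralZl//; last exact: L2_mul (L2I r0 C2) (L2I r0 C2).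
  rewrite -RintegralB//; [|by apply: L1Z => //; exact: L2_mul (L2I r0 C2) (L2I r0 C2)|exact: L2_mul].
  apply: loc.
  + by apply: L1B => //; [apply: L1Z => //; exact: L2_mul (L2I r0 C2) (L2I r0 C2)|exact: L2_mul].
  + apply: measurable_funB; [apply: measurable_funM => //|]; apply: measurable_funX.
      by case: S1.
    by case: S2.
  + by apply: ae_imp E2 => x H xlr; rewrite H// !expr2.
  + by move=> x rx; rewrite Z1// Z2// expr0n /= mulr0 subr0.
- apply: loc.
  + exact: L1G (L2I r0 (L2I r0 C2)).
  + have -> : (fun x => Gq q (cut0 psi v c x)) = (fun x => gq q (cut0 psi v c x) * cut0 psi v c x).
      by apply/funext => x; rewrite gq_mul.
    have m0 : measurable_fun setT (cut0 psi v c) by case: S0.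
    apply: measurable_funM => //; apply: (measurableT_comp _ m0).
    by apply: continuous_measurable_fun; exact: gq_cont.
  + apply: ae_imp E1 => x H xlr; rewrite (H xlr) EE; first by [].
    by case/andP: xlr => _ /ltW.
  + by move=> x rx; rewrite (Z0 _ rx) -gq_mul mulr0.
Qed.

(** The weights p, s, w stand for psi (c x), c psi' (c x) and c^2 psi'' (c
    x), uniformly bounded by some B for c <= 1; the right-hand side is then
    a dominating function independent of c. *)
Lemma energy_density_le (B p s w x y z : R) : `|p| <= B -> `|s| <= B -> `|w| <= B ->
  `|2 * (p * y + s * x) ^+ 2 - (p * z + 2 * s * y + w * x) ^+ 2| <= 16 * B ^+ 2 * (x ^+ 2 + y ^+ 2 + z ^+ 2).
Proof.
move=> pB sB wB; have B0 : 0 <= B by exact: le_trans pB.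
have sq (a b : R) : `|a| <= B -> (a * b) ^+ 2 <= B ^+ 2 * b ^+ 2.
  by move=> aB; rewrite exprMn ler_wpM2r ?sqr_ge0// -[a ^+ 2]real_normK ?num_real// lerXn2r ?nnegrE.
have := sq p y pB; have := sq p z pB; have := sq s x sB; have := sq s y sB; have := sq w x wB.
have X := sqr_ge0 x; have Y := sqr_ge0 y; have Z := sqr_ge0 z; have BB := sqr_ge0 B.
have := mulr_ge0 BB X; have := mulr_ge0 BB Y; have := mulr_ge0 BB Z.
move: (B ^+ 2) (x ^+ 2) (y ^+ 2) (z ^+ 2) => b x2 y2 z2.
rewrite -[2 * s * y]mulrA.
move: (p * y) (p * z) (s * x) (s * y) (w * x) => py pz sx sy wx.
move=> h1 h2 h3 h4 h5 h6 h7 h8; rewrite ler_norml.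
have := sqr_ge0 (py - sx); have := sqr_ge0 (py + sx).
have := sqr_ge0 (pz + 2 * sy + wx); have := sqr_ge0 (pz - 2 * sy).
have := sqr_ge0 (pz - wx); have := sqr_ge0 (2 * sy - wx).
move=> *; apply/andP; split; lra.
Qed.

Lemma cutoff_cvg (f : R -> R) (x : R) : smooth f -> f (n.+1%:R^-1 * x) @[n --> \oo] --> f 0.
Proof.
move=> sf; have : (n.+1%:R^-1 : R) * x @[n --> \oo] --> (0 : R).
  by rewrite -[X in _ --> X](mul0r x); apply: cvgMl; exact: cvg_harmonic.
move=> H; have sc : continuous f by exact: smooth_continuous.
exact: cvg_comp H (sc 0).
Qed.

(** Dominated convergence as the dilation factor tends to 0: the terms with
    a derivative of the profile carry a factor c. *)
Lemma cutoff_limits (psi v v1 v2 : R -> R) (q : R) : test_function `[-2, 2] psi -> psi 0 = 1 -> 1 < q ->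
  square_integrable setT v -> square_integrable setT v1 -> square_integrable setT v2 ->
  (\int[mu]_x (2 * cut1 psi v v1 n.+1%:R^-1 x ^+ 2 - cut2 psi v v1 v2 n.+1%:R^-1 x ^+ 2)) @[n --> \oo] -->
    \int[mu]_x (2 * v1 x ^+ 2 - v2 x ^+ 2) /\
  (\int[mu]_x Gq q (cut0 psi v n.+1%:R^-1 x)) @[n --> \oo] --> \int[mu]_x Gq q (v x).
Proof.
move=> t0 psi0 q1 [mv iv] [mv1 iv1] [mv2 iv2].
have t1 := derive1_test_function t0; have t2 := derive1_test_function t1.
have s0 := test_function_smooth t0; have s1 := test_function_smooth t1; have s2 := test_function_smooth t2.
have [B0 H0] := test_function_bounded t0; have [B1 H1] := test_function_bounded t1.
have [B2 H2] := test_function_bounded t2.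
pose B := B0 + B1 + B2.
have p0 : 0 <= B0 by exact: le_trans (H0 0).
have p1 : 0 <= B1 by exact: le_trans (H1 0).
have p2 : 0 <= B2 by exact: le_trans (H2 0).
have K0 x : `|psi x| <= B by rewrite (le_trans (H0 x))// /B; lra.
have K1 x : `|derive1 psi x| <= B by rewrite (le_trans (H1 x))// /B; lra.
have K2 x : `|derive1 (derive1 psi) x| <= B by rewrite (le_trans (H2 x))// /B; lra.
have B_0 : 0 <= B by rewrite /B; lra.
have mf (f : R -> R) (c : R) : smooth f -> measurable_fun setT (fun x => f (c * x)).
  by move=> sf; apply: continuous_measurable_fun; apply: smooth_continuous; exact: smooth_dilate.
have m0 c : measurable_fun setT (cut0 psi v c) by apply: measurable_funM => //; exact: mf.
have m1 c : measurable_fun setT (cut1 psi v v1 c).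
  apply: measurable_funD; first by apply: measurable_funM => //; exact: mf.
  by apply: measurable_funM => //; apply: measurable_funM => //; exact: mf.
have m2 c : measurable_fun setT (cut2 psi v v1 v2 c).
  apply: measurable_funD; [apply: measurable_funD|].
  - by apply: measurable_funM => //; exact: mf.
  - by apply: measurable_funM => //; apply: measurable_funM => //; exact: mf.
  - by apply: measurable_funM => //; apply: measurable_funM => //; exact: mf.
have mG (u : R -> R) : measurable_fun setT u -> measurable_fun setT (fun x => Gq q (u x)).
  move=> mu'; have -> : (fun x => Gq q (u x)) = (fun x => gq q (u x) * u x).
    by apply/funext => x; rewrite gq_mul.
  apply: measurable_funM => //; apply: (measurableT_comp _ mu').
  by apply: continuous_measurable_fun; exact: gq_cont.
have cn n : 0 < (n.+1%:R^-1 : R) <= 1 by rewrite invr_gt0 ltr0n /= invf_le1 ?ltr0n// ler1n.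
have c0 : (n.+1%:R^-1 : R) @[n --> \oo] --> (0 : R) by exact: cvg_harmonic.
have k0 x : psi (n.+1%:R^-1 * x) @[n --> \oo] --> (1 : R).
  by have := cutoff_cvg x s0; rewrite psi0.
have k1 x := cutoff_cvg x s1.
have k2 x := cutoff_cvg x s2.
have cst (a : R) : (fun _ : nat => a) @ \oo --> a by exact: cvg_cst.
have l0 (x : R) : cut0 psi v n.+1%:R^-1 x @[n --> \oo] --> v x.
  by have H := cvgM (k0 x) (cst (v x)); rewrite mul1r in H; exact: H.
have l1 (x : R) : cut1 psi v v1 n.+1%:R^-1 x @[n --> \oo] --> v1 x.
  have := cvgD (cvgM (k0 x) (cst (v1 x))) (cvgM (cvgM c0 (k1 x)) (cst (v x))).
  by rewrite mul1r !mul0r addr0 => H; exact: H.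
have l2 (x : R) : cut2 psi v v1 v2 n.+1%:R^-1 x @[n --> \oo] --> v2 x.
  have E : v2 x = 1 * v2 x + 2 * 0 * derive1 psi 0 * v1 x + 0 * 0 * derive1 (derive1 psi) 0 * v x by ring.
  rewrite [X in _ --> X]E; apply: cvgD; [apply: cvgD|]; (apply: cvgM; last exact: cst).
  - exact: k0.
  - by apply: cvgM; [apply: cvgM; [exact: cst|exact: c0]|exact: k1].
  - by apply: cvgM; [exact: (cvgM c0 c0)|exact: k2].
pose g x := v x ^+ 2 + v1 x ^+ 2 + v2 x ^+ 2.
have ig : mu.-integrable setT (EFin \o (fun x => 16 * B ^+ 2 * g x)).
  by apply: L1Z => //; apply: L1D => //; exact: L1D.
have iv' : mu.-integrable setT (EFin \o (fun x => q * B ^+ 2 * v x ^+ 2)) by exact: L1Z.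
split.
  refine (proj2 (@Rintegral_dominated R setT (fun n x => 2 * cut1 psi v v1 n.+1%:R^-1 x ^+ 2 - cut2 psi v v1 v2 n.+1%:R^-1 x ^+ 2)
    (fun x => 2 * v1 x ^+ 2 - v2 x ^+ 2) _ measurableT _ _ _ ig _)).
  - move=> n; apply: measurable_funB; last exact: measurable_funX.
    by apply: measurable_funM => //; exact: measurable_funX.
  - apply: measurable_funB; last exact: measurable_funX.
    by apply: measurable_funM => //; exact: measurable_funX.
  - move=> x _; apply: cvgB; last exact: (cvgM (l2 x) (l2 x)).
    by apply: cvgM; [exact: cst|exact: (cvgM (l1 x) (l1 x))].
  - move=> n x _; have /andP[p0' p1'] := cn n.
    have Z (k f : R) : 0 <= k <= 1 -> `|f| <= B -> `|k * f| <= B.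
      move=> /andP[h0 h1] fB; rewrite normrM ger0_norm// (le_trans _ fB)//.
      by rewrite ler_piMl.
    rewrite /cut1 /cut2 -(mulrA 2); apply: energy_density_le => //; apply: Z => //.
      by rewrite ltW.
    by rewrite exprn_ge0 ?exprn_ile1 // ltW.
refine (proj2 (@Rintegral_dominated R setT (fun n x => Gq q (cut0 psi v n.+1%:R^-1 x))
    (fun x => Gq q (v x)) _ measurableT _ _ _ iv' _)).
- by move=> n; exact: mG.
- exact: mG.
- move=> x _; rewrite -gq_mul; under eq_fun do rewrite -gq_mul.
  have cg : continuous (gq q) by exact: gq_cont.
  by apply: cvgM => //; exact: (cvg_comp _ _ (l0 x) (cg (v x))).
- move=> n x _; rewrite ger0_norm; last by rewrite (le_trans _ (Gq_ge q1 _))// sqr_ge0.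
  rewrite (le_trans (Gq_le q1 _))// -mulrA ler_pM2l; last by rewrite (lt_trans _ q1).
  by rewrite /cut0 exprMn ler_wpM2r ?sqr_ge0// -real_normK ?num_real// lerXn2r ?nnegrE.
Qed.

Lemma L1_Gq (q : R) (v : R -> R) : 1 < q -> square_integrable setT v ->
  mu.-integrable setT (EFin \o (fun x => Gq q (v x))).
Proof.
move=> q1 [mv iv]; apply: le_integrable (L1Z q measurableT iv) => //.
  apply/measurable_EFinP; have -> : (fun x => Gq q (v x)) = (fun x => gq q (v x) * v x).
    by apply/funext => x; rewrite gq_mul.
  apply: measurable_funM => //; apply: (measurableT_comp _ mv).
  by apply: continuous_measurable_fun; exact: gq_cont.
move=> x _ /=; rewrite lee_fin !ger0_norm.
- exact: Gq_le.
- by rewrite mulr_ge0 ?sqr_ge0// (le_trans ler01)// ltW.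
- by rewrite (le_trans _ (Gq_ge q1 _))// sqr_ge0.
Qed.

Lemma Rintegral_Gq_gt0 (q : R) (v : R -> R) : 1 < q -> square_integrable setT v ->
  ~ {ae mu, forall x, v x = 0} -> 0 < \int[mu]_x Gq q (v x).
Proof.
move=> q1 sv nv; rewrite ltNge; apply/negP => M0; apply: nv.
have [mv iv] := sv; have iG := L1_Gq q1 sv.
have v0 : \int[mu]_x (v x ^+ 2) <= \int[mu]_x Gq q (v x).
  by apply: le_Rintegral => // x _; exact: Gq_ge.
have v1 : 0 <= \int[mu]_x (v x ^+ 2) by apply: Rintegral_ge0 => x _; exact: sqr_ge0.
have v2 : \int[mu]_x (v x ^+ 2) = 0 by apply/eqP; rewrite eq_le v1 (le_trans v0 M0).
have [+ _] := @ae_eq_integral_abs _ _ _ mu setT measurableT (fun x => (v x ^+ 2)%:E) (measurable_int _ iv).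
have -> : (\int[mu]_x `|(v x ^+ 2)%:E| = 0)%E.
  rewrite -[RHS]/((0 : R)%:E) -v2 -(L1_EFin measurableT iv); apply: eq_integral => x _.
  by rewrite /= ger0_norm// sqr_ge0.
move=> /(_ erefl); apply: ae_imp => x /(_ I)/= [] /eqP.
by rewrite sqrf_eq0 => /eqP.
Qed.

(** J (q b) b v = 0 says that the energy of v over the line is b times its
    mass. Truncations of v are admissible on intervals of length tending to
    infinity, so they have energy at most S times their mass, and this
    passes to the limit; the mass of v is positive because v is not zero
    almost everywhere. *)
Lemma J_zero_le (q b S : R) (v : R -> R) : 1 < q -> 0 < b -> sobolevH2 setT v ->
  ~ {ae mu, forall x, v x = 0} -> J (q * b) b v = 0 ->
  (forall r, Num.sqrt 2 * pi / 2 < r -> sup (energy_values r q) <= S) -> b <= S.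
Proof.
move=> q1 b0 [Hv Hv1] nv J0 HS.
have [sv _] := Hv; have [sv1 wv1] := H1_wderiv Hv; have [sv2 wv2] := H1_wderiv Hv1.
have M0 := Rintegral_Gq_gt0 q1 sv nv.
have [psi tpsi psi0] := exists_cutoff_profile.
have [limE limM] := cutoff_limits tpsi psi0 q1 sv sv1 sv2.
have [_ iv1] := sv1; have [_ iv2] := sv2.
have iE : mu.-integrable setT (EFin \o (fun x => 2 * wderiv setT v x ^+ 2 - wderiv setT (wderiv setT v) x ^+ 2)).
  by apply: L1B => //; exact: L1Z.
have iG := L1_Gq q1 sv.
have EbM : \int[mu]_x (2 * wderiv setT v x ^+ 2 - wderiv setT (wderiv setT v) x ^+ 2) = b * \int[mu]_x Gq q (v x).
  apply/eqP; rewrite eq_sym -subr_eq0 -RintegralZl// -RintegralB//; last exact: L1Z.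
  rewrite -[X in _ == X]J0; apply/eqP; apply: eq_Rintegral => x _.
  by rewrite /Gq /funrpos /funrneg; ring.
rewrite -(ler_pM2r M0) -EbM.
apply: ler_cvg_to limE (cvgM (cvg_cst S) limM) _ => //.
apply: nearW => n /=.
(* At least 5, which exceeds sqrt 2 pi / 2, and more than 2 / c for the
   dilation factor c = 1 / (n + 1). *)
pose r : R := 2 * n.+1%:R + 3.
have n0 : 0 < n.+1%:R :> R by rewrite ltr0n.
have n_ge1 : 1 <= n.+1%:R :> R by rewrite ler1n.
have r0 : 0 < r by rewrite /r; lra.
have cr : 2 < n.+1%:R^-1 * r by rewrite mulrC ltr_pdivlMr//; rewrite /r; lra.
have c0 : 0 < n.+1%:R^-1 :> R by rewrite invr_gt0.
have rpi : Num.sqrt 2 * pi / 2 < r.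
  have s2 : Num.sqrt (2 : R) <= 2.
    by rewrite -(@ler_pXn2r _ 2) ?nnegrE ?sqrtr_ge0// sqr_sqrtr//; lra.
  have /andP[p0 p2] := @pihalf_02 R.
  apply: (@le_lt_trans _ _ (2 * 2)); last by rewrite /r; lra.
  by rewrite -mulrA ler_pM ?sqrtr_ge0// ltW.
have [Cl eE mE] := cutoff_clamped tpsi c0 cr r0 q1 sv sv1 sv2 wv1 wv2.
have [hs s0] := has_sup_values r0 q1 rpi.
rewrite -eE -mE; apply: le_trans (energy_le_sup r0 q1 hs s0 Cl) _.
by rewrite ler_wpM2r ?HS// mass_ge0.
Qed.

End Whole.

Local Open Scope classical_set_scope.
Local Open Scope ring_scope.

Theorem proposition7 (R : realType) :
  (forall r q : R, Num.sqrt 2 * pi / 2 < r -> 1 < q ->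
    exists2 m : R, is_max (fucik_ray r q) m & beta_star_r r q = m%:E) /\
  (forall q : R, 1 < q ->
    beta_star q =
    ereal_sup [set m%:E | m in [set m : R |
      exists2 r : R, Num.sqrt 2 * pi / 2 < r & is_max (fucik_ray r q) m]]).
Proof.
have pos (r : R) : Num.sqrt 2 * pi / 2 < r -> 0 < r.
  by apply: le_lt_trans; rewrite divr_ge0// mulr_ge0 ?sqrtr_ge0// pi_ge0.
split=> [r q rpi q1|q q1].
  by have [] := fucik_max (pos _ rpi) q1 rpi; exists (sup (energy_values r q)).
apply/eqP; rewrite eq_le; apply/andP; split.
- apply: ge_ereal_sup => _ [b [b0 [v [Hv nv Jv]]] <-].
  set X := ereal_sup _.
  have HX (r : R) : Num.sqrt 2 * pi / 2 < r -> ((sup (energy_values r q))%:E <= X)%E.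
    move=> rpi; apply: ereal_sup_ubound; exists (sup (energy_values r q)) => //.
    by exists r => //; case: (fucik_max (pos _ rpi) q1 rpi).
  case: X HX => [S HX|HX|HX].
  + rewrite lee_fin; apply: (J_zero_le q1 b0 Hv nv Jv) => r rpi.
    by rewrite -lee_fin HX.
  + exact: leey.
  + by have := HX (Num.sqrt 2 * pi / 2 + 1); rewrite ltrDl ltr01 leeNy_eq => /(_ isT).
- apply: ge_ereal_sup => _ [m [r rpi [fm _]] <-].
  have r0 := pos _ rpi; have [m0 _] := fm.
  have [h [Ch M0 eh]] := fucik_ray_value r0 q1 fm.
  have [v [Hv nv Jv]] := zero_extension_J r0 q1 Ch M0 eh.
  by apply: ereal_sup_ubound; exists m => //; split => //; exists v.
Qed.
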